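(* Let $A=(KQ/\mathcal{I},\leqslant)$ be a 1-quasi-hereditary algebra and $i\in Q_0$. The following statements are equivalent: (i) $A(i)$ is 1-quasi-hereditary; (ii) $T(i)\cong P(1)/\left(\sum_{l\in Q_0\setminus\Lambda_{(i)}}P(l)\right)$; (ii') $T(i)\cong\bigcap_{l\in Q_0\setminus\Lambda_{(i)}}\operatorname{Ker}(I(1)\twoheadrightarrow I(l))$; (iii) $\operatorname{soc}T(i)$ is simple; (iii') $\operatorname{top}T(i)$ is simple.
   Context: $K$ is an algebraically closed field, $Q$ is a finite quiver with vertex set $Q_0$, and $KQ/\mathcal{I}$ is a finite-dimensional bound quiver algebra ($\mathcal{I}$ an admissible ideal). Modules are finite-dimensional left modules. For $i\in Q_0$, $e_i$ is the trivial path at $i$, and $S(i)$, $P(i)$, $I(i)$ denote the simple, projective indecomposable and injective indecomposable module at $i$; $[M:S(i)]$ is the Jordan-Hölder multiplicity. Let $\leqslant$ be a partial order on $Q_0$. The standard module $\Delta(i)$ is the largest factor module of $P(i)$ with $[\Delta(i):S(j)]=0$ for all $j\not\leqslant i$; the costandard module $\nabla(i)$ is the largest submodule of $I(i)$ with $[\nabla(i):S(j)]=0$ for all $j\not\leqslant i$. $\mathfrak{F}(\Delta)$ (resp. $\mathfrak{F}(\nabla)$) is the full subcategory of modules having a filtration with all subquotients isomorphic to standard (resp. costandard) modules; $(M:\Delta(i))$ (resp. $(M:\nabla(i))$) is the (well-defined) number of subquotients isomorphic to $\Delta(i)$ (resp. $\nabla(i)$). $(KQ/\mathcal{I},\leqslant)$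 is quasi-hereditary if for all $i,j\in Q_0$: $[\Delta(i):S(i)]=1$, and $P(i)\in\mathfrak{F}(\Delta)$ with $(P(i):\Delta(j))=0$ for $j\not\geqslant i$ and $(P(i):\Delta(i))=1$. A quasi-hereditary algebra $A=(KQ/\mathcal{I},\leqslant)$ is 1-quasi-hereditary if for all $i,j\in Q_0=\{1,\ldots,n\}$: (1) there is a smallest and a largest element with respect to $\leqslant$, denoted (up to relabelling) $1$ and $n$ respectively; (2) $[\Delta(i):S(j)]=(P(j):\Delta(i))=1$ for $j\leqslant i$; (3) $\operatorname{soc}P(j)\cong\operatorname{top}I(j)\cong S(1)$; (4) there are an injection $\Delta(i)\hookrightarrow\Delta(n)$ and a surjection $\nabla(n)\twoheadrightarrow\nabla(i)$. $\Lambda_{(i)}=\{j\in Q_0\mid j\leqslant i\}$. $A(i):=A/J(i)$ with $J(i):=A\left(\sum_{j\in Q_0\setminus\Lambda_{(i)}}e_j\right)A$; its quiver has vertex set $\Lambda_{(i)}$, and $(A(i),\leqslant)$, with $\leqslant$ restricted to $\Lambda_{(i)}$, is quasi-hereditary (smallest vertex $1$, largest vertex $i$). For $i\in Q_0$, $T(i)$ is the (unique up to isomorphism) indecomposable $A$-module in $\mathfrak{F}(\Delta)\cap\mathfrak{F}(\nabla)$ with $(T(i):\Delta(j))=(T(i):\nabla(j))=[T(i):S(j)]=0$ for $j\not\leqslant i$ and $(T(i):\Delta(i))=(T(i):\nabla(i))=[T(i):S(i)]=1$ (the direct summand of the characteristic tilting module at $i$). For every $l\in Q_0$ there is a unique submodule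 of $P(1)$ isomorphic to $P(l)$, and $P(l)$ is regarded as this submodule; dually, there is a surjection $I(1)\twoheadrightarrow I(l)$ and its kernel does not depend on the choice of surjection. The empty sum is $0$ and the empty intersection is $I(1)$. *)

(* Defs.v *)
From HB Require Import structures.
From mathcomp Require Import all_boot all_order all_algebra all_field.
From mathcomp Require Import boolp.
From mathcomp Require Import monalg.

Set Implicit Arguments.
Unset Strict Implicit.
Unset Printing Implicit Defensive.

Import Order.TTheory GRing.Theory.
Local Open Scope ring_scope.

(* V/U is carried by a complement U^C of U; the canonical map V -> V/U is the
   projection onto U^C along U, and [vsval] is a linear section of it. *)
Section QuotientSpace.
Context {K : fieldType} {V : vectType K}.
Implicit Types (U : {vspace V}) (v : V).

Definition quotvs U := subvs_of (U^C)%VS.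

Definition qproj U : 'Hom(V, quotvs U) :=
  (linfun (vsproj (U^C)%VS) \o daddv_pi (U^C)%VS U)%VF.

Let disjC U : (U^C :&: U = 0)%VS.
Proof. by rewrite capvC capv_compl. Qed.

Lemma val_qproj U v : vsval (qproj U v) = daddv_pi (U^C)%VS U v.
Proof. by rewrite /qproj comp_lfunE lfunE /= vsprojK ?memv_pi. Qed.

Lemma qproj_val U (x : quotvs U) : qproj U (vsval x) = x.
Proof. by apply: val_inj; rewrite /= val_qproj daddv_pi_id ?subvsP. Qed.

Lemma qproj_sub U v : vsval (qproj U v) - v \in U.
Proof.
have Dv : v = daddv_pi (U^C)%VS U v + daddv_pi U (U^C)%VS v.
  by rewrite daddv_pi_add // addvC addv_complf memvf.
by rewrite val_qproj {2}Dv opprD addrA subrr sub0r memvN memv_pi.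
Qed.

Lemma qproj_eq0 U v : (qproj U v == 0) = (v \in U).
Proof.
apply/eqP/idP => [q0|Uv].
  by have := qproj_sub U v; rewrite q0 linear0 sub0r memvN.
apply: val_inj; apply/eqP; rewrite -memv0 -(disjC U).
rewrite memv_cap subvsP /=.
by have := memvD (qproj_sub U v) Uv; rewrite subrK.
Qed.

Lemma qproj_eq U v w : v - w \in U -> qproj U v = qproj U w.
Proof. by rewrite -qproj_eq0 linearB subr_eq0 => /eqP. Qed.

End QuotientSpace.

Lemma vspace_of_pred (K : fieldType) (V : vectType K) (S : V -> Prop) :
  S 0 -> (forall a u v, S u -> S v -> S (a *: u + v)) ->
  exists U : {vspace V}, forall v, v \in U <-> S v.
Proof.
move=> S0 SL.
suff H n : forall U : {vspace V}, (forall v, v \in U -> S v) ->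
    (\dim (U^C)%VS <= n)%N -> exists W : {vspace V}, forall v, v \in W <-> S v.
  by apply: (H _ 0%VS _ (leqnn _)) => v /[!memv0] /eqP->.
elim: n => [|n IHn] U US dU.
  exists U => v; split=> [/US//|_].
  move: dU; rewrite leqn0 dimv_eq0 => /eqP U0.
  by have := memvf v; rewrite -(addv_complf U) U0 addv0.
have [[v [Sv Uv]]|nv] := pselect (exists v, S v /\ v \notin U); last first.
  exists U => v; split=> [/US//|Sv].
  by apply: contra_notT nv => Uv; exists v.
apply: (IHn (U + <[v]>)%VS) => [w /memv_addP[u Uu [_ /vlineP[k ->] ->]]|].
  by rewrite addrC; apply: SL => //; apply: US.
have := dimv_compl (U + <[v]>)%VS; have := dimv_compl U.
move=> E1 E2; rewrite E2; rewrite E1 in dU.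
have lt : (\dim U < \dim (U + <[v]>)%VS)%N.
  rewrite ltn_neqAle dimvS ?addvSl // andbT.
  apply: contra Uv => /eqP dE.
  have /eqP-> : (U == U + <[v]>)%VS by rewrite eqEdim addvSl dE /=.
  by rewrite (subvP (addvSr U <[v]>)) ?memv_line.
by rewrite -ltnS (leq_trans _ dU) //; apply: ltn_sub2l => //;
   rewrite (leq_trans lt) // dimvS ?subvf.
Qed.

Section Modules.
Context {K : fieldType} {A : falgType K}.

(* Finite-dimensional left modules; K acts through A because [act] is linear in
   its first argument. *)
Record lmodule := LModule {
  lmod_sort :> vectType K;
  act : A -> lmod_sort -> lmod_sort;
  act_linearr : forall a, linear (act a);
  act_linearl : forall u, linear (act^~ u);
  act1 : forall u, act 1 u = u;
  actM : forall a b u, act (a * b) u = act a (act b u)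
}.

Definition modhom (M N : lmodule) (f : 'Hom(M, N)) :=
  forall a u, f (act a u) = act a (f u).

Definition injects (M N : lmodule) :=
  exists f : 'Hom(M, N), modhom f /\ injective f.

Definition surjects (M N : lmodule) :=
  exists f : 'Hom(M, N), modhom f /\ limg f = fullv.

Definition isom (M N : lmodule) :=
  exists f : 'Hom(M, N), modhom f /\ bijective f.

Record submodule (M : lmodule) := Submodule {
  subm_vs :> {vspace M};
  subm_act : forall a u, u \in subm_vs -> act a u \in subm_vs
}.

Section SubQuotient.
Variables (M : lmodule) (U : submodule M).

Definition sub_act (a : A) (x : subvs_of U) : subvs_of U :=
  Subvs (subm_act a (subvsP x)).

Fact sub_act_linearr a : linear (sub_act a).
Proof. by move=> k x y; apply: val_inj; rewrite /= act_linearr. Qed.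
Fact sub_act_linearl x : linear (sub_act^~ x).
Proof. by move=> k a b; apply: val_inj; rewrite /= act_linearl. Qed.
Fact sub_act1 x : sub_act 1 x = x.
Proof. by apply: val_inj; rewrite /= act1. Qed.
Fact sub_actM a b x : sub_act (a * b) x = sub_act a (sub_act b x).
Proof. by apply: val_inj; rewrite /= actM. Qed.

Definition submod : lmodule :=
  LModule sub_act_linearr sub_act_linearl sub_act1 sub_actM.

Definition quot_act (a : A) (x : quotvs U) : quotvs U :=
  qproj U (act a (vsval x)).

Fact quot_act_linearr a : linear (quot_act a).
Proof. by move=> k x y; rewrite /quot_act linearP act_linearr linearP. Qed.
Fact quot_act_linearl x : linear (quot_act^~ x).
Proof. by move=> k a b; rewrite /quot_act act_linearl linearP. Qed.
Fact quot_act1 x : quot_act 1 x = x.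
Proof. by rewrite /quot_act act1 qproj_val. Qed.
Fact quot_actM a b x : quot_act (a * b) x = quot_act a (quot_act b x).
Proof.
rewrite /quot_act actM; apply: qproj_eq.
have actB c u v : act c (u - v) = act c u - act c v :> M.
  by rewrite addrC -scaleN1r act_linearr scaleN1r addrC.
by rewrite -actB subm_act // -opprB memvN qproj_sub.
Qed.

Definition quotmod : lmodule :=
  LModule quot_act_linearr quot_act_linearl quot_act1 quot_actM.

End SubQuotient.

Section Lattice.
Variable M : lmodule.
Implicit Types (U W : submodule M) (C : submodule M -> Prop).

Fact subm_inf_ex C :
  exists U : {vspace M}, forall v, v \in U <-> (forall W, C W -> v \in W).
Proof.
apply: vspace_of_pred => [W _|a u v Cu Cv W CW]; first exact: mem0v.
by rewrite memvD ?memvZ ?Cu ?Cv.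
Qed.

Fact subm_inf_act C a u :
  u \in sval (cid (subm_inf_ex C)) -> act a u \in sval (cid (subm_inf_ex C)).
Proof.
case: cid => /= U UP /UP Cu; apply/UP => W CW.
by apply: subm_act; apply: Cu.
Qed.

(* Intersection and sum of an arbitrary family of submodules; they are [M] and
   [0] for the empty family. *)
Definition subm_inf C : submodule M := Submodule (@subm_inf_act C).

Definition subm_sup C : submodule M :=
  subm_inf (fun W => forall U, C U -> (U <= W)%VS).

Lemma mem_subm_inf C v : v \in subm_inf C <-> (forall W, C W -> v \in W).
Proof. by rewrite /subm_inf /=; case: cid => /= U ->. Qed.

End Lattice.

Definition simple_mod (M : lmodule) :=
  \dim {:M} <> 0%N /\
  forall U : submodule M, U = 0%VS :> {vspace M} \/ U = fullv :> {vspace M}.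

Definition indecomposable (M : lmodule) :=
  \dim {:M} <> 0%N /\
  forall U W : submodule M, (U + W = fullv)%VS -> (U :&: W = 0)%VS ->
    U = 0%VS :> {vspace M} \/ W = 0%VS :> {vspace M}.

Definition soc (M : lmodule) : submodule M :=
  subm_sup (fun U : submodule M => simple_mod (submod U)).

Definition rad (M : lmodule) : submodule M :=
  subm_inf (fun U : submodule M => simple_mod (quotmod U)).

Definition top (M : lmodule) : lmodule := quotmod (rad M).

(* [filtered F M s]: M has a filtration M = M_0 > M_1 > ... > M_r = 0 with
   M_(k-1) / M_k isomorphic to the module F s_k, where s = [:: s_1; ...; s_r]. *)
Fixpoint filtered (I : Type) (F : I -> lmodule) (M : lmodule) (s : seq I) :
    Prop :=
  if s is i :: s' then
    exists U : submodule M, isom (quotmod U) (F i) /\ filtered F (submod U) s'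
  else \dim {:M} = 0%N.

Definition in_filt (I : Type) (F : I -> lmodule) (M : lmodule) :=
  exists s, filtered F M s.

(* (M : F i) = m.  With F := S this is [M : S(i)] = m: every simple module is
   isomorphic to some S(j), so these filtrations are the composition series. *)
Definition filt_mult (I : eqType) (F : I -> lmodule) (M : lmodule)
    (i : I) (m : nat) :=
  exists s, filtered F M s /\ count_mem i s = m.

Fact mul_linearr (a : A) : linear (fun u : A => a * u).
Proof. by move=> k u v; rewrite mulrDr scalerAr. Qed.
Fact mul_linearl (u : A) : linear (fun a : A => a * u).
Proof. by move=> k a b; rewrite mulrDl scalerAl. Qed.

Definition regmod : lmodule :=
  LModule mul_linearr mul_linearl (@mul1r A) (fun a b u => esym (mulrA a b u)).

Fact lideal_act (e : A) (a : A) (u : regmod) :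
  u \in ({:A} * <[e]>)%VS -> act a u \in ({:A} * <[e]>)%VS.
Proof.
move=> eu; apply: subvP (prodvSl <[e]> (subvf ({:A} * {:A})%VS)) _ _.
by rewrite -prodvA memv_mul ?memvf.
Qed.

Definition lideal (e : A) : submodule regmod := Submodule (@lideal_act e).

(* D(e A) = Hom_K(e A, K), with (a f)(x) = f (x a). *)
Section Dual.
Variable e : A.
Let W := (<[e]> * {:A})%VS.

Definition dual_act (a : A) (f : 'Hom(subvs_of W, K^o)) :
    'Hom(subvs_of W, K^o) :=
  (f \o linfun (vsproj W) \o amulr a \o linfun (@vsval _ _ W))%VF.

Fact dual_actE a f x : dual_act a f x = f (vsproj W (vsval x * a)).
Proof. by rewrite /dual_act !comp_lfunE !lfunE. Qed.

Let mulW (x : subvs_of W) a : vsval x * a \in W.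
Proof.
apply: subvP (prodvSr <[e]> (subvf ({:A} * {:A})%VS)) _ _.
by rewrite prodvA memv_mul ?memvf ?subvsP.
Qed.

Fact dual_act_linearr a : linear (dual_act a).
Proof.
move=> k f g; apply/lfunP=> x.
by rewrite !(dual_actE, add_lfunE, scale_lfunE).
Qed.
Fact dual_act_linearl f : linear (dual_act^~ f).
Proof.
move=> k a b; apply/lfunP=> x; rewrite !(dual_actE, add_lfunE, scale_lfunE).
by rewrite mulrDr -scalerAr !linearP.
Qed.
Fact dual_act1 f : dual_act 1 f = f.
Proof. by apply/lfunP=> x; rewrite dual_actE mulr1 vsvalK. Qed.
Fact dual_actM a b f : dual_act (a * b) f = dual_act a (dual_act b f).
Proof.
by apply/lfunP=> x; rewrite !dual_actE mulrA vsprojK ?mulW.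
Qed.

Definition dualmod : lmodule :=
  LModule dual_act_linearr dual_act_linearl dual_act1 dual_actM.

End Dual.

End Modules.

Arguments lmodule {K} A.

(* Paths are listed in the order in which they are traversed: (i, [:: a_1; ...;
   a_k]) starts at i, runs through a_1 first, and is the element a_k ... a_1 e_i
   of KQ, as befits left modules. *)
Record quiver (V : finType) := Quiver {
  arrow : finType;
  src : arrow -> V;
  tgt : arrow -> V
}.

Section PathAlgebra.
Context {V : finType}.
Variable Q : quiver V.

Fixpoint composable (i : V) (p : seq (arrow Q)) : bool :=
  if p is a :: p' then (src a == i) && composable (tgt a) p' else true.

Definition qpath := {ip : V * seq (arrow Q) | composable ip.1 ip.2}.

Definition plen (p : qpath) : nat := size (sval p).2.

Definition trivpath (i : V) : qpath := exist _ (i, [::]) isT.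

Variable K : fieldType.

(* {malg K[qpath]}, the K-space with basis the set of paths, underlies KQ. *)

Definition arrow_ideal_pow (m : nat) (u : {malg K[qpath]}) :=
  forall p, u@_p != 0 -> (m <= plen p)%N.

Definition admissible (I : {malg K[qpath]} -> Prop) :=
  (forall u, I u -> arrow_ideal_pow 2 u) /\
  exists2 m, (2 <= m)%N & forall u, arrow_ideal_pow m u -> I u.

Variables (A : falgType K) (e : V -> A) (x : arrow Q -> A).

Definition ev_path (p : qpath) : A :=
  foldl (fun b a => x a * b) (e (sval p).1) (sval p).2.

(* The linear map KQ -> A with e_i |-> e i and a |-> x a. *)
Definition ev (u : {malg K[qpath]}) : A := mmap (in_alg A) ev_path u.

End PathAlgebra.

(* A = KQ/I: the first three conditions make [ev] a morphism of algebras
   KQ -> A; it is onto, and its kernel I is admissible. *)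
Record bound_quiver_algebra (K : fieldType) (V : finType) (Q : quiver V)
    (A : falgType K) := BoundQuiverAlgebra {
  idem : V -> A;
  arr : arrow Q -> A;
  idemM : forall i j, idem i * idem j = if i == j then idem i else 0;
  idem_sum : \sum_i idem i = 1;
  arrE : forall a, idem (tgt a) * arr a * idem (src a) = arr a;
  ev_surj : forall b, exists u, ev idem arr u = b;
  ev_ker : admissible (fun u => ev idem arr u = 0)
}.

Section QuasiHereditary.
Context {K : fieldType} {A : falgType K} {d : Order.disp_t}.
Context {V : finPOrderType d} (e : V -> A).
Local Open Scope order_scope.
Implicit Types i j : V.

Definition Pmod i : lmodule A := submod (lideal (e i)).
Definition Imod i : lmodule A := dualmod (e i).
Definition Smod i : lmodule A := top (Pmod i).

(* The class of modules having no composition factor S(j), j not <= i, is closed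
   under submodules, quotients and finite direct sums.  Hence the intersection
   in [Delta] (resp. the sum in [Nabla]) is itself a member of its family, and
   gives the largest factor module (resp. submodule) in this class. *)
Definition Delta i : lmodule A :=
  quotmod (subm_inf (fun U : submodule (Pmod i) =>
    forall j, ~~ (j <= i) -> filt_mult Smod (quotmod U) j 0)).

Definition Nabla i : lmodule A :=
  submod (subm_sup (fun U : submodule (Imod i) =>
    forall j, ~~ (j <= i) -> filt_mult Smod (submod U) j 0)).

Definition quasi_hereditary :=
  forall i,
    [/\ filt_mult Smod (Delta i) i 1,
        in_filt Delta (Pmod i),
        forall j, ~~ (i <= j) -> filt_mult Delta (Pmod i) j 0
      & filt_mult Delta (Pmod i) i 1].

Definition one_quasi_hereditary :=
  quasi_hereditary /\
  exists v1 vn : V,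
    [/\ forall j, v1 <= j /\ j <= vn,
        forall i j, j <= i ->
          filt_mult Smod (Delta i) j 1 /\ filt_mult Delta (Pmod j) i 1,
        forall j, isom (submod (soc (Pmod j))) (Smod v1) /\
                  isom (top (Imod j)) (Smod v1)
      & forall i, injects (Delta i) (Delta vn) /\
                  surjects (Nabla vn) (Nabla i)].

(* T is isomorphic to the indecomposable tilting module T(i). *)
Definition tilting_at i (T : lmodule A) :=
  [/\ indecomposable T,
      in_filt Delta T /\ in_filt Nabla T,
      forall j, ~~ (j <= i) ->
        [/\ filt_mult Delta T j 0, filt_mult Nabla T j 0
          & filt_mult Smod T j 0]
    & [/\ filt_mult Delta T i 1, filt_mult Nabla T i 1
        & filt_mult Smod T i 1]].

(* Given that Pmod v has a unique submodule isomorphic to Pmod l, this is the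
   sum over l not <= i of these submodules. *)
Definition sumP (v i : V) : submodule (Pmod v) :=
  subm_sup (fun U : submodule (Pmod v) =>
    exists l, ~~ (l <= i) /\ isom (submod U) (Pmod l)).

Definition capKer (v i : V) : submodule (Imod v) :=
  subm_inf (fun U : submodule (Imod v) =>
    exists l (f : 'Hom(Imod v, Imod l)),
      [/\ ~~ (l <= i), modhom f, limg f = fullv
        & U = lker f :> {vspace Imod v}]).

End QuasiHereditary.

Section QuotientAlgebra.
Context {K : fieldType} {A : falgType K}.

Record proper_twosided_ideal := ProperIdeal {
  ideal_vs :> {vspace A};
  ideal_mull : forall a x, x \in ideal_vs -> a * x \in ideal_vs;
  ideal_mulr : forall a x, x \in ideal_vs -> x * a \in ideal_vs;
  ideal_proper : 1 \notin ideal_vs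
}.

Definition quotalg (J : proper_twosided_ideal) := quotvs J.

Variable J : proper_twosided_ideal.

HB.instance Definition _ := Vector.on (quotalg J).

Definition qalg_one : quotalg J := qproj J 1.
Definition qalg_mul (x y : quotalg J) : quotalg J :=
  qproj J (vsval x * vsval y).

Lemma qproj_mul (a b : A) :
  qproj J (a * b) = qalg_mul (qproj J a) (qproj J b) :> quotalg J.
Proof.
apply: qproj_eq.
set a' := vsval _; set b' := vsval _.
have -> : a * b - a' * b' = - ((a' - a) * b + a' * (b' - b)).
  by rewrite mulrBl mulrBr [(_ - a * b) + _]addrC addrA subrK opprB.
rewrite memvN; apply: memvD.
  by apply: ideal_mulr; apply: qproj_sub.
by apply: ideal_mull; apply: qproj_sub.
Qed.

Let qK : cancel (@vsval _ _ _) (qproj J : A -> quotalg J) := @qproj_val _ _ J.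

Fact qalg_mulA : associative qalg_mul.
Proof.
by move=> x y z; rewrite -[x]qK -[y]qK -[z]qK -!qproj_mul mulrA.
Qed.
Fact qalg_mul1l : left_id qalg_one qalg_mul.
Proof. by move=> x; rewrite -[x]qK -qproj_mul mul1r. Qed.
Fact qalg_mul1r : right_id qalg_one qalg_mul.
Proof. by move=> x; rewrite -[x]qK -qproj_mul mulr1. Qed.
Fact qalg_mulDl : left_distributive qalg_mul +%R.
Proof. by move=> x y z; rewrite /qalg_mul linearD mulrDl linearD. Qed.
Fact qalg_mulDr : right_distributive qalg_mul +%R.
Proof. by move=> x y z; rewrite /qalg_mul linearD mulrDr linearD. Qed.
Fact qalg_one_neq0 : qalg_one != 0.
Proof. by rewrite qproj_eq0 ideal_proper. Qed.

HB.instance Definition _ := GRing.Zmodule_isNzRing.Build (quotalg J)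
  qalg_mulA qalg_mul1l qalg_mul1r qalg_mulDl qalg_mulDr qalg_one_neq0.

Fact qalg_scaleAl k (x y : quotalg J) : k *: (x * y) = (k *: x) * y.
Proof. by rewrite /GRing.mul /= /qalg_mul linearZ -scalerAl linearZ. Qed.
HB.instance Definition _ := GRing.Lmodule_isLalgebra.Build K (quotalg J)
  qalg_scaleAl.

Fact qalg_scaleAr k (x y : quotalg J) : k *: (x * y) = x * (k *: y).
Proof. by rewrite /GRing.mul /= /qalg_mul linearZ -scalerAr linearZ. Qed.
HB.instance Definition _ := GRing.Lalgebra_isAlgebra.Build K (quotalg J)
  qalg_scaleAr.

HB.instance Definition _ := Algebra_isFalgebra.Build K (quotalg J).

End QuotientAlgebra.
Arguments proper_twosided_ideal {K} A.

Section LowerSet.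
Context {d : Order.disp_t} {V : finPOrderType d}.

Definition lower (i : V) := {j : V | (j <= i)%O}.

HB.instance Definition _ i := SubFinite.on (lower i).
HB.instance Definition _ i :=
  [SubChoice_isSubPOrder of lower i by <: with d].

End LowerSet.

Section TruncatedAlgebra.
Context {K : fieldType} {d : Order.disp_t} {V : finPOrderType d}.
Context {Q : quiver V} {A : falgType K} (B : bound_quiver_algebra Q A).
Local Notation e := (idem B).
Local Notation evB := (ev e (arr B)).
Local Notation evpB := (ev_path e (arr B)).

Definition trunc_ideal_vs (i : V) : {vspace A} :=
  ({:A} * <[\sum_(j | ~~ (j <= i)%O) e j]> * {:A})%VS.

Fact trunc_ideal_mull i a x :
  x \in trunc_ideal_vs i -> a * x \in trunc_ideal_vs i.
Proof.
move=> Jx; rewrite /trunc_ideal_vs.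
have : a * x \in ({:A} * trunc_ideal_vs i)%VS by rewrite memv_mul ?memvf.
apply: subvP; rewrite /trunc_ideal_vs !prodvA.
by do 2!apply: prodvSl; apply: subvf.
Qed.

Fact trunc_ideal_mulr i a x :
  x \in trunc_ideal_vs i -> x * a \in trunc_ideal_vs i.
Proof.
move=> Jx; rewrite /trunc_ideal_vs.
have : x * a \in (trunc_ideal_vs i * {:A})%VS by rewrite memv_mul ?memvf.
by apply: subvP; rewrite /trunc_ideal_vs -prodvA; apply: prodvSr; apply: subvf.
Qed.

Let avoids i (a : A) := exists u, evB u = a /\ u@_(trivpath Q i) = 0.

Let evZ c u : evB (c *: u) = c *: evB u.
Proof.
rewrite /ev (mmapEw (msuppZ_le c u)) mmapE scaler_sumr.
by apply: eq_bigr => p _; rewrite mcoeffZ /= -scalerA -scalerAl.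
Qed.

Let avoidsL i k a b : avoids i a -> avoids i b -> avoids i (k *: a + b).
Proof.
move=> [u [<- u0]] [v [<- v0]]; exists (k *: u + v); split.
  by rewrite {1}/ev mmapD -/(evB _) evZ.
by rewrite mcoeffD mcoeffZ u0 v0 mulr0 addr0.
Qed.

Let avoids0 i : avoids i 0.
Proof. by exists 0; rewrite /ev mmap0 mcoeff0. Qed.

Let avoids_sum i (I : Type) (r : seq I) (P : pred I) F :
  (forall k, P k -> avoids i (F k)) -> avoids i (\sum_(k <- r | P k) F k).
Proof.
move=> HF; elim/big_rec: _ => [|k b Pk Hb]; first exact: avoids0.
by rewrite -[F k]scale1r; apply: avoidsL => //; apply: HF.
Qed.

Let foldE (c : A) s :
  foldl (fun b a => arr B a * b) c s =
  foldl (fun b a => arr B a * b) 1 s * c.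
Proof.
elim/last_ind: s => [|s a IHs]; first by rewrite mul1r.
by rewrite !foldl_rcons IHs mulrA.
Qed.

Let arr_tgt a : e (tgt a) * arr B a = arr B a.
Proof. by rewrite -(arrE B a) !mulrA idemM eqxx. Qed.

Let evp_end (p : qpath Q) :
  e (last (sval p).1 [seq tgt a | a <- (sval p).2]) * evpB p = evpB p.
Proof.
rewrite /ev_path; case: p => -[k s] _ /=; case/lastP: s => [|s a] /=.
  by rewrite idemM eqxx.
by rewrite map_rcons last_rcons foldl_rcons mulrA arr_tgt.
Qed.

Let comp_cat k (s t : seq (arrow Q)) :
  composable k s -> composable (last k [seq tgt a | a <- s]) t ->
  composable k (s ++ t).
Proof.
elim: s k => [|a s IHs] k //= /andP[-> Hs] Ht /=.
exact: IHs.
Qed.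

Let avoids_path i j (p q : qpath Q) :
  j != i -> avoids i (evpB p * e j * evpB q).
Proof.
move=> ji; have Hq := evp_end q.
case: p q Hq => [[k s] /= ks] [[l t] /= lt] Hq.
rewrite {1}/ev_path /= foldE -[_ * e k * e j]mulrA idemM.
have [Ek|] := eqVneq k j; last by move=> _; rewrite mulr0 mul0r.
rewrite -Hq -mulrA (mulrA (e k)) idemM.
have [El|] := eqVneq k _; last by move=> _; rewrite mul0r mulr0.
rewrite {1}El Hq /ev_path /= -foldE -foldl_cat.
have cts : composable l (t ++ s) by apply: comp_cat; rewrite // -El.
exists << exist (fun ip => composable ip.1 ip.2) (l, t ++ s) cts >>.
split; first by rewrite /ev mmapU /= scale1r mul1r.
rewrite mcoeffU; case: eqP => // /(congr1 sval) [li ts].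
move: ts El; case: t {Hq lt cts} => //= _ El.
by rewrite -Ek El li eqxx in ji.
Qed.

Fact trunc_ideal_proper i : 1 \notin trunc_ideal_vs i.
Proof.
apply/negP => J1.
have [W WP] := vspace_of_pred (@avoids0 i) (@avoidsL i).
suff /subvP JW : (trunc_ideal_vs i <= W)%VS.
  have /JW/WP[u [ue ui]] := trunc_ideal_mulr (e i) J1.
  rewrite mul1r in ue.
  have [ker2 _] := ev_ker B.
  have ev0 : evB (u - << trivpath Q i >>) = 0.
    rewrite /ev mmapB -/(evB u) ue mmapU /= /ev_path /=.
    by rewrite scale1r mul1r subrr.
  have := ker2 _ ev0 (trivpath Q i).
  rewrite mcoeffB ui mcoeffU eqxx sub0r oppr_eq0 oner_eq0 => H.
  by have := H isT.
have mulJ a b : avoids i (a * (\sum_(j | ~~ (j <= i)%O) e j) * b).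
  have [u <-] := ev_surj B a; have [v <-] := ev_surj B b.
  rewrite -mulrA {1}/ev mmapE mulr_suml; apply: avoids_sum => p _.
  rewrite mulr_suml mulr_sumr; apply: avoids_sum => j ji.
  rewrite {1}/ev mmapE !mulr_sumr; apply: avoids_sum => q _ /=.
  rewrite !mulr_algl -!(scalerAl, scalerAr) scalerA mulrA.
  rewrite -[X in avoids i X]addr0.
  apply: avoidsL (avoids0 i); apply: avoids_path.
  by apply: contra ji => /eqP->.
apply/prodvP=> c b; rewrite -limg_amulr => /memv_imgP[a _ ->] _.
by rewrite lfunE /=; apply/WP.
Qed.

Definition trunc_ideal (i : V) : proper_twosided_ideal A :=
  ProperIdeal (@trunc_ideal_mull i) (@trunc_ideal_mulr i)
    (trunc_ideal_proper i).

Definition trunc_alg (i : V) : falgType K := quotalg (trunc_ideal i).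

Definition trunc_idem (i : V) (j : lower i) : trunc_alg i :=
  qproj (trunc_ideal i) (e (val j)).

End TruncatedAlgebra.

(* Main.v *)
Require Import Defs.
From HB Require Import structures.
From mathcomp Require Import all_boot all_order all_algebra all_field.
From mathcomp Require Import boolp zify monalg.

(* Everything is reduced to dimensions of the spaces e_k M.  Counting along
   Delta-filtrations gives dim e_k (A/AeA) e_j = #{l | j, k <= l, l not in X} for
   the idempotent e of an up-closed set X of vertices; this is symmetric in j
   and k, so arguments on left ideals dualize to right ideals.  In particular
   P(1) = I(1), the submodules P(l) of P(1) are the A e_l A e_1, the quotient of
   P(1) in (ii) is A(i) e_1 and the submodule of I(1) in (ii') is D(e_1 A(i)).
   Both modules have dimension vector #{l | k <= l <= i}.

   Comparing dimension vectors, (T : Delta(k)) = (T : Nabla(k)) for T = T(i).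
   The tops of the Nabla(k) and the socles of the Delta(k) are all S(1), and
   Ext^1(Delta(1), Nabla(k)) = 0, so soc T is simple iff (T : Nabla(1)) = 1 and
   top T is simple iff (T : Delta(1)) = 1: hence (iii) <-> (iii').  If top T is
   simple then T is a quotient of A(i) e_1; since T maps onto Nabla(i), hence onto
   Nabla(k) for k <= i, each (T : Delta(k)) is at least 1, and T = A(i) e_1 by
   dimension.  Its simple socle then passes to the A(i) e_j, and gives the axioms
   of 1-quasi-heredity for A(i).  Conversely, if A(i) e_1 has a simple socle it is
   projective and injective over A(i), and it splits off T. *)

Set Implicit Arguments.
Unset Strict Implicit.
Unset Printing Implicit Defensive.

Import Order.TTheory GRing.Theory.
Local Open Scope ring_scope.

(** * Linear algebra *)

(** Quasi-heredity only provides Delta-filtrations of left projectives. The corresponding statements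
    for right ideals, such as [costd_line] and [nondeg_right], are obtained from the symmetry of dim
    e_k (A e_X A) e_j, in place of a duality functor. For such counts to apply,
    [one_quasi_hereditaryP] first turns the axioms into statements on elements of A: maps between
    standard or between costandard modules become multiplications, I(v) becomes a space of
    functionals on A, and simple socles and tops become nondegenerate pairings. In this language
    A(i) e_1 has simple socle S(1) exactly when some functional satisfies [form_at]; this is the
    pivot between (i) and (ii). T is never turned into an A(i)-module: it stays an A-module killed
    by J(i), and A(i) is mostly seen as computation modulo [idn e i]. Likewise filtrations are
    chains of subspaces of one fixed module instead of nested subquotients. *)

Section LinearAlgebra.
Context {K : fieldType}.

Lemma linfunE (V W : vectType K) (f : V -> W) (lf : linear f) x : linfun f x = f x.
Proof.
pose g := HB.pack_for {linear V -> W} f (GRing.isLinear.Build K V W *:%R f lf).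
exact: (lfunE g).
Qed.

Lemma vspace_of (V : vectType K) (S : V -> Prop) :
  S 0 -> (forall a u v, S u -> S v -> S (a *: u + v)) ->
  {U : {vspace V} | forall v, v \in U <-> S v}.
Proof. by move=> S0 SL; apply/cid/vspace_of_pred. Qed.

Lemma eq_fullv (V : vectType K) (U : {vspace V}) :
  (forall v, v \in U) -> U = fullv.
Proof. by move=> H; apply/vspaceP => v; rewrite memvf H. Qed.

Lemma functional_neq0 (V : vectType K) (v : V) :
  v != 0 -> exists f : 'Hom(V, K^o), f v != 0.
Proof.
move=> v0; apply/not_existsP => H; case/negP: v0; apply/eqP.
rewrite (coord_vbasis (memvf v)) big1 // => i _.
have := H (linfun (coord (vbasis {:V}) i : V -> K^o)).
by rewrite lfunE /= => /negP; rewrite negbK => /eqP->; rewrite scale0r.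
Qed.

Lemma functional_sep (V : vectType K) (U : {vspace V}) (v : V) :
  v \notin U ->
  exists f : 'Hom(V, K^o), (forall u, u \in U -> f u = 0) /\ f v != 0.
Proof.
rewrite -qproj_eq0 => /functional_neq0[f fv].
exists (f \o qproj U)%VF; rewrite comp_lfunE; split=> // u.
by rewrite comp_lfunE -qproj_eq0 => /eqP->; rewrite linear0.
Qed.

(** Finite-dimensional reflexivity, with v given by coordinates. It later turns homomorphisms
    between injectives into multiplications by elements of A. *)
Lemma bidual (V : vectType K) (m : 'Hom('Hom(V, K^o), K^o)) :
  exists v, forall f, m f = f v.
Proof.
pose b := vbasis {:V}; pose c i : 'Hom(V, K^o) := linfun (coord b i : V -> K^o).
exists (\sum_(i < \dim {:V}) m (c i) *: b`_i) => f.
have fE : f = \sum_(i < \dim {:V}) (f b`_i : K) *: c i.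
  apply/lfunP => v; rewrite {1}(coord_vbasis (memvf v)) linear_sum sum_lfunE.
  by apply: eq_bigr => i _; rewrite linearZ scale_lfunE lfunE /= /GRing.scale /= mulrC.
rewrite {1}fE !linear_sum /=; apply: eq_bigr => i _.
by rewrite !linearZ /= /GRing.scale /= mulrC.
Qed.

(** The g x form a subspace of the dual of W, and a functional outside a subspace is separated from
    it by an element of the bidual, that is, by a vector w. Most witnesses extracted from a
    nondegenerate pairing come from here. *)
Lemma functional_repr (V W : vectType K) (g : V -> W -> K^o)
    (gl : forall x, linear (g x)) (gr : forall w, linear (g^~ w))
    (f : 'Hom(W, K^o)) :
  (forall w, (forall x, g x w = 0) -> f w = 0) ->
  exists x, forall w, f w = g x w.
Proof.
move=> H; have lG : linear (fun x => linfun (g x)).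
  move=> k x y; apply/lfunP => w.
  by rewrite add_lfunE scale_lfunE !linfunE // gr.
have [|/functional_sep[m [m0 mf]]] := boolP (f \in limg (linfun (fun x => linfun (g x)))).
  by case/memv_imgP => x _ ->; exists x => w; rewrite !linfunE.
have [w mw] := bidual m; case/negP: mf; rewrite mw; apply/eqP/H => x.
rewrite -[g x w](linfunE (gl x)) -mw; apply: m0.
by rewrite -[linfun (g x)](linfunE lG) memv_img ?memvf.
Qed.

(** Restricting g x to a complement of Y1 in Y sends X to a dual space of dimension dim Y - dim Y1,
    with kernel inside X1. *)
Lemma dim_pairing (V W : vectType K) (g : V -> W -> K^o)
    (gl : forall x, linear (g x)) (gr : forall w, linear (g^~ w))
    (X X1 : {vspace V}) (Y Y1 : {vspace W}) :
  (forall x, x \in X -> (forall y, y \in Y -> g x y = 0) -> x \in X1) ->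
  (Y1 <= Y)%VS -> (forall x y, x \in X -> y \in Y1 -> g x y = 0) ->
  (\dim X + \dim Y1 <= \dim Y + \dim X1)%N.
Proof.
move=> HX sY HY; pose C := (Y :\: Y1)%VS.
pose h x : 'Hom(subvs_of C, K^o) := linfun (fun w : subvs_of C => g x (vsval w)).
have lh x : linear (fun w : subvs_of C => g x (vsval w)).
  by move=> k u v; rewrite /= -(gl x) -linearP.
have lH : linear h.
  by move=> k x y; apply/lfunP => w; rewrite add_lfunE scale_lfunE !linfunE // gr.
have dC : (\dim Y = \dim C + \dim Y1)%N.
  have := dimv_cap_compl Y Y1; rewrite -/C (capv_idPr sY); lia.
have := limg_ker_dim (linfun h) X.
have d1 : (\dim (linfun h @: X) <= \dim C)%N.
  apply: leq_trans (dimvS (subvf _)) _.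
  by rewrite dimvf /dim /= muln1.
suff d2 : (\dim (X :&: lker (linfun h)) <= \dim X1)%N by lia.
apply/dimvS/subvP => x; rewrite memv_cap memv_ker linfunE // => /andP[Xx /eqP h0].
apply: HX => // y.
have <- : (C + Y1)%VS = Y by rewrite -[RHS](addv_diff_cap Y Y1) (capv_idPr sY).
case/memv_addP => c Cc [z Yz ->].
have -> : g x (c + z) = g x c + g x z by by rewrite -[c in LHS]scale1r gl scale1r.
rewrite (HY x z) // addr0.
have := congr1 (fun f : 'Hom(subvs_of C, K^o) => f (vsproj C c)) h0.
by rewrite /h linfunE // zero_lfunE vsprojK.
Qed.

End LinearAlgebra.

(** * Modules *)

HB.instance Definition _ (K : fieldType) (A : falgType K) (M : lmodule A)
  (a : A) := GRing.isLinear.Build K M M *:%R (act a) (act_linearr a).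

Section Modules.
Context {K : fieldType} {A : falgType K}.

Section Action.
Variable M : lmodule A.
Implicit Types (a b : A) (u v : M) (U W : {vspace M}).

Definition orbit_map u : 'Hom(A, M) := linfun (fun a => act a u).

Lemma orbit_mapE u a : orbit_map u a = act a u.
Proof. by rewrite linfunE //; apply: act_linearl. Qed.

Lemma actDl a b u : act (a + b) u = act a u + act b u.
Proof. by rewrite -!orbit_mapE linearD. Qed.
Lemma actBl a b u : act (a - b) u = act a u - act b u.
Proof. by rewrite -!orbit_mapE linearB. Qed.
Lemma actZl k a u : act (k *: a) u = k *: act a u.
Proof. by rewrite -!orbit_mapE linearZ. Qed.
Lemma act0l u : act 0 u = 0.
Proof. by rewrite -orbit_mapE linear0. Qed.
Lemma act_suml (I : finType) (P : pred I) (F : I -> A) u :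
  act (\sum_(i | P i) F i) u = \sum_(i | P i) act (F i) u.
Proof. rewrite -orbit_mapE linear_sum; by apply: eq_bigr => i _; exact: orbit_mapE. Qed.

Definition stable U := forall a u, u \in U -> act a u \in U.

Lemma stableD U W : stable U -> stable W -> stable (U + W)%VS.
Proof.
move=> sU sW a x /memv_addP[u Uu [w Ww ->]].
by rewrite linearD memv_add ?sU ?sW.
Qed.

Lemma stable_full : stable fullv.
Proof. by move=> *; apply: memvf. Qed.

Lemma stable0 : stable 0%VS.
Proof. by move=> a u; rewrite !memv0 => /eqP->; rewrite linear0. Qed.

Definition cyc u := limg (orbit_map u).

Lemma cycP u x : reflect (exists a, x = act a u) (x \in cyc u).
Proof.
apply: (iffP memv_imgP) => [[a _ ->]|[a ->]]; exists a => //.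
- by rewrite orbit_mapE.
- exact: memvf.
- by rewrite orbit_mapE.
Qed.

Lemma mem_cyc a u : act a u \in cyc u.
Proof. by apply/cycP; exists a. Qed.

Lemma mem_cyc1 u : u \in cyc u.
Proof. by apply/cycP; exists 1; rewrite act1. Qed.

Lemma stable_cyc u : stable (cyc u).
Proof. by move=> a _ /cycP[b ->]; rewrite -actM mem_cyc. Qed.

Lemma cyc_sub u U : stable U -> u \in U -> (cyc u <= U)%VS.
Proof. by move=> sU Uu; apply/subvP => _ /cycP[a ->]; apply: sU. Qed.

(** The span B U of all products; running over a basis of B keeps the sum finite. *)
Definition mulv (B : {vspace A}) U : {vspace M} :=
  (\sum_(i < \dim B) linfun (act (vbasis B)`_i : M -> M) @: U)%VS.

Lemma mem_mulv (B : {vspace A}) U a u : a \in B -> u \in U -> act a u \in mulv B U.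
Proof.
move=> Ba Uu; rewrite (coord_vbasis Ba) act_suml memv_suml // => i _.
rewrite actZl memvZ //; apply: (subvP (sumv_sup i _ (subvv _))) => //.
by rewrite -[act _ u](lfunE (act (vbasis B)`_i)) memv_img.
Qed.

Lemma mulv_sub (B : {vspace A}) U W :
  (forall a u, a \in B -> u \in U -> act a u \in W) -> (mulv B U <= W)%VS.
Proof.
move=> H; apply/subv_sumP => i _; apply/subvP => _ /memv_imgP[u Uu ->].
by rewrite lfunE /= H // vbasis_mem // mem_nth // size_tuple.
Qed.

Lemma mulv_ind (B : {vspace A}) U (P : M -> Prop) : P 0 ->
  (forall k x y, P x -> P y -> P (k *: x + y)) ->
  (forall a u, a \in B -> u \in U -> P (act a u)) ->
  forall x, x \in mulv B U -> P x.
Proof.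
move=> P0 PL Pa x; have [W WP] := vspace_of P0 PL.
by move/(subvP (@mulv_sub B U W (fun a u Ba Uu => (WP _).2 (Pa _ _ Ba Uu))))/WP.
Qed.

Lemma mulvA (B C : {vspace A}) U : mulv B (mulv C U) = mulv (B * C)%VS U.
Proof.
apply/eqP; rewrite eqEsubv; apply/andP; split; apply: mulv_sub => a u.
  move=> Ba; move: u; apply: mulv_ind => [|k x y Hx Hy|c u Cc Uu].
  - by rewrite linear0 mem0v.
  - by rewrite linearP memvD ?memvZ.
  - by rewrite -actM mem_mulv // memv_mul.
move=> BCa Uu.
suff /subvP/(_ _ BCa) : (B * C <= orbit_map u @^-1: mulv B (mulv C U))%VS.
  by rewrite -memv_preim orbit_mapE.
apply/prodvP => b c Bb Cc.
by rewrite -memv_preim orbit_mapE actM !mem_mulv.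
Qed.

Lemma mulvS (B : {vspace A}) U W : (U <= W)%VS -> (mulv B U <= mulv B W)%VS.
Proof. by move=> /subvP sUW; apply: mulv_sub => a u Ba /sUW Wu; apply: mem_mulv. Qed.

Lemma stable_mulv (B : {vspace A}) U :
  (forall a b, b \in B -> a * b \in B) -> stable (mulv B U).
Proof.
move=> HB a; apply: mulv_ind => [|k x y Hx Hy|b u Bb Uu].
- by rewrite linear0 mem0v.
- by rewrite linearP memvD ?memvZ.
- by rewrite -actM mem_mulv ?HB.
Qed.

Lemma stable_max (U : {vspace M}) : stable U -> U != fullv ->
  exists W, [/\ stable W, (U <= W)%VS, W != fullv &
    forall W', stable W' -> (W <= W')%VS -> W' = W \/ W' = fullv].
Proof.
move: {2}(\dim {:M} - \dim U)%N (leqnn (\dim {:M} - \dim U)%N) => n.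
elim: n U => [|n IH] U Un sU Uf.
  case/negP: Uf; rewrite eqEdim subvf /=; lia.
have [H|/existsNP[W /not_implyP[sW /not_implyP[UW /not_orP[WU Wf]]]]] :=
  pselect (forall W', stable W' -> (U <= W')%VS -> W' = U \/ W' = fullv).
  by exists U; split.
have ltUW : (\dim U < \dim W)%N.
  rewrite ltn_neqAle dimvS // andbT; apply/eqP => dE.
  by apply: WU; apply/eqP; rewrite eq_sym eqEdim UW /= dE.
have leW := dimvS (subvf W).
have [||X [sX WX Xf HX]] := IH W _ sW; [lia|exact/eqP|].
by exists X; split=> //; apply: subv_trans WX.
Qed.

Lemma stable_min (U : {vspace M}) : stable U -> U != 0%VS ->
  exists W, [/\ stable W, (W <= U)%VS, W != 0%VS &
    forall W', stable W' -> (W' <= W)%VS -> W' = 0%VS \/ W' = W].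
Proof.
move: {2}(\dim U) (leqnn (\dim U)) => n.
elim: n U => [|n IH] U Un sU Uf.
  by case/negP: Uf; rewrite -dimv_eq0 -leqn0.
have [H|/existsNP[W /not_implyP[sW /not_implyP[UW /not_orP[WU Wf]]]]] :=
  pselect (forall W', stable W' -> (W' <= U)%VS -> W' = 0%VS \/ W' = U).
  by exists U; split.
have ltUW : (\dim W < \dim U)%N.
  rewrite ltn_neqAle dimvS // andbT; apply/eqP => dE.
  by apply: Wf; apply/eqP; rewrite eqEdim UW /= dE.
have [||X [sX WX Xf HX]] := IH W _ sW; [lia|exact/eqP|].
by exists X; split=> //; apply: subv_trans UW.
Qed.

End Action.

Lemma subm_stable (M : lmodule A) (U : submodule M) : stable U.
Proof. by move=> a u; apply: subm_act. Qed.

Lemma qproj_hom (M : lmodule A) (U : submodule M) :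
  modhom (N := quotmod U) (qproj U : 'Hom(M, quotmod U)).
Proof.
move=> a u /=; rewrite /quot_act; apply: qproj_eq.
rewrite -opprB memvN -linearB /=; apply: subm_act.
by rewrite qproj_sub.
Qed.

Lemma vsval_hom (M : lmodule A) (U : submodule M) :
  modhom (M := submod U) (linfun (@vsval _ _ U) : 'Hom(submod U, M)).
Proof. by move=> a u; rewrite !lfunE. Qed.

(** The map is a linear section of a |-> a m followed by a |-> a n. The inclusion of annihilators
    makes it independent of the section, hence A-linear. *)
Lemma cyc_hom (M N : lmodule A) (m : M) (n : N) : cyc m = fullv ->
  (forall a, act a m = 0 -> act a n = 0) ->
  exists f : 'Hom(M, N), modhom f /\ f m = n.
Proof.
move=> cm H; pose s := ((orbit_map m)^-1)%VF.
have sE x : act (s x) m = x.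
  by rewrite -orbit_mapE limg_lfunVK // -/(cyc m) cm memvf.
exists (orbit_map n \o s)%VF; split=> [a x|].
  rewrite !comp_lfunE !orbit_mapE -actM; apply/eqP; rewrite -subr_eq0 -actBl.
  by apply/eqP/H; rewrite actBl actM !sE subrr.
rewrite comp_lfunE orbit_mapE -[RHS]act1; apply/eqP; rewrite -subr_eq0 -actBl.
by apply/eqP/H; rewrite actBl sE act1 subrr.
Qed.

Lemma modhom_bij (M N : lmodule A) (f : 'Hom(M, N)) :
  lker f == 0%VS -> limg f = fullv -> bijective f.
Proof.
move=> k0 fi; exists (f^-1)%VF; first by move=> x; apply: lker0_lfunK.
by move=> y; apply: limg_lfunVK; rewrite fi memvf.
Qed.

Lemma isom_cyc (M N : lmodule A) (m : M) (n : N) :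
  cyc m = fullv -> cyc n = fullv ->
  (forall a, act a m = 0 <-> act a n = 0) -> isom M N.
Proof.
move=> cm cn H; have [f [hf fm]] := cyc_hom cm (fun a => (H a).1).
exists f; split=> //; apply: modhom_bij.
  rewrite -subv0; apply/subvP => x; rewrite memv_ker.
  have /cycP[a ->] : x \in cyc m by rewrite cm memvf.
  by rewrite hf fm memv0 => /eqP/H->.
apply: eq_fullv => y; have /cycP[a ->] : y \in cyc n by rewrite cn memvf.
by rewrite -fm -hf memv_img ?memvf.
Qed.

Lemma isom_cyc_gen (M N : lmodule A) (m : M) : isom N M -> cyc m = fullv ->
  exists n : N, cyc n = fullv /\ (forall a, act a n = 0 <-> act a m = 0).
Proof.
move=> [f [hf [g fK gK]]] cm; exists (g m); split.
  apply: eq_fullv => x; have /cycP[a fx] : f x \in cyc m by rewrite cm memvf.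
  by apply/cycP; exists a; apply: (can_inj fK); rewrite hf gK.
move=> a; split=> [H|H]; first by rewrite -[m]gK -hf H linear0.
by apply: (can_inj fK); rewrite hf gK H linear0.
Qed.

End Modules.
Arguments stable_cyc {K A M} u.

(** * Radical and simple modules *)

Section Quotients.
Context {K : fieldType} {A : falgType K} (M : lmodule A) (U : submodule M).

Lemma lker_qproj : lker (qproj U) = U.
Proof. by apply/vspaceP => x; rewrite memv_ker qproj_eq0. Qed.

Lemma limg_qproj : limg (qproj U) = fullv.
Proof.
by apply: eq_fullv => x; rewrite -[x]qproj_val memv_img ?memvf.
Qed.

Lemma simple_quotP : simple_mod (quotmod U) <->
  U != fullv :> {vspace M} /\
  forall W : {vspace M}, stable W -> (U <= W)%VS -> W = U \/ W = fullv.
Proof.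
have q0P : \dim {:quotmod U} = 0%N <-> U = fullv :> {vspace M}.
  have := limg_ker_dim (qproj U) fullv.
  rewrite lker_qproj limg_qproj capfv /= => E; split=> [d0|UT].
    by apply/eqP; rewrite eqEdim subvf /= -E d0 addn0.
  by move: E; rewrite UT; lia.
split=> [[d0 HS]|[Uf HS]].
  split=> [|W sW UW]; first by apply/eqP => /q0P.
  have sqW a (u : quotmod U) : u \in (qproj U @: W)%VS -> act a u \in (qproj U @: W)%VS.
    by case/memv_imgP => w Ww ->; rewrite -qproj_hom memv_img ?sW.
  have [/= W0|/= W1] := HS (Submodule sqW).
    left; apply/eqP; rewrite eqEsubv UW andbT; apply/subvP => w Ww.
    have : qproj U w \in (qproj U @: W)%VS by rewrite memv_img.
    by rewrite W0 memv0 qproj_eq0.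
  right; apply: eq_fullv => x.
  have : qproj U x \in (qproj U @: W)%VS by rewrite W1 memvf.
  case/memv_imgP => w Ww /eqP; rewrite -subr_eq0 -linearB qproj_eq0 => xw.
  by rewrite -[x](subrK w) memvD // (subvP UW).
split=> [/q0P UT|W]; first by rewrite UT eqxx in Uf.
have sW : stable (qproj U @^-1: W)%VS.
  by move=> a u; rewrite -!memv_preim qproj_hom => /(subm_act (s := W)); apply.
have UW : (U <= qproj U @^-1: W)%VS.
  by apply/subvP => x; rewrite -qproj_eq0 -memv_preim => /eqP->; apply: mem0v.
have [E|E] := HS _ sW UW; [left|right].
  apply/eqP; rewrite -subv0; apply/subvP => x Wx.
  have : vsval x \in (qproj U @^-1: W)%VS by rewrite -memv_preim qproj_val.
  by rewrite E -qproj_eq0 qproj_val memv0.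
apply: eq_fullv => x; rewrite -[x]qproj_val memv_preim E; apply: memvf.
Qed.

Lemma simple_subP : simple_mod (submod U) <->
  U != 0%VS :> {vspace M} /\
  forall W : {vspace M}, stable W -> (W <= U)%VS -> W = 0%VS \/ W = U.
Proof.
have dU : \dim {:submod U} = \dim U by rewrite dimvf.
pose v : 'Hom(submod U, M) := linfun (@vsval _ _ U).
have vE x : v x = vsval x by rewrite lfunE.
rewrite /simple_mod dU; split=> [[d0 HS]|[U0 HS]].
  split=> [|W sW WU]; first by rewrite -dimv_eq0; apply/eqP.
  have sW' a (u : submod U) : u \in (v @^-1: W)%VS -> act a u \in (v @^-1: W)%VS.
    by rewrite -!memv_preim !vE => /(sW a).
  have [/= W0|/= W1] := HS (Submodule sW'); [left|right].
    apply/eqP; rewrite -subv0; apply/subvP => w Ww.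
    have Uw := subvP WU w Ww.
    have : vsproj U w \in (v @^-1: W)%VS by rewrite -memv_preim vE vsprojK.
    by rewrite W0 !memv0 => /eqP E; rewrite -[w](vsprojK Uw) E linear0.
  apply/eqP; rewrite eqEsubv WU /=; apply/subvP => u Uu.
  have : vsproj U u \in (v @^-1: W)%VS by rewrite W1 memvf.
  by rewrite -memv_preim vE vsprojK.
split=> [|W]; first by apply/eqP; rewrite dimv_eq0.
have sW : stable (v @: W)%VS.
  move=> a _ /memv_imgP[u Wu ->].
  by rewrite vE -[act a _]/(vsval (act a u : submod U)) -vE memv_img ?subm_act.
have [|E|E] := HS _ sW.
- by apply/subvP => _ /memv_imgP[u _ ->]; rewrite vE subvsP.
- left; apply/eqP; rewrite -subv0; apply/subvP => x Wx.
  have : v x \in (v @: W)%VS by rewrite memv_img.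
  by rewrite E !memv0 vE => /eqP x0; apply/eqP/val_inj.
right; apply: eq_fullv => x.
have : v x \in (v @: W)%VS by rewrite E vE subvsP.
by case/memv_imgP => y Wy; rewrite !vE => /val_inj->.
Qed.

End Quotients.

Section Basic.
Context {K : fieldType} {A : falgType K} {V : finType}.

(** These properties characterize the radical of a basic algebra with one-dimensional simple modules
    at the vertices: modulo the nilpotent ideal J, each A e_j is spanned by e_j. *)
Definition is_radical (e : V -> A) (J : {vspace A}) :=
  [/\ forall a x, x \in J -> a * x \in J,
      forall a x, x \in J -> x * a \in J,
      exists n, (J ^+ n = 0)%VS
    & forall a j, exists c : K, a * e j - c *: e j \in J].

Variable e : V -> A.
Hypothesis eM : forall i j, e i * e j = if i == j then e i else 0.
Hypothesis e_sum : \sum_i e i = 1.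

Lemma eMM i : e i * e i = e i. Proof. by rewrite eM eqxx. Qed.

Lemma act_esum (M : lmodule A) (x : M) : x = \sum_i act (e i) x.
Proof. by rewrite -act_suml e_sum act1. Qed.

Lemma act_ee (M : lmodule A) i (x : M) : act (e i) (act (e i) x) = act (e i) x.
Proof. by rewrite -actM eMM. Qed.

Lemma act_ene (M : lmodule A) i j (x : M) :
  act (e j) x = x -> i != j -> act (e i) x = 0.
Proof. by move=> <- ij; rewrite -actM eM (negPf ij) act0l. Qed.

Definition ecmp (M : lmodule A) k (U : {vspace M}) : {vspace M} :=
  (linfun (act (e k) : M -> M) @: U)%VS.

Lemma ecmpP (M : lmodule A) k (U : {vspace M}) x : stable U ->
  x \in ecmp k U <-> x \in U /\ act (e k) x = x.
Proof.
move=> sU; split=> [/memv_imgP[u Uu ->]|[Ux xE]].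
  by rewrite lfunE /= act_ee sU.
by rewrite -xE -[act _ _](lfunE (act (e k))) memv_img.
Qed.

Lemma mem_ecmp (M : lmodule A) k (U : {vspace M}) x :
  x \in U -> act (e k) x \in ecmp k U.
Proof. by move=> Ux; rewrite -[act _ _](lfunE (act (e k))) memv_img. Qed.

Lemma ecmpS (M : lmodule A) k (U W : {vspace M}) :
  (U <= W)%VS -> (ecmp k U <= ecmp k W)%VS.
Proof. exact: limgS. Qed.

Lemma ecmp_hom (M N : lmodule A) (f : 'Hom(M, N)) k U : modhom f ->
  (f @: ecmp k U = ecmp k (f @: U))%VS.
Proof.
move=> hf; rewrite /ecmp -!limg_comp; congr (_ @: _)%VS; apply/lfunP => x.
by rewrite !comp_lfunE !lfunE /= hf.
Qed.

(** A submodule is the sum of its e_k-parts, so the comparison can be made one vertex at a time. *)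
Lemma stable_eq (M : lmodule A) (U W : {vspace M}) : (U <= W)%VS -> stable W ->
  (forall k, \dim (ecmp k W) <= \dim (ecmp k U))%N -> stable U -> U = W.
Proof.
move=> UW sW H sU; apply/eqP; rewrite eqEsubv UW; apply/subvP => w Ww.
rewrite (act_esum w) memv_suml // => k _.
have EUW : ecmp k U = ecmp k W by apply/eqP; rewrite eqEdim ecmpS //= H.
have : act (e k) w \in ecmp k U by rewrite EUW mem_ecmp.
by case/ecmpP.
Qed.

Lemma dim_ecmp_quot (M : lmodule A) (U : submodule M) k :
  (\dim (ecmp k {:M}) =
   \dim (ecmp k {:submod U}) + \dim (ecmp k {:quotmod U}))%N.
Proof.
have := limg_ker_dim (qproj U) (ecmp k {:M}).
rewrite (ecmp_hom (N := quotmod U)) ?limg_qproj; last exact: qproj_hom.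
rewrite lker_qproj => <-; congr (_ + _)%N.
pose v : 'Hom(submod U, M) := linfun (@vsval _ _ U).
have vE x : v x = vsval x by rewrite lfunE.
have vI : lker v == 0%VS.
  apply/lker0P => x y; rewrite !vE; exact: val_inj.
rewrite -(limg_dim_eq (f := v)) ?(eqP vI) ?capv0 //.
rewrite ecmp_hom; last exact: vsval_hom.
congr (\dim _); apply/vspaceP => x; apply/idP/idP.
  rewrite memv_cap => /andP[/ecmpP[|_ xE Ux]]; first exact: stable_full.
  rewrite -xE mem_ecmp //.
  by rewrite -[x](vsprojK Ux) -vE memv_img ?memvf.
case/memv_imgP => _ /memv_imgP[u _ ->] ->; rewrite lfunE /= vE memv_cap.
by rewrite mem_ecmp ?memvf //= subm_act ?subvsP.
Qed.

Variable J : {vspace A}.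
Hypothesis JP : is_radical e J.

(** Iteration gives U inside J^m U for every m, and J is nilpotent. *)
Lemma nakayama (M : lmodule A) (U : {vspace M}) : (U <= mulv J U)%VS -> U = 0%VS.
Proof.
move=> UJ; have [_ _ [n J0] _] := JP.
have H m : (U <= mulv (J ^+ m)%VS U)%VS.
  elim: m => [|m IH].
    by apply/subvP => u Uu; rewrite -[u]act1 mem_mulv // expv0 memv_line.
  by rewrite expvSl -mulvA; apply: subv_trans UJ (mulvS _ IH).
apply/eqP; rewrite -subv0; apply: subv_trans (H n) _; rewrite J0.
by apply: mulv_sub => a u; rewrite !memv0 => /eqP-> _; rewrite act0l.
Qed.

Lemma stable_radmul (M : lmodule A) (U : {vspace M}) : stable (mulv J U).
Proof. by have [Jl _ _ _] := JP; apply: stable_mulv. Qed.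
Arguments stable_radmul {M} U _ _ _.

(** Otherwise A t lies in a maximal submodule W. If J M is inside W then so is all of M; if not, W +
    J M = M, so M/W equals J (M/W) and vanishes. *)
Lemma nakayama_gen (M : lmodule A) (t : M) :
  (forall x, exists c : K, x - c *: t \in mulv J {:M}) -> cyc t = fullv.
Proof.
move=> H; apply/eqP; apply: contraT => tf.
have [W [sW tW Wf HW]] := stable_max (stable_cyc t) tf.
pose WS := Submodule sW.
have [/= E|E] := HW (W + mulv J {:M})%VS (stableD sW (stable_radmul _)) (addvSl _ _).
  have JW : (mulv J {:M} <= W)%VS by rewrite -E addvSr.
  case/eqP: Wf; apply: eq_fullv => x; have [c xc] := H x.
  rewrite -[x](subrK (c *: t)); apply: memvD; first exact: (subvP JW).
  by rewrite memvZ // (subvP tW) ?mem_cyc1.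
have q0 : fullv = 0%VS :> {vspace (quotmod WS)}.
  apply: nakayama; apply/subvP => y _; rewrite -[y]qproj_val.
  have : vsval y \in (W + mulv J {:M})%VS by rewrite E memvf.
  case/memv_addP => w Ww [z Jz ->].
  rewrite linearD /=; have /eqP-> : qproj WS w == 0 by rewrite qproj_eq0.
  rewrite add0r; move: z Jz; apply: mulv_ind => [|k a b Ha Hb|a u Ja _].
  - by rewrite linear0 mem0v.
  - by rewrite linearP memvD ?memvZ.
  - rewrite (qproj_hom WS a u).
    exact: (@mem_mulv _ _ (quotmod WS) J fullv a _ Ja (memvf _)).
case/eqP: Wf; apply: eq_fullv => x; rewrite -[W]/(WS : {vspace M}) -qproj_eq0.
by rewrite -memv0 -q0 memvf.
Qed.

(** Such a vector spans a copy of S(j) ([sgen_line]); simple submodules and tops are handled through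
    these vectors instead of isomorphisms. *)
Definition sgen (M : lmodule A) j (n : M) :=
  [/\ n != 0, act (e j) n = n & forall r, r \in J -> act r n = 0].

Lemma sgen_act (M : lmodule A) j (n : M) a : sgen j n ->
  exists c : K, act a n = c *: n /\ (c = 0 -> a * e j \in J).
Proof.
case=> n0 nE Jn; have [_ _ _ /(_ a j)[c ac]] := JP; exists c; split.
  rewrite -nE -actM -[_ * _](subrK (c *: e j)) actDl actZl nE.
  by rewrite Jn // add0r.
by move=> c0; move: ac; rewrite c0 scale0r subr0.
Qed.

Lemma sgen_ann (M : lmodule A) j (n : M) a : sgen j n ->
  act a n = 0 <-> a * e j \in J.
Proof.
move=> sn; split=> [an0|Ja]; last first.
  by case: sn => _ nE Jn; rewrite -nE -actM Jn.
have [c [aE]] := sgen_act a sn; apply.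
case: sn => n0 _ _; apply/eqP; move: an0; rewrite aE => /eqP.
by rewrite scaler_eq0 (negPf n0) orbF.
Qed.

Lemma sgen_line (M : lmodule A) j (n : M) : sgen j n -> cyc n = <[n]>%VS.
Proof.
move=> sn; apply/eqP; rewrite eqEsubv; apply/andP; split; apply/subvP.
  by move=> _ /cycP[a ->]; have [c [-> _]] := sgen_act a sn; rewrite memvZ ?memv_line.
by move=> _ /vlineP[k ->]; rewrite memvZ ?mem_cyc1.
Qed.

Lemma sgen_isom (M N : lmodule A) j (m : M) (n : N) : sgen j m -> sgen j n ->
  cyc m = fullv -> cyc n = fullv -> isom M N.
Proof.
move=> sm sn cm cn; apply: (isom_cyc cm cn) => a.
by rewrite (sgen_ann a sm) (sgen_ann a sn).
Qed.

(** J W is a submodule of W, and it is not W by Nakayama, so J kills W; some e_j w is then nonzero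
    and spans W. *)
Lemma minimal_sgen (M : lmodule A) (W : {vspace M}) : stable W -> W != 0%VS ->
  (forall W', stable W' -> (W' <= W)%VS -> W' = 0%VS \/ W' = W) ->
  exists j n, sgen j n /\ W = <[n]>%VS.
Proof.
move=> sW W0 HW.
have JW : mulv J W = 0%VS.
  case: (HW _ (@stable_radmul M W)) => //.
    by apply: mulv_sub => a u _; apply: sW.
  by move=> E; case/eqP: W0; apply: nakayama; rewrite E.
have Jn n r : n \in W -> r \in J -> act r n = 0.
  by move=> Wn Jr; apply/eqP; rewrite -memv0 -JW mem_mulv.
have [w [Ww w0]] : exists w, w \in W /\ w != 0.
  by exists (vpick W); rewrite memv_pick vpick0.
have [j wj] : exists j, act (e j) w != 0.
  apply/not_existsP => H; case/eqP: w0; rewrite (act_esum w) big1 // => i _.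
  by apply/eqP; have /negP := H i; rewrite negbK.
have sn : sgen j (act (e j) w).
  by split=> //; [rewrite act_ee | move=> r; apply: Jn; apply: sW].
exists j, (act (e j) w); split=> //; rewrite -(sgen_line sn).
case: (HW _ (stable_cyc (act (e j) w))) => //.
  by apply: cyc_sub => //; apply: sW.
move=> E; case/eqP: wj; apply/eqP; rewrite -memv0 -E; apply: mem_cyc1.
Qed.

Lemma simple_sgen (N : lmodule A) : simple_mod N ->
  exists j (n : N), sgen j n /\ cyc n = fullv.
Proof.
move=> [d0 HS]; have [|| |j [n [sn E]]] := @minimal_sgen N fullv.
- exact: stable_full.
- by rewrite -dimv_eq0; apply/eqP.
- by move=> W' sW' _; apply: (HS (Submodule sW')).
by exists j, n; split=> //; rewrite E -(sgen_line sn).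
Qed.

Lemma sgen_simple (N : lmodule A) j (n : N) : sgen j n -> cyc n = fullv ->
  simple_mod N.
Proof.
move=> sn cn; have fE : fullv = <[n]>%VS by rewrite -cn (sgen_line sn).
case: (sn) => n0 _ _; split=> [|U].
  by apply/eqP; rewrite fE dim_vline n0.
have [U0|/subvPn[u Uu u0]] := boolP (U <= 0)%VS.
  by left; apply/eqP; rewrite -subv0.
right; apply: eq_fullv => x.
have /vlineP[k uE] : u \in <[n]>%VS by rewrite -fE memvf.
have k0 : k != 0 by apply: contra u0 => /eqP k0; rewrite uE k0 scale0r mem0v.
have /vlineP[l ->] : x \in <[n]>%VS by rewrite -fE memvf.
by rewrite -[n](scalerK k0) -uE !memvZ.
Qed.

Lemma rad_mulv (M : lmodule A) : (mulv J {:M} <= Defs.rad M)%VS.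
Proof.
apply: mulv_sub => r x Jr _; apply/mem_subm_inf => U sU.
have [j [n [sn cn]]] := simple_sgen sU.
rewrite -qproj_eq0 qproj_hom.
have /cycP[a ->] : qproj U x \in cyc n by rewrite cn memvf.
have [_ Jr' _ _] := JP; case: sn => _ _ Jn.
by rewrite -actM Jn ?Jr'.
Qed.

(** J M is itself a maximal submodule: M / J M is spanned by the image of t, which is nonzero by
    Nakayama. *)
Lemma rad_cyc (M : lmodule A) j (t : M) : t != 0 -> act (e j) t = t ->
  cyc t = fullv -> Defs.rad M = mulv J {:M} :> {vspace M} /\ t \notin Defs.rad M.
Proof.
move=> t0 tE ct.
have tJ : t \notin mulv J {:M}.
  apply: contra t0 => Jt.
  have : (fullv <= mulv J {:M})%VS by rewrite -{1}ct cyc_sub //; apply: stable_radmul.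
  by move/nakayama => E; rewrite -memv0 -E memvf.
pose U0 := Submodule (@stable_radmul M fullv).
have sU0 : simple_mod (quotmod U0).
  apply: (@sgen_simple (quotmod U0) j (qproj U0 t)).
    split; first by rewrite qproj_eq0.
      by rewrite -qproj_hom tE.
    move=> r Jr; rewrite -qproj_hom; apply/eqP; rewrite qproj_eq0 /=.
    by rewrite mem_mulv ?memvf.
  apply: eq_fullv => x; have /cycP[a E] : vsval x \in cyc t by rewrite ct memvf.
  by apply/cycP; exists a; rewrite -qproj_hom -E qproj_val.
have E : Defs.rad M = mulv J {:M} :> {vspace M}.
  apply/eqP; rewrite eqEsubv rad_mulv andbT; apply/subvP => x.
  by move/mem_subm_inf/(_ U0 sU0).
by rewrite E.
Qed.

Lemma top_sgen (M : lmodule A) j (t : M) : t != 0 -> act (e j) t = t ->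
  cyc t = fullv -> exists n : top M, sgen j n /\ cyc n = fullv.
Proof.
move=> t0 tE ct; have [E tr] := rad_cyc t0 tE ct.
exists (qproj (Defs.rad M) t); split.
  split; first by rewrite qproj_eq0.
    by rewrite -qproj_hom tE.
  move=> r Jr; rewrite -qproj_hom; apply/eqP; rewrite qproj_eq0 E.
  by rewrite mem_mulv ?memvf.
apply: eq_fullv => x; have /cycP[a Ea] : vsval x \in cyc t by rewrite ct memvf.
by apply/cycP; exists a; rewrite -qproj_hom -Ea qproj_val.
Qed.

(** With a simple top, rad M is the only maximal submodule, so A t is contained in none. *)
Lemma cyc_of_top (M : lmodule A) (t : M) : simple_mod (top M) -> t \notin Defs.rad M ->
  cyc t = fullv.
Proof.
case/simple_quotP => rf Hr tr; apply/eqP; apply: contraT => tf.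
have [W [sW tW Wf HW]] := stable_max (stable_cyc t) tf.
have rW : (Defs.rad M <= W)%VS.
  apply/subvP => x /mem_subm_inf/(_ (Submodule sW)); apply.
  by apply/simple_quotP; split.
have [E|E] := Hr W sW rW; last by rewrite E eqxx in Wf.
by case/negP: tr; rewrite -E (subvP tW) ?mem_cyc1.
Qed.

End Basic.

(** * Socles and tops *)

Section SimpleModules.
Context {K : fieldType} {A : falgType K} {d : Order.disp_t}.
Context {V : finPOrderType d} (e : V -> A).
Hypothesis eM : forall i j, e i * e j = if i == j then e i else 0.
Hypothesis e_sum : \sum_i e i = 1.
Hypothesis e_neq0 : forall i, e i != 0.
Variable J : {vspace A}.
Hypothesis JP : is_radical e J.

Local Notation S := (Smod e).

Lemma lidealP i a : (a \in (lideal (e i) : {vspace A})) = (a * e i == a).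
Proof.
rewrite /= -limg_amulr; apply/memv_imgP/eqP => [[b _ ->]|<-].
  by rewrite lfunE /= -mulrA (eMM eM).
by exists a; rewrite ?memvf // lfunE.
Qed.

Lemma mem_lideal i a : a * e i \in (lideal (e i) : {vspace A}).
Proof. by rewrite lidealP -mulrA (eMM eM). Qed.

Definition pgen i : Pmod e i := vsproj (lideal (e i)) (e i).

Lemma val_pgen i : vsval (pgen i) = e i.
Proof. by rewrite vsprojK // lidealP (eMM eM). Qed.

Lemma val_act_pgen i a : vsval (act a (pgen i)) = a * e i.
Proof. by rewrite /= val_pgen. Qed.

Lemma cyc_pgen i : cyc (pgen i) = fullv.
Proof.
apply: eq_fullv => x; apply/cycP; exists (vsval x); apply: val_inj.
by rewrite [RHS]val_act_pgen; have := subvsP x; rewrite lidealP => /eqP.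
Qed.

Lemma act_pgen0 i a : act a (pgen i) = 0 <-> a * e i = 0.
Proof.
rewrite -(val_act_pgen i a); split=> [->//|H].
by apply: val_inj; rewrite /= -[LHS]/(vsval (act a (pgen i))) H.
Qed.

Lemma act_e_pgen i : act (e i) (pgen i) = pgen i.
Proof. by apply: val_inj; rewrite [LHS]val_act_pgen (eMM eM); exact/esym/val_pgen. Qed.

Lemma pgen_neq0 i : pgen i != 0.
Proof.
by apply: contra (e_neq0 i) => /eqP E; rewrite -(val_pgen i) E.
Qed.

Lemma Smod_sgen i : exists n : S i, sgen e J i n /\ cyc n = fullv.
Proof.
apply: (top_sgen eM e_sum JP (pgen_neq0 i)); first exact: act_e_pgen.
exact: cyc_pgen.
Qed.

Lemma dim_ecmp_sgen (N : lmodule A) j (n : N) k : sgen e J j n ->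
  cyc n = fullv -> \dim (ecmp e k {:N}) = (k == j).
Proof.
move=> sn cn; case: (sn) => n0 nE _; have fE : fullv = <[n]>%VS.
  by rewrite -cn (sgen_line JP sn).
rewrite /ecmp {1}fE limg_line lfunE /= dim_vline.
have [->|kj] := eqVneq k j; first by rewrite nE n0.
by rewrite (act_ene eM nE kj) eqxx.
Qed.

Lemma ann_sgen (N M : lmodule A) j (n : N) (m : M) : sgen e J j n ->
  (forall a, act a m = 0 <-> a * e j \in J) -> sgen e J j m.
Proof.
move=> [n0 nE Jn] am; have [_ Jr _ _] := JP; split.
- apply: contra n0 => /eqP m0.
  have /Jn : e j \in J by rewrite -[e j]mul1r -am m0 linear0.
  by rewrite nE => ->.
- apply/eqP; rewrite -subr_eq0 -[X in _ - X]act1 -actBl; apply/eqP/am.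
  by rewrite mulrBl (eMM eM) mul1r subrr mem0v.
- by move=> r Jr'; apply/am; apply: Jr.
Qed.

Lemma filtered_Smod (M : lmodule A) s k : filtered S M s ->
  \dim (ecmp e k {:M}) = count_mem k s.
Proof.
elim: s M => [|i s IH] M /=.
  by move=> d0; apply/eqP; rewrite -leqn0 -d0 dimvS ?subvf.
case=> U [iU /IH E]; rewrite (dim_ecmp_quot eM U) E addnC; congr (_ + _)%N.
have [n [sn cn]] := Smod_sgen i.
have [m [cm Hm]] := isom_cyc_gen iU cn.
have am a : act a m = 0 <-> a * e i \in J by rewrite Hm; apply: (sgen_ann JP a).
rewrite (dim_ecmp_sgen k (ann_sgen sn am) cm) eq_sym //.
Qed.

Lemma Smod_filtration (M : lmodule A) : exists s, filtered S M s.
Proof.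
move: {2}(\dim {:M}) (leqnn (\dim {:M})) => n.
elim: n M => [|n IH] M dM; first by exists [::]; apply/eqP; rewrite -leqn0.
have [d0|d0] := eqVneq (\dim {:M}) 0%N; first by exists [::].
have [||W [sW _ Wf HW]] := @stable_max _ _ M 0%VS; first exact: stable0.
  by apply: contra d0 => /eqP <-; rewrite dimv0.
pose U := Submodule sW.
have [|j [m [sm cm]]] := @simple_sgen _ _ _ e eM e_sum _ JP (quotmod U).
  by apply/simple_quotP; split.
have [|s Hs] := IH (submod U).
  rewrite dimvf /=; have /= := dimvS (subvf W).
  move: Wf; rewrite eqEdim subvf /= -ltnNge /dim /=; lia.
exists (j :: s), U; split=> //.
by have [k [sk ck]] := Smod_sgen j; apply: (sgen_isom JP sm sk).
Qed.

(** A factor S(j) adds one to dim e_j M and nothing to the other e_k M. Hence the existential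
    [filt_mult] determines a number. *)
Lemma filt_mult_SmodP (M : lmodule A) k m :
  filt_mult S M k m <-> \dim (ecmp e k {:M}) = m.
Proof.
split=> [[s [/filtered_Smod-> ]]//|<-].
by have [s Hs] := Smod_filtration M; exists s; rewrite (filtered_Smod k Hs).
Qed.

Lemma ecmp_eq0 (M : lmodule A) k :
  \dim (ecmp e k {:M}) = 0%N <-> forall x : M, act (e k) x = 0.
Proof.
split=> [/eqP|H].
  rewrite dimv_eq0 => /eqP E x; apply/eqP; rewrite -memv0 -E.
  exact: mem_ecmp (memvf _).
apply/eqP; rewrite dimv_eq0 -subv0; apply/subvP => _ /memv_imgP[x _ ->].
by rewrite lfunE /= H mem0v.
Qed.

Lemma sgen_soc (M : lmodule A) j (n : M) : sgen e J j n -> n \in soc M.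
Proof.
move=> sn; apply/mem_subm_inf => W HW.
apply: (subvP (HW (Submodule (stable_cyc n)) _)); last exact: mem_cyc1.
apply/simple_subP; case: (sn) => n0 nE Jn; split.
  by apply: contra n0 => /eqP /= E; rewrite -memv0 -E mem_cyc1.
move=> X sX; rewrite /= (sgen_line JP sn) => XW.
have [X0|/subvPn[u Xu u0]] := boolP (X <= 0)%VS.
  by left; apply/eqP; rewrite -subv0.
right; apply/eqP; rewrite eqEdim XW dim_vline n0 lt0n dimv_eq0.
by apply: contra u0 => /eqP <-.
Qed.

(* M embeds in I(v), the dual of e_v A, by x |-> (a |-> f (e_v a x)). *)
Definition cogenerated v (M : lmodule A) :=
  exists f : 'Hom(M, K^o),
    forall x, (forall a, f (act (e v) (act a x)) = 0) -> x = 0.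

(** A simple submodule is spanned by some n at the vertex v with f n nonzero. Two such vectors are
    proportional: n - (f n / f z) z is killed by f, so it cannot be a nonzero socle vector. *)
Lemma cogenerated_soc v (M : lmodule A) : \dim {:M} <> 0%N ->
  cogenerated v M -> exists z, sgen e J v z /\ soc M = <[z]>%VS :> {vspace M}.
Proof.
move=> d0 [f Hf].
have sgv j (n : M) : sgen e J j n -> j = v /\ f n != 0.
  move=> sn; have [n0 nE Jn] := sn.
  have : ~ forall a, f (act (e v) (act a n)) = 0.
    by move/Hf => E; rewrite E eqxx in n0.
  case/existsNP => a; have [c [-> _]] := sgen_act JP a sn.
  rewrite !linearZ /= => /eqP fn.
  have [jv|vj] := eqVneq v j.
    split=> //; apply: contra fn => /eqP f0.
    by rewrite jv nE f0 scaler0.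
  by rewrite (act_ene eM nE vj) linear0 scaler0 eqxx in fn.
have [|W [sW _ W0 HW]] := @stable_min _ _ M fullv (@stable_full _ _ M).
  by rewrite -dimv_eq0; apply/eqP.
have [j [z [sz _]]] := minimal_sgen eM e_sum JP sW W0 HW.
have [jv fz] := sgv j z sz; rewrite {}jv in sz.
exists z; split=> //; apply/eqP; rewrite eqEsubv; apply/andP; split; last first.
  by apply/subvP => _ /vlineP[k ->]; rewrite memvZ ?(sgen_soc sz).
apply/subvP => x /mem_subm_inf.
have sl : stable <[z]>%VS by rewrite -(sgen_line JP sz); apply: stable_cyc.
move/(_ (Submodule sl)); apply=> U /simple_subP[U0 HU] /=.
have [k [n [sn ->]]] := minimal_sgen eM e_sum JP (@subm_stable _ _ M U) U0 HU.
have [kv fn] := sgv k n sn; rewrite {}kv in sn.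
rewrite -memvE; apply/vlineP; exists ((f n : K) / (f z : K)).
apply/eqP; rewrite -subr_eq0; apply: contraT => y0.
have sy : sgen e J v (n - ((f n : K) / (f z : K)) *: z).
  case: sn sz => _ nE Jn [_ zE Jz]; split=> //.
    by rewrite linearB linearZ /= nE zE.
  by move=> r Jr; rewrite linearB linearZ /= Jn // Jz // scaler0 subr0.
have [_] := sgv v _ sy.
rewrite linearB linearZ /= -[_ *: f z]/((f n : K) / (f z : K) * (f z : K)).
by rewrite mulfVK // subrr eqxx.
Qed.

Lemma line_sgen (M : lmodule A) (U : submodule M) j z :
  sgen e J j z -> U = <[z]>%VS :> {vspace M} ->
  exists n : submod U, sgen e J j n /\ cyc n = fullv.
Proof.
move=> [z0 zE Jz] UE; have Uz : z \in U by rewrite UE memv_line.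
exists (vsproj U z : submod U).
have vz : vsval (vsproj U z) = z by rewrite vsprojK.
split; first split.
- by apply: contra z0 => /eqP E; rewrite -vz E linear0.
- by apply: val_inj; rewrite /= vz.
- by move=> r Jr; apply: val_inj; rewrite /= vz Jz.
apply: eq_fullv => x.
have /vlineP[k xE] : vsval x \in <[z]>%VS by apply: (subvP _ _ (subvsP x)); rewrite UE.
 have -> : x = k *: vsproj U z.
  by apply: val_inj; rewrite /= vz.
by rewrite memvZ ?mem_cyc1.
Qed.

Lemma cogenerated_soc_isom v (M : lmodule A) : \dim {:M} <> 0%N ->
  cogenerated v M -> isom (submod (soc M)) (S v) /\ simple_mod (submod (soc M)).
Proof.
move=> d0 cM; have [z [sz E]] := cogenerated_soc d0 cM.
have [n [sn cn]] := line_sgen sz E; have [m [sm cm]] := Smod_sgen v.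
by split; [apply: (sgen_isom JP sn sm) | apply: (sgen_simple JP sn)].
Qed.

Lemma soc_line (M : lmodule A) (n : submod (soc M)) j :
  sgen e J j n -> cyc n = fullv ->
  sgen e J j (vsval n) /\ soc M = <[vsval n]>%VS :> {vspace M}.
Proof.
move=> sn cn; case: (sn) => n0 nE Jn; split.
  split.
  - by apply: contra n0 => /eqP E; apply/eqP/val_inj.
  - by have /(congr1 val) := nE.
  - by move=> r /Jn/(congr1 val).
apply/vspaceP => x; apply/idP/idP => [sx|/vlineP[k ->]]; last first.
  by rewrite memvZ ?subvsP.
have : vsproj (soc M) x \in cyc n by rewrite cn memvf.
rewrite (sgen_line JP sn) => /vlineP[k /(congr1 val)] /=.
by rewrite vsprojK // => ->; rewrite memvZ ?memv_line.
Qed.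

(** Every nonzero x generates a submodule containing a socle vector at v, and these are all
    multiples of one z. Any functional nonzero at z therefore works. *)
Lemma cogenerated_of_ess v (M : lmodule A) :
  (forall x : M, x != 0 -> exists a, act (e v) (act a x) != 0) ->
  (forall x y : M, sgen e J v x -> sgen e J v y -> exists c, y = c *: x) ->
  cogenerated v M.
Proof.
move=> ess one.
have minv (x : M) : x != 0 -> exists a, sgen e J v (act a x).
  move=> x0; have [|W [sW WU W0 HW]] := stable_min (stable_cyc x).
    by apply: contra x0 => /eqP E; rewrite -memv0 -E mem_cyc1.
  have [j [z [sz WE]]] := minimal_sgen eM e_sum JP sW W0 HW.
  have [a az] : exists a, z = act a x.
    by apply/cycP/(subvP WU); rewrite WE memv_line.
  exists a; rewrite -az; have [z0 zE _] := sz.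
  have [b] := ess z z0; have [c [-> _]] := sgen_act JP b sz.
  have [->//|vj] := eqVneq v j.
  by rewrite linearZ /= (act_ene eM zE vj) scaler0 eqxx.
have [[x0 x00]|H] := pselect (exists x : M, x != 0); last first.
  exists 0 => x _; apply/eqP; apply: contraT => x0.
  by case: H; exists x.
have [a0 sz] := minv x0 x00; have [z0 _ _] := sz.
have [f fz] := functional_neq0 z0.
exists f => x Hx; apply/eqP; apply: contraT => xn0.
have [a sa] := minv x xn0; have [c E] := one _ _ sz sa.
have := Hx a; case: sa => ax0 -> _; rewrite E linearZ /= => /eqP.
rewrite /GRing.scale /= mulf_eq0 (negPf fz) orbF => /eqP c0.
by move: ax0; rewrite E c0 scale0r eqxx.
Qed.

Lemma soc_isom_cogenerated v (M : lmodule A) :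
  isom (submod (soc M)) (S v) -> cogenerated v M.
Proof.
move=> iS; have [m [sm cm]] := Smod_sgen v.
have [n [cn Hn]] := isom_cyc_gen iS cm.
have an a : act a n = 0 <-> a * e v \in J by rewrite Hn; apply: (sgen_ann JP a).
have sn := ann_sgen sm an.
have [sz sE] := soc_line sn cn.
apply: cogenerated_of_ess => [x x0|x y sx sy].
  have [|W [sW WU W0 HW]] := stable_min (stable_cyc x).
    by apply: contra x0 => /eqP E; rewrite -memv0 -E mem_cyc1.
  have [j [w [sw WE]]] := minimal_sgen eM e_sum JP sW W0 HW.
  have [a aw] : exists a, w = act a x.
    by apply/cycP/(subvP WU); rewrite WE memv_line.
  exists a; rewrite -aw; have := sgen_soc sw; rewrite sE => /vlineP[k wE].
  case: sz sw => _ zE _ [w0 _ _].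
  by rewrite wE linearZ /= zE -wE.
have := sgen_soc sx; have := sgen_soc sy; rewrite sE => /vlineP[k ->] /vlineP[l xE].
have l0 : l != 0.
  by case: sx => x0 _ _; apply: contra x0 => /eqP l0; rewrite xE l0 scale0r.
by exists (k / l); rewrite xE scalerA mulfVK.
Qed.

Lemma simple_soc_sgen (M : lmodule A) : simple_mod (submod (soc M)) ->
  forall j (x y : M), sgen e J j x -> sgen e J j y -> exists c, y = c *: x.
Proof.
move=> sS j x y sx sy.
have [k [n [sn cn]]] := simple_sgen eM e_sum JP sS.
have [sz sE] := soc_line sn cn.
have := sgen_soc sx; have := sgen_soc sy; rewrite sE => /vlineP[a ->] /vlineP[l xE].
have l0 : l != 0.
  by case: sx => x0 _ _; apply: contra x0 => /eqP l0; rewrite xE l0 scale0r.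
by exists (a / l); rewrite xE scalerA mulfVK.
Qed.

Definition generated v (M : lmodule A) :=
  exists t : M, act (e v) t = t /\ cyc t = fullv.

Lemma generated_top v (M : lmodule A) : \dim {:M} <> 0%N -> generated v M ->
  isom (top M) (S v) /\ simple_mod (top M).
Proof.
move=> d0 [t [tE ct]]; have t0 : t != 0.
  apply/eqP => t0; apply: d0; apply/eqP; rewrite dimv_eq0 -ct t0 -subv0.
  by apply/subvP => _ /cycP[a ->]; rewrite linear0 mem0v.
have [n [sn cn]] := top_sgen eM e_sum JP t0 tE ct; have [m [sm cm]] := Smod_sgen v.
by split; [apply: (sgen_isom JP sn sm) | apply: (sgen_simple JP sn)].
Qed.

Lemma top_isom_generated v (M : lmodule A) : isom (top M) (S v) -> generated v M.
Proof.
move=> iS; have [m [sm cm]] := Smod_sgen v.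
have [n [cn Hn]] := isom_cyc_gen iS cm.
have an a : act a n = 0 <-> a * e v \in J by rewrite Hn; apply: (sgen_ann JP a).
have sn := ann_sgen sm an; have [n0 nE _] := sn.
exists (act (e v) (vsval n)); split; first by rewrite (act_ee eM).
apply: (cyc_of_top (sgen_simple JP sn cn)).
by rewrite -qproj_eq0 qproj_hom qproj_val nE.
Qed.

(** The second hypothesis says that e_v M generates M, so e_v M is not inside the radical. *)
Lemma simple_top_generated v (M : lmodule A) : simple_mod (top M) ->
  (forall W : {vspace M}, stable W -> (forall x, act (e v) x = x -> x \in W) ->
     W = fullv) ->
  generated v M.
Proof.
move=> sT H; have /simple_quotP[/eqP rf _] := sT.
have /existsNP[t /not_implyP[tE /negP tr]] :
    ~ forall x : M, act (e v) x = x -> x \in Defs.rad M.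
  by move=> Hx; apply: rf; apply: H Hx; apply: subm_stable.
by exists t; split=> //; apply: cyc_of_top sT tr.
Qed.

End SimpleModules.

(** * Standard and costandard modules *)

Section Standard.
Context {K : fieldType} {A : falgType K} {d : Order.disp_t}.
Context {V : finPOrderType d} (e : V -> A).
Implicit Types X Y : pred V.

(* The ideal A e_X A, where e_X is the sum of the e_j with X j; [idn i] below is
   J(i). *)
Definition idl (X : pred V) : {vspace A} :=
  ({:A} * <[\sum_(j | X j) e j]> * {:A})%VS.

Lemma idl_ind X (P : A -> Prop) : P 0 ->
  (forall k x y, P x -> P y -> P (k *: x + y)) ->
  (forall a j b, X j -> P (a * e j * b)) ->
  forall x, x \in idl X -> P x.
Proof.
move=> P0 PL Pa x; have [W WP] := vspace_of P0 PL.
suff sW : (idl X <= W)%VS by move/(subvP sW)/WP.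
apply/prodvP => c b; rewrite -limg_amulr => /memv_imgP[a _ ->] _.
rewrite lfunE /= mulr_sumr mulr_suml memv_suml // => j Xj.
exact/WP/Pa.
Qed.

Lemma idl_mull X a x : x \in idl X -> a * x \in idl X.
Proof.
move=> Jx; have : a * x \in ({:A} * idl X)%VS by rewrite memv_mul ?memvf.
apply: subvP; rewrite /idl !prodvA.
by do 2!apply: prodvSl; apply: subvf.
Qed.

Lemma idl_mulr X a x : x \in idl X -> x * a \in idl X.
Proof.
move=> Jx; have : x * a \in (idl X * {:A})%VS by rewrite memv_mul ?memvf.
by apply: subvP; rewrite /idl -prodvA; apply: prodvSr; apply: subvf.
Qed.

Hypothesis eM : forall i j, e i * e j = if i == j then e i else 0.

Lemma mem_idl X k : X k -> e k \in idl X.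
Proof.
move=> Xk; have -> : e k = 1 * (\sum_(j | X j) e j) * e k.
  rewrite mul1r mulr_suml (bigD1 k) //= (eMM eM) big1 ?addr0 // => j /andP[_ jk].
  by rewrite eM (negPf jk).
by rewrite !memv_mul ?memvf ?memv_line.
Qed.

Lemma mem_idl_mul X k a b : X k -> a * e k * b \in idl X.
Proof. by move=> Xk; rewrite idl_mulr ?idl_mull ?mem_idl. Qed.

Lemma idlS X Y : (forall k, X k -> Y k) -> (idl X <= idl Y)%VS.
Proof.
move=> XY; apply/subvP; apply: idl_ind => [|k x y Hx Hy|a j b Xj].
- exact: mem0v.
- by rewrite memvD ?memvZ.
- by rewrite mem_idl_mul ?XY.
Qed.

Definition idn i := idl (fun j => ~~ (j <= i)%O).

Lemma idn_le i j : (j <= i)%O -> (idn i <= idn j)%VS.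
Proof.
by move=> ji; apply: idlS => k; apply: contra => kj; apply: le_trans ji.
Qed.

Lemma act_idl_sub (M : lmodule A) X (W : {vspace M}) : stable W ->
  forall u, (forall k a, X k -> act (e k) (act a u) \in W) ->
  forall x, x \in idl X -> act x u \in W.
Proof.
move=> sW u H x; move: x; apply: idl_ind => [|k x y Hx Hy|a j b Xj].
- by rewrite act0l mem0v.
- by rewrite actDl actZl memvD ?memvZ.
- by rewrite actM actM sW ?H.
Qed.

Hypothesis e_sum : \sum_i e i = 1.
Hypothesis e_neq0 : forall i, e i != 0.
Variable J : {vspace A}.
Hypothesis JP : is_radical e J.

(** The submodule divided out in [Delta] is J(i) e_i: P(i)/U has no factor S(j) with j not <= i
    exactly when U contains J(i) e_i. *)
Lemma Delta_gen i : exists g : Delta e i,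
  [/\ act (e i) g = g, cyc g = fullv
    & forall a, act a g = 0 <-> a * e i \in idn i].
Proof.
rewrite /Delta; set D := subm_inf _.
have DP (v : Pmod e i) : v \in D <-> vsval v \in idn i.
  split=> [/mem_subm_inf H|Jv].
    have [W WP] := @vspace_of _ (Pmod e i) (fun v => vsval v \in idn i)
      (mem0v _) (fun k u v Hu Hv => memvD (memvZ k Hu) Hv).
    have sW : stable W.
      by move=> a u /WP Hu; apply/WP; apply: idl_mull.
    apply/WP; apply: (H (Submodule sW)) => j ji.
    apply/(filt_mult_SmodP eM e_sum e_neq0 JP)/ecmp_eq0 => x.
    rewrite -[x]qproj_val -qproj_hom; apply/eqP; rewrite qproj_eq0.
    apply/WP; rewrite -[vsval _]mul1r mulrA /=.
    exact: mem_idl_mul.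
  apply/mem_subm_inf => W HW.
  have -> : v = act (vsval v) (pgen e i).
    apply: val_inj; rewrite [RHS](val_act_pgen eM).
    by have := subvsP v; rewrite (lidealP eM) => /eqP.
  apply: act_idl_sub Jv; first exact: subm_stable.
  move=> k a ki; rewrite -qproj_eq0 qproj_hom.
  have /(filt_mult_SmodP eM e_sum e_neq0 JP)/ecmp_eq0 H := HW k ki.
  exact/eqP/H.
exists (qproj D (pgen e i)); split.
- by rewrite -qproj_hom (act_e_pgen eM).
- apply: eq_fullv => x.
  have /cycP[a E] : vsval x \in cyc (pgen e i) by rewrite (cyc_pgen eM) memvf.
  by apply/cycP; exists a; rewrite -qproj_hom -E qproj_val.
move=> a; rewrite -qproj_hom; split=> [/eqP|H].
  by rewrite qproj_eq0 => /DP; rewrite (val_act_pgen eM).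
by apply/eqP; rewrite qproj_eq0; apply/DP; rewrite (val_act_pgen eM).
Qed.

Lemma isom_Delta (N : lmodule A) i : isom N (Delta e i) <->
  exists g : N, [/\ act (e i) g = g, cyc g = fullv
    & forall a, act a g = 0 <-> a * e i \in idn i].
Proof.
have [h [hE ch Hh]] := Delta_gen i.
split=> [iN|[g [gE cg Hg]]]; last first.
  by apply: (isom_cyc cg ch) => a; split=> [/Hg/Hh|/Hh/Hg].
have [g [cg Hg]] := isom_cyc_gen iN ch; exists g; split=> // [|a]; last first.
  by split=> [/Hg/Hh|/Hh/Hg].
apply/eqP; rewrite -subr_eq0 -[X in _ - X]act1 -actBl; apply/eqP/Hg.
by rewrite actBl act1 hE subrr.
Qed.

(** * Elements of I(i) as functionals on A *)

Section DualElements.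
Variable i : V.
Implicit Types (f g : Imod e i) (a b : A).

Lemma eA_P a : (a \in (<[e i]> * {:A})%VS) = (e i * a == a).
Proof.
apply/idP/eqP => [|<-]; last by rewrite memv_mul ?memvf ?memv_line.
have sW : (<[e i]> * {:A} <= lker (amull (e i) - \1%VF))%VS.
  apply/prodvP => _ b /vlineP[k ->] _; rewrite memv_ker add_lfunE opp_lfunE.
  by rewrite !lfunE /= -!scalerAl -scalerAr mulrA (eMM eM) subrr.
move/(subvP sW); rewrite memv_ker add_lfunE opp_lfunE !lfunE /=.
by rewrite subr_eq0 => /eqP.
Qed.

Lemma mem_eA a : e i * a \in (<[e i]> * {:A})%VS.
Proof. by rewrite eA_P mulrA (eMM eM). Qed.

(* An element f of I(i) = D(e_i A) is handled through the functional
   a |-> f (e_i a) on A. *)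
Definition nev f a : K^o :=
  (f : 'Hom(subvs_of (<[e i]> * {:A})%VS, K^o))
    (vsproj (<[e i]> * {:A})%VS (e i * a)).

Lemma nev_linear f : linear (nev f).
Proof. by move=> k a b; rewrite /nev mulrDr -scalerAr !linearP. Qed.

Lemma nev_linearl a : linear (nev^~ a).
Proof. by move=> k f g; rewrite /nev add_lfunE scale_lfunE. Qed.

Lemma nev_act f a b : nev (act b f) a = nev f (a * b).
Proof.
rewrite /nev [in LHS]/= dual_actE vsprojK ?mem_eA //.
by rewrite mulrA.
Qed.

Lemma nev_e f a : nev f (e i * a) = nev f a.
Proof. by rewrite /nev mulrA (eMM eM). Qed.

Lemma nev_inj f g : (forall a, nev f a = nev g a) -> f = g.
Proof.
move=> H; apply/lfunP => x; have := H (vsval x); rewrite /nev.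
have := subvsP x; rewrite eA_P => /eqP->.
by rewrite vsvalK.
Qed.

Definition nmk (h : 'Hom(A, K^o)) : Imod e i :=
  (h \o linfun (@vsval _ _ (<[e i]> * {:A})%VS))%VF.

Lemma nev_nmk (h : 'Hom(A, K^o)) a : nev (nmk h) a = h (e i * a).
Proof. by rewrite /nev /nmk comp_lfunE lfunE /= vsprojK ?mem_eA. Qed.

Definition nevf f : 'Hom(A, K^o) := linfun (nev f).

Lemma nevfE f a : nevf f a = nev f a.
Proof. by rewrite /nevf linfunE //; apply: nev_linear. Qed.

(** The adjunction Hom_A(N, I(i)) = Hom_K(e_i N, K), in the direction that constructs
    homomorphisms. *)
Lemma hom_Imod (N : lmodule A) (h : 'Hom(N, K^o)) :
  exists F : 'Hom(N, Imod e i), modhom F /\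
    forall x a, nev (F x) a = h (act (e i) (act a x)).
Proof.
pose F (x : N) : Imod e i :=
  nmk (linfun (fun a => h (act a x))).
have lh (x : N) : linear (fun a => h (act a x)).
  by move=> k a b; rewrite actDl actZl linearP.
have FE x a : nev (F x) a = h (act (e i) (act a x)).
  by rewrite /F nev_nmk linfunE // actM.
have lF : linear F.
  move=> k x y; apply: nev_inj => a; rewrite nev_linearl !FE.
  by rewrite !linearP.
exists (linfun F); split=> [a x|x a]; last by rewrite linfunE.
rewrite !linfunE //; apply: nev_inj => b.
by rewrite nev_act !FE actM.
Qed.

Definition nabla_sub : submodule (Imod e i) :=
  subm_sup (fun U : submodule (Imod e i) =>
    forall j, ~~ (j <= i)%O -> filt_mult (Smod e) (submod U) j 0).

(** The functionals killing J(i) form a submodule of the required kind. Conversely, in such a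
    submodule e_j acts as zero for j not <= i, and J(i) is spanned by elements factoring through
    these e_j. *)
Lemma nabla_subP f : f \in nabla_sub <-> forall a, a \in idn i -> nev f a = 0.
Proof.
have [|k u v Hu Hv a Ja|W WP] := @vspace_of _ (Imod e i)
    (fun f => forall a, a \in idn i -> nev f a = 0).
- by move=> a _; rewrite /nev zero_lfunE.
- by rewrite nev_linearl Hu ?Hv // scaler0 addr0.
have sW : stable W.
  move=> a u /WP Hu; apply/WP => b Jb; rewrite nev_act.
  by apply: Hu; apply: idl_mulr.
split=> [/mem_subm_inf/(_ (Submodule sW)) H|/WP Wf].
  apply/WP/H => U HU; apply/subvP => u Uu; apply/WP => a Ja.
  rewrite -[a]mulr1 -nev_act /=.
  suff H1 : forall b, nev u (a * b) = 0 by rewrite nev_act H1.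
  move: a Ja; apply: idl_ind => [b|k x y Hx Hy c|a j b ji c].
  - by rewrite mul0r -nevfE linear0.
  - by rewrite mulrDl -scalerAl nev_linear Hx Hy scaler0 addr0.
  have /(filt_mult_SmodP eM e_sum e_neq0 JP)/ecmp_eq0 Hj := HU j ji.
  have Uc : act (b * c) u \in U by rewrite subm_act.
  have E0 : act (e j) (act (b * c) u) = 0.
    have /(congr1 val) := Hj (vsproj U (act (b * c) u) : submod U).
    by rewrite /= vsprojK.
  by rewrite -!mulrA -nev_act actM E0 /nev zero_lfunE.
apply/mem_subm_inf => X HX.
apply: (subvP (HX (Submodule sW) _)) Wf => j ji.
apply/(filt_mult_SmodP eM e_sum e_neq0 JP)/ecmp_eq0 => x.
apply: val_inj => /=; apply: nev_inj => a; rewrite nev_act.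
rewrite [RHS]/nev zero_lfunE; have /WP := subvsP x; apply.
by rewrite -[a * _]mulr1 mem_idl_mul.
Qed.

End DualElements.

Lemma cogenerated_P v j : cogenerated e v (Pmod e j) <->
  exists f : 'Hom(A, K^o), forall x, x * e j = x ->
    (forall a, f (e v * a * x) = 0) -> x = 0.
Proof.
split=> [[f Hf]|[f Hf]].
  exists (f \o linfun (vsproj (lideal (e j))))%VF => x xE Hx.
  have Px : x \in (lideal (e j) : {vspace A}) by rewrite (lidealP eM) xE.
  rewrite -[x](vsprojK Px); have -> : vsproj (lideal (e j)) x = 0.
    apply: Hf => a; have := Hx a; rewrite comp_lfunE lfunE /=.
    congr (_ = _); congr (f _); apply: val_inj.
    rewrite /= !vsprojK ?mulrA //.
    by rewrite (lidealP eM) -mulrA xE.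
  by rewrite linear0.
exists (f \o linfun (@vsval _ _ (lideal (e j))))%VF => x Hx.
apply: val_inj; apply: Hf => [|a]; last first.
  by have := Hx a; rewrite comp_lfunE lfunE /= mulrA.
by have := subvsP x; rewrite (lidealP eM) => /eqP.
Qed.

(** A generator t at v is itself the functional f: every functional on e_j A has the form a t, so a
    vector orthogonal to A e_v is zero. For the converse, [functional_repr] writes each element as a
    t. *)
Lemma generated_I v j : generated e v (Imod e j) <->
  exists f : 'Hom(A, K^o), forall x, e j * x = x ->
    (forall a, f (x * a * e v) = 0) -> x = 0.
Proof.
split=> [[t [tE ct]]|[f Hf]].
  exists (nevf t) => x xE Hx; apply/eqP; apply: contraT => /functional_neq0[g gx].
  case/eqP: gx; have /cycP[a E] : nmk j g \in cyc t by rewrite ct memvf.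
  rewrite -xE -nev_nmk E -tE -actM nev_act -nevfE mulrA; exact: Hx.
pose h (x : A) : K^o := f (x * e v).
have lh : linear h by move=> k x y; rewrite /h mulrDl -scalerAl linearP.
have tE a b : nev (act b (nmk j (linfun h))) a = f (e j * a * b * e v).
  by rewrite nev_act nev_nmk linfunE // /h !mulrA.
exists (nmk j (linfun h)); split.
  apply: nev_inj => a; rewrite tE nev_nmk linfunE // /h.
  by rewrite -mulrA (eMM eM).
apply: eq_fullv => g; apply/cycP.
have [|||a Ha] := @functional_repr _ A A (fun a w => f (e j * w * a * e v)) _ _ (nevf g).
- by move=> a k x y; rewrite mulrDr !mulrDl -scalerAr -!scalerAl linearP.
- by move=> a k x y; rewrite mulrDr !mulrDl -scalerAr -!scalerAl linearP.
- move=> w Hw; rewrite nevfE -nev_e.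
  have -> : e j * w = 0 by apply: Hf; rewrite ?mulrA ?(eMM eM).
  by rewrite -nevfE linear0.
by exists a; apply: nev_inj => w; rewrite tE -Ha nevfE.
Qed.

Lemma injects_Delta j n : injects (Delta e j) (Delta e n) <->
  exists c, [/\ e j * c = c, c * e n = c
    & forall a, a * c \in idn n <-> a * e j \in idn j].
Proof.
have [g [gE cg Hg]] := Delta_gen j; have [h [hE ch Hh]] := Delta_gen n.
split=> [[f [hf fI]]|[c [jc cn Hc]]].
  have /cycP[b fg] : f g \in cyc h by rewrite ch memvf.
  exists (e j * b * e n); split; rewrite ?mulrA ?(eMM eM) //.
    by rewrite -mulrA (eMM eM).
  move=> a; rewrite !mulrA -Hh actM actM -fg -hf gE.
  rewrite -Hg; split=> [E|E]; last by rewrite -hf E linear0.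
  by apply: fI; rewrite linear0 hf.
have [|f [hf fg]] := @cyc_hom _ _ _ _ g (act c h : Delta e n) cg.
  by move=> a /Hg/Hc; rewrite -actM Hh -mulrA cn.
exists f; split=> // x y /eqP; rewrite -subr_eq0 -linearB /=.
have /cycP[a E] : x - y \in cyc g by rewrite cg memvf.
move/eqP; rewrite E hf fg -actM Hh -mulrA cn Hc -Hg => E0.
by apply/eqP; rewrite -subr_eq0 E E0.
Qed.

End Standard.

(** * Filtrations *)

Section Filtrations.
Context {K : fieldType} {A : falgType K} {d : Order.disp_t}.
Context {V : finPOrderType d} (e : V -> A).
Implicit Types X Y : pred V.
Hypothesis eM : forall i j, e i * e j = if i == j then e i else 0.
Hypothesis e_sum : \sum_i e i = 1.
Hypothesis e_neq0 : forall i, e i != 0.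
Variable J : {vspace A}.
Hypothesis JP : is_radical e J.

Let nabP i := nabla_subP eM e_sum e_neq0 JP (i := i).

Lemma surjects_Nabla j n : surjects (Nabla e n) (Nabla e j) <->
  exists c, [/\ e n * c = c, c * e j = c
    & forall a, c * a \in idn e n <-> e j * a \in idn e j].
Proof.
split=> [[F [hF sF]]|[c [nc cj Hc]]].
  (* Evaluating F at 1 is a functional on the dual of A, hence evaluation at some c0; A-linearity
     then gives F(x)(a) = x(c0 e_j a). *)
  pose m (f : 'Hom(A, K^o)) : K^o :=
    nev (i := j) (vsval (F (vsproj (nabla_sub e n) (nmk e n f)))) 1.
  have lm : linear m.
    move=> k f g; rewrite /m; have -> : nmk e n (k *: f + g) = k *: nmk e n f + nmk e n g.
      apply: (nev_inj eM) => a; rewrite nev_linearl !(nev_nmk eM).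
      by rewrite add_lfunE scale_lfunE.
    by rewrite !linearP nev_linearl.
  have [c0 Hc0] := bidual (linfun m).
  have FE (x : Nabla e n) a : nev (vsval (F x)) a = nev (vsval x) (c0 * e j * a).
    pose g := nevf (vsval (act (e j * a) x)).
    rewrite -(nev_e eM) -[e j * a]mul1r -(nev_act eM) -[act _ (vsval _)]/(vsval (act (e j * a) (F x))).
    rewrite -hF -mulrA -(nev_act eM) -(nevfE (act _ _)).
    rewrite -[nevf _]/g -Hc0 linfunE // /m; congr (nev (vsval (F _)) _).
    apply: val_inj; rewrite [RHS]vsprojK.
      by apply: (nev_inj eM) => b; rewrite (nev_nmk eM) nevfE (nev_e eM).
    have -> : nmk e n g = vsval (act (e j * a) x).
      by apply: (nev_inj eM) => b; rewrite (nev_nmk eM) nevfE (nev_e eM).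
    exact: subvsP.
  exists (e n * (c0 * e j)); split; rewrite ?mulrA ?(eMM eM) //.
    by rewrite -!mulrA (eMM eM).
  move=> a; split=> [H|H].
    apply: contraT => /functional_sep[g [g0]].
    have gN : nmk e j g \in nabla_sub e j.
      by apply/nabP => b Jb; rewrite (nev_nmk eM) g0 // idl_mull.
    have : vsproj (nabla_sub e j) (nmk e j g) \in limg F by rewrite sF memvf.
    case/memv_imgP => x _ E.
    rewrite -(nev_nmk eM) -[nmk e j g](vsprojK gN) E FE -(nev_e eM) !mulrA.
    by rewrite ((nabP _).1 (subvsP x)) ?eqxx.
  apply: contraT => /functional_sep[g [g0]].
  pose h := nmk e n g.
  have gN : h \in nabla_sub e n.
    by apply/nabP => b Jb; rewrite (nev_nmk eM) g0 // idl_mull.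
  have := FE (vsproj (nabla_sub e n) h) a; rewrite [in RHS]vsprojK //.
  rewrite (nev_nmk eM) -(nev_e eM) !mulrA => <-.
  by rewrite ((nabP _).1 (subvsP _)) ?eqxx.
pose h := linfun (fun x : Nabla e n => nev (vsval x) c).
have lh : linear (fun x : Nabla e n => nev (vsval x) c).
  by move=> k x y; rewrite linearP nev_linearl.
have [F [hF HF]] := hom_Imod eM j h.
have FE x a : nev (F x) a = nev (vsval x) (c * a).
  rewrite HF /h linfunE // -actM [vsval _]/= (nev_act eM).
  by rewrite mulrA cj.
have FN x : F x \in nabla_sub e j.
  by apply/nabP => a Ja; rewrite FE (nabP _).1 ?subvsP // Hc idl_mull.
exists (linfun (vsproj (nabla_sub e j)) \o F)%VF; split.
  move=> a x; apply: val_inj; rewrite !comp_lfunE !lfunE /=.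
  by rewrite !vsprojK // hF.
(* A preimage of y is a functional g killing J(n) with g(c a) = y(a). By [Hc] this is well defined
   modulo J(n), and the inverse of L extends it to A. *)
apply: eq_fullv => y; pose L := (qproj (idn e n) \o amull c)%VF.
have LE a : L a = qproj (idn e n) (c * a) by rewrite comp_lfunE [amull c a]lfunE.
pose g := (nevf (vsval y) \o L^-1 \o qproj (idn e n))%VF.
have gq x : g x = nevf (vsval y) (L^-1 (qproj (idn e n) x))%VF.
  by rewrite /g comp_lfunE comp_lfunE.
have gE a : g (c * a) = nev (vsval y) a.
  rewrite gq -LE.
  apply/eqP; rewrite -nevfE // -subr_eq0 -linearB /= nevfE -(nev_e eM).
  apply/eqP; apply: ((nabP _).1 (subvsP y)); apply/Hc.
  rewrite -qproj_eq0 -LE linearB /=.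
  by rewrite limg_lfunVK ?memv_img ?memvf // subrr.
have g0 a : a \in idn e n -> g a = 0.
  by rewrite -qproj_eq0 gq => /eqP->; rewrite !linear0.
have gN : nmk e n g \in nabla_sub e n.
  by apply/nabP => a Ja; rewrite (nev_nmk eM) g0 // idl_mull.
apply/memv_imgP; exists (vsproj (nabla_sub e n) (nmk e n g)); rewrite ?memvf //.
apply: val_inj; rewrite comp_lfunE lfunE /= vsprojK //.
apply: (nev_inj eM) => a; rewrite FE vsprojK // (nev_nmk eM).
by rewrite mulrA nc gE.
Qed.

Section Internal.
Variable M : lmodule A.
Implicit Types U W : {vspace M}.

(* Chains of subspaces from U down to W (resp. 0) with factors Delta(l) (resp.
   Nabla(l)).  Delta(l) is the cyclic module with annihilator
   {a | a e_l \in J(l)}; Nabla(l) consists of the functionals on e_l A that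
   vanish on J(l), and x |-> (a |-> h (e_l a x)) is the map onto it. *)
Fixpoint dfil W U (s : seq V) : Prop :=
  if s is l :: s' then
    exists U' m, [/\ stable U', act (e l) m = m, U = (cyc m + U')%VS,
      forall a, act a m \in U' <-> a * e l \in idn e l & dfil W U' s']
  else U = W.

Fixpoint nfil U (s : seq V) : Prop :=
  if s is l :: s' then
    exists U' (h : 'Hom(M, K^o)), [/\ stable U' /\ (U' <= U)%VS,
      forall x, x \in U ->
        (x \in U' <-> forall a, h (act (e l) (act a x)) = 0),
      forall x a, x \in U -> a \in idn e l -> h (act (e l) (act a x)) = 0,
      forall f : 'Hom(A, K^o), (forall a, a \in idn e l -> f a = 0) ->
        exists x, x \in U /\ forall a, h (act (e l) (act a x)) = f (e l * a)
      & nfil U' s']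
  else U = 0%VS.

End Internal.

Lemma stable_img (N M : lmodule A) (f : 'Hom(N, M)) (U : {vspace N}) :
  modhom f -> stable U -> stable (f @: U)%VS.
Proof.
by move=> hf sU a _ /memv_imgP[u Uu ->]; rewrite -hf memv_img ?sU.
Qed.

Lemma injective_img (N M : lmodule A) (f : 'Hom(N, M)) (U : {vspace N}) x :
  injective f -> (f x \in (f @: U)%VS) = (x \in U).
Proof.
by move=> fI; apply/memv_imgP/idP => [[u Uu /fI->]//|Ux]; exists x.
Qed.

(** Stated for an injection of N into a fixed M, so that in the induction the nested types
    [submod U] become subspaces of the same module. *)
Lemma filtered_dfil (N M : lmodule A) (f : 'Hom(N, M)) s :
  modhom f -> injective f -> filtered (Delta e) N s -> dfil 0 (limg f) s.
Proof.
elim: s N f => [|l s IH] N f hf fI /=.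
  by move/eqP; rewrite dimv_eq0 => /eqP->; rewrite limg0.
case=> U [/(isom_Delta eM e_sum e_neq0 JP)[g [gE cg Hg]] fU].
pose m := act (e l) (vsval g).
have qm : qproj U m = g by rewrite qproj_hom qproj_val gE.
exists (f @: U)%VS, (f m); split.
- exact: stable_img (@subm_stable _ _ N U).
- by rewrite -hf /m (act_ee eM).
- apply/eqP; rewrite eqEsubv; apply/andP; split; last first.
    rewrite subv_add limgS ?subvf // andbT; apply: cyc_sub.
      exact: stable_img (@stable_full _ _ N).
    by rewrite memv_img ?memvf.
  apply/subvP => _ /memv_imgP[x _ ->].
  have /cycP[a xE] : qproj U x \in cyc g by rewrite cg memvf.
  have -> : x = act a m + (x - act a m) by rewrite addrC subrK.
  rewrite linearD; apply: memv_add; first by rewrite /= hf mem_cyc.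
  rewrite memv_img // -qproj_eq0 linearB /= xE (qproj_hom U a m) qm.
  by rewrite subrr.
- move=> a; rewrite -hf injective_img // -Hg -qproj_eq0 (qproj_hom U a m) qm.
  by split=> /eqP.
pose v : 'Hom(submod U, N) := linfun (@vsval _ _ U).
have <- : limg (f \o v) = (f @: U)%VS.
  rewrite limg_comp; congr (_ @: _)%VS; apply/vspaceP => x.
  apply/memv_imgP/idP => [[y _ ->]|Ux]; first by rewrite lfunE subvsP.
  by exists (vsproj U x); rewrite ?memvf // lfunE /= vsprojK.
apply: IH fU => [a x|x y]; first by rewrite !comp_lfunE vsval_hom hf.
by rewrite !comp_lfunE !lfunE => /fI /= /val_inj.
Qed.

Lemma dfil_filtered (N M : lmodule A) (f : 'Hom(N, M)) s :
  modhom f -> injective f -> dfil 0 (limg f) s -> filtered (Delta e) N s.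
Proof.
elim: s N f => [|l s IH] N f hf fI /=.
  move=> f0; apply/eqP; rewrite dimv_eq0 -subv0; apply/subvP => x _.
  rewrite memv0; apply/eqP/fI; rewrite linear0; apply/eqP; rewrite -memv0 -f0.
  by rewrite memv_img ?memvf.
case=> U' [m [sU' mE UE Hm FU']].
have sU : stable (f @^-1: U')%VS.
  by move=> a u; rewrite -!memv_preim hf => /sU'.
pose U := Submodule sU.
have /memv_imgP[m0 _ mf] : m \in limg f.
  by rewrite UE (subvP (addvSl _ _)) ?mem_cyc1.
have m0E : act (e l) m0 = m0 by apply: fI; rewrite hf -mf mE.
exists U; split.
  apply/(isom_Delta eM e_sum e_neq0 JP); exists (qproj U m0); split.
  - by rewrite -qproj_hom m0E.
  - apply: eq_fullv => x; rewrite -[x]qproj_val.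
    have : f (vsval x) \in limg f by rewrite memv_img ?memvf.
    rewrite UE => /memv_addP[_ /cycP[a ->] [u U'u E]].
    apply/cycP; exists a; rewrite -qproj_hom; apply: qproj_eq.
    by rewrite /= -memv_preim linearB /= E hf -mf addrC addKr.
  move=> a; rewrite -qproj_hom -Hm mf -hf; split.
    by move/eqP; rewrite qproj_eq0 /= -memv_preim.
  by move=> H; apply/eqP; rewrite qproj_eq0 /= -memv_preim.
pose v : 'Hom(submod U, N) := linfun (@vsval _ _ U).
have E : limg (f \o v) = U'.
  apply/vspaceP => y; apply/memv_imgP/idP => [[x _ ->]|Uy].
    by rewrite comp_lfunE lfunE memv_preim (subvsP x).
  have /memv_imgP[x _ xE] : y \in limg f by rewrite UE (subvP (addvSr _ _)).
  have Ux : x \in U by rewrite /= -memv_preim -xE.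
  by exists (vsproj U x); rewrite ?memvf // comp_lfunE lfunE /= vsprojK.
apply: (IH (submod U) (f \o v)%VF); last by rewrite E.
  by move=> a x; rewrite !comp_lfunE vsval_hom hf.
by move=> x y; rewrite !comp_lfunE !lfunE => /fI /= /val_inj.
Qed.

Lemma filtered_nfil (N M : lmodule A) (f : 'Hom(N, M)) s :
  modhom f -> injective f -> filtered (Nabla e) N s -> nfil (limg f) s.
Proof.
elim: s N f => [|l s IH] N f hf fI /=.
  by move/eqP; rewrite dimv_eq0 => /eqP->; rewrite limg0.
case=> U [[F [hF bF]] fU].
pose h0 (x : N) : K^o := nev (i := l) (vsval (F (qproj U x))) 1.
have lh0 : linear h0 by move=> k x y; rewrite /h0 !linearP nev_linearl.
pose h := (linfun h0 \o f^-1)%VF.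
have f0 : lker f == 0%VS by apply/lker0P.
have hE a x : h (act (e l) (act a (f x))) = nev (vsval (F (qproj U x))) a.
  rewrite -!hf comp_lfunE lker0_lfunK // linfunE // /h0 -actM qproj_hom hF.
  by rewrite [vsval _]/= (nev_act eM) mul1r (nev_e eM).
exists (f @: U)%VS, h; split.
- split; last by rewrite limgS ?subvf.
  exact: stable_img (@subm_stable _ _ N U).
- move=> _ /memv_imgP[x _ ->]; rewrite injective_img // -qproj_eq0.
  split=> [/eqP E a|H]; first by rewrite hE E !linear0 /nev zero_lfunE.
  apply/eqP/(bij_inj bF); rewrite linear0; apply: val_inj.
  by apply: (nev_inj eM) => a; rewrite -hE H /nev zero_lfunE.
- move=> _ a /memv_imgP[x _ ->] Ja; rewrite hE.
  exact: ((nabP _).1 (subvsP _)).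
- move=> g g0; have gN : nmk e l g \in nabla_sub e l.
    by apply/nabP => a Ja; rewrite (nev_nmk eM) g0 // idl_mull.
  have [G FK GK] := bF.
  exists (f (vsval (G (vsproj (nabla_sub e l) (nmk e l g))))).
  split; first by rewrite memv_img ?memvf.
  by move=> a; rewrite hE qproj_val GK vsprojK // (nev_nmk eM).
pose v : 'Hom(submod U, N) := linfun (@vsval _ _ U).
have <- : limg (f \o v) = (f @: U)%VS.
  rewrite limg_comp; congr (_ @: _)%VS; apply/vspaceP => x.
  apply/memv_imgP/idP => [[y _ ->]|Ux]; first by rewrite lfunE subvsP.
  by exists (vsproj U x); rewrite ?memvf // lfunE /= vsprojK.
apply: IH fU => [a x|x y]; first by rewrite !comp_lfunE vsval_hom hf.
by rewrite !comp_lfunE !lfunE => /fI /= /val_inj.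
Qed.

End Filtrations.

(** * Dimensions along Delta-filtrations *)

(** Moebius inversion, by induction on the number of elements strictly above k. *)
Lemma sum_up_inj (d : Order.disp_t) (V : finPOrderType d) (f g : V -> nat) :
  (forall k, \sum_(l | (k <= l)%O) f l = \sum_(l | (k <= l)%O) g l)%N ->
  f =1 g.
Proof.
move=> H k; move: {2}(#|[pred l | (k < l)%O]|) (leqnn #|[pred l | (k < l)%O]|) => n.
elim: n k => [|n IH] k kn.
  have k0 l : (k < l)%O = false.
    by have /card0_eq/(_ l) : #|[pred l | (k < l)%O]| = 0%N by apply/eqP; rewrite -leqn0.
  have kE (l : V) : (k <= l)%O = (l == k) by rewrite le_eqVlt k0 orbF eq_sym.
  have := H k; rewrite !(eq_bigl _ _ kE) !big_pred1_eq //.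
have Hlt l : (k < l)%O -> f l = g l.
  move=> kl; apply: IH; rewrite -ltnS; apply: leq_trans kn.
  apply/proper_card/properP; split.
    by apply/subsetP => t; rewrite !inE; apply: lt_trans.
  by exists l; rewrite !inE ?ltxx.
have := H k; rewrite !(bigD1 (P := fun l => (k <= l)%O) k) ?lexx //=.
have -> : (\sum_(l | (k <= l)%O && (l != k)) f l =
           \sum_(l | (k <= l)%O && (l != k)) g l)%N.
  by apply: eq_bigr => l /andP[kl lk]; apply: Hlt; rewrite lt_def lk.
by move/addIn.
Qed.

Lemma count_sum (V : finType) (P : pred V) (s : seq V) :
  count P s = (\sum_(l | P l) count_mem l s)%N.
Proof.
elim: s => [|x s IH] /=; first by rewrite big1.
rewrite IH big_split /=; congr (_ + _)%N.
have [Px|Px] := boolP (P x).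
  rewrite (bigD1 x) //= eqxx big1 ?addn0 // => i /andP[_ ix].
  by rewrite eq_sym (negPf ix).
rewrite big1 // => i Pi; case: eqP => // xi.
by rewrite xi Pi in Px.
Qed.

Lemma count_up_inj (d : Order.disp_t) (V : finPOrderType d) (s s' : seq V) :
  (forall k, count (fun l => (k <= l)%O) s = count (fun l => (k <= l)%O) s') ->
  forall k, count_mem k s = count_mem k s'.
Proof.
move=> H; apply: sum_up_inj => k.
by have := H k; rewrite !count_sum.
Qed.

Section Dimensions.
Context {K : fieldType} {A : falgType K} {d : Order.disp_t}.
Context {V : finPOrderType d} (e : V -> A).
Implicit Types X Y : pred V.
Hypothesis eM : forall i j, e i * e j = if i == j then e i else 0.
Hypothesis e_sum : \sum_i e i = 1.

(* [Delta(t) : S(k)] = 1 for k <= t; c generates e_k Delta(t). *)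
Definition std_line := forall k t, (k <= t)%O ->
  exists c, [/\ e k * c = c, c * e t = c, c \notin idn e t
    & forall a, exists r : K, e k * a * e t - r *: c \in idn e t].

Definition proj_filt := forall j, exists s,
  dfil e (M := regmod) 0 (lideal (e j)) s /\
  forall t, count_mem t s = (j <= t)%O.

Hypothesis SL : std_line.

Lemma dfil_stable (M : lmodule A) (W U : {vspace M}) s :
  stable W -> dfil e W U s -> stable U.
Proof.
move=> sW; case: s => [->//|l s /= [U' [m [sU' _ -> _ _]]]].
by apply: stableD sU'; apply: stable_cyc.
Qed.

(** Modulo W, m generates a quotient of Delta(l), whose e_k-part is spanned by c m with c from
    [std_line] if k <= l, and is zero otherwise. *)
Lemma ecmp_cyc_le (M : lmodule A) (W : {vspace M}) l m k : stable W ->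
  act (e l) m = m -> (forall a, a * e l \in idn e l -> act a m \in W) ->
  (\dim (ecmp e k (cyc m + W)) <= \dim (ecmp e k W) + (k <= l)%O)%N.
Proof.
move=> sW mE H; have sC : stable (cyc m + W)%VS.
  by apply: stableD sW; apply: stable_cyc.
have [kl|kl] := boolP (k <= l)%O; last first.
  rewrite addn0 dimvS //; apply/subvP => x /(ecmpP eM k x sC)[].
  case/memv_addP => _ /cycP[a ->] [w Ww ->] <-.
  rewrite linearD memvD //=; last by rewrite mem_ecmp.
  rewrite -(act_ee eM) mem_ecmp // -actM H //.
  by do 2!apply: idl_mulr; apply: mem_idl.
have [c [kc cl cJ Hc]] := SL kl.
apply: leq_trans (_ : \dim (<[act c m]> + ecmp e k W) <= _)%N.
  apply: dimvS; apply/subvP => x /(ecmpP eM k x sC)[].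
  case/memv_addP => _ /cycP[a ->] [w Ww ->] <-.
  have [r Hr] := Hc a.
  have E : act (e k) (act a m) = r *: act c m + act (e k * a * e l - r *: c) m.
    by rewrite actBl actZl addrC subrK actM mE actM.
  rewrite linearD /= E -addrA memv_add ?memvZ ?memv_line //.
  apply/(ecmpP eM k _ sW); split.
    apply: memvD; last exact: sW.
    by apply: H; rewrite mulrBl -[_ * e l * e l]mulrA (eMM eM) -scalerAl cl.
  by rewrite linearD /= (act_ee eM) -actM mulrBr -scalerAr kc !mulrA (eMM eM).
rewrite addnC; apply: leq_trans (dimv_add_leqif _ _) _.
by rewrite leq_add2r dim_vline leq_b1.
Qed.

Lemma dfil_dim (M : lmodule A) (U : {vspace M}) s k : dfil e 0 U s ->
  \dim (ecmp e k U) = count (fun t => (k <= t)%O) s.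
Proof.
elim: s U => [|l s IH] U /=; first by move->; rewrite /ecmp limg0 dimv0.
case=> U' [m [sU' mE -> Hm FU']]; rewrite -(IH _ FU').
apply/eqP; rewrite eqn_leq [(_ + \dim _)%N]addnC ecmp_cyc_le //=; last by move=> a /Hm.
have [kl|kl] := boolP (k <= l)%O; last by rewrite addn0 dimvS // ecmpS // addvSr.
have [c [kc cl cJ Hc]] := SL kl; rewrite addn1 ltn_neqAle dimvS ?ecmpS ?addvSr // andbT.
apply: contra cJ => /eqP dE.
have /eqP E : ecmp e k U' == ecmp e k (cyc m + U')%VS by rewrite eqEdim ecmpS ?addvSr //= dE.
have : act c m \in ecmp e k (cyc m + U')%VS.
  by rewrite -kc actM mem_ecmp // (subvP (addvSl _ _)) ?mem_cyc.
by rewrite -E => /(ecmpP eM k _ sU')[/Hm]; rewrite cl.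
Qed.

(** A factor Delta(t) with X t is generated by a vector at t, which lies in Z; it disappears from (U
    + Z)/Z. *)
Lemma dfil_add_le (M : lmodule A) (U Z : {vspace M}) X s k : dfil e 0 U s ->
  stable Z -> (forall j x, X j -> x \in U -> act (e j) x \in Z) ->
  (\dim (ecmp e k (U + Z)) <=
   \dim (ecmp e k Z) + count (fun t => ~~ X t && (k <= t)%O) s)%N.
Proof.
move=> FU sZ; elim: s U FU => [|l s IH] U /=.
  by move=> -> _; rewrite add0v addn0.
case=> U' [m [sU' mE -> Hm FU']] HZ; rewrite -addvA.
have {}IH := IH _ FU' (fun j x Xj Ux => HZ j x Xj (subvP (addvSr _ _) _ Ux)).
have [Xl|Xl] /= := boolP (X l).
  suff -> : (cyc m + (U' + Z) = U' + Z)%VS by [].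
  apply/addv_idPr; apply: subv_trans (addvSr _ _).
  apply: cyc_sub => //; rewrite -mE HZ //.
  by rewrite (subvP (addvSl _ _)) ?mem_cyc1.
rewrite addnCA addnC.
apply: leq_trans (ecmp_cyc_le k (stableD sU' sZ) mE _) _.
  by move=> a /Hm Ha; rewrite (subvP (addvSl _ _)).
by rewrite leq_add2r.
Qed.

Lemma stable_idl (M : lmodule A) X (U : {vspace M}) : stable (mulv (idl e X) U).
Proof. by apply: stable_mulv => b x; apply: idl_mull. Qed.

Lemma mulv_idl_reg X (U : {vspace A}) x :
  x \in mulv (M := regmod) (idl e X) U -> x \in idl e X.
Proof.
move: x; apply: mulv_ind => [|k x y Hx Hy|b u Jb _].
- exact: mem0v.
- by rewrite memvD ?memvZ.
- exact: idl_mulr.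
Qed.

Hypothesis PF : proj_filt.

(* Counting dimensions along a Delta-filtration of P(l), in which only Delta(l)
   and Delta(t), t > l, occur, shows that the kernel of P(l) -> Delta(l) is
   generated by the e_t with t > l. *)
Lemma idn_gt l a : a * e l \in idn e l -> a * e l \in idl e (fun k => (l < k)%O).
Proof.
have [s [Fs sE]] := PF l.
pose P : {vspace regmod} := lideal (e l).
have sP : stable P by apply: (@subm_stable _ _ regmod).
pose Z : {vspace regmod} := mulv (idl e (fun k => (l < k)%O)) P.
pose Y : {vspace regmod} := mulv (idn e l) P.
have sZ : stable Z by apply: stable_idl.
have sY : stable Y by apply: stable_idl.
have ZP : (Z <= P)%VS by apply: mulv_sub => b x _; apply: sP.
have YP : (Y <= P)%VS by apply: mulv_sub => b x _; apply: sP.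
have ZY : (Z <= Y)%VS.
  apply: mulv_sub => b x Zb Px; apply: mem_mulv => //.
  apply: subvP Zb; apply: idlS => // k; rewrite lt_def => /andP[kl lk].
  by apply: contra kl => kl'; rewrite eq_le kl' lk.
have PE x : x \in P -> x * e l = x by rewrite (lidealP eM) => /eqP.
have Pe : e l \in P by rewrite (lidealP eM) (eMM eM).
suff EZ : Z = Y.
  move=> Ja; have : a * e l \in Z.
    rewrite EZ -[a * e l](PE _ (mem_lideal eM _ _)).
    exact: (@mem_mulv _ _ regmod).
  exact: mulv_idl_reg.
apply: (stable_eq eM e_sum ZY sY _ sZ) => k.
have sl : count (fun t => ~~ (l < t)%O && (k <= t)%O) s = (k <= l)%O.
  rewrite count_sum; have [kl|kl] := boolP (k <= l)%O.
    rewrite (bigD1 l) ?ltxx //= sE lexx big1 // => t /andP[/andP[lt _] tl].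
    by rewrite sE le_eqVlt (negPf lt) orbF eq_sym (negPf tl).
  rewrite big1 // => t /andP[lt kt]; rewrite sE le_eqVlt (negPf lt) orbF.
  by case: eqP => // E; rewrite E kt in kl.
have H1 : (\dim (ecmp e k P) <= \dim (ecmp e k Z) + (k <= l)%O)%N.
  have := @dfil_add_le regmod P Z (fun k => (l < k)%O) s k Fs sZ.
  rewrite (addv_idPl ZP) sl; apply.
  move=> j x lj Px; apply: (@mem_mulv _ _ regmod) => //; exact: mem_idl.
suff H2 : (\dim (ecmp e k Y) + (k <= l)%O <= \dim (ecmp e k P))%N by lia.
have [kl|kl] := boolP (k <= l)%O; last by rewrite addn0 dimvS // ecmpS.
have [c [kc cl cJ Hc]] := SL kl; rewrite addn1 ltn_neqAle dimvS ?ecmpS // andbT.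
apply: contra cJ => /eqP dE.
have /eqP E : ecmp e k Y == ecmp e k P by rewrite eqEdim ecmpS //= dE.
have : c \in ecmp e k P.
  apply/(ecmpP eM k _ sP); split=> //.
  by rewrite -cl; apply: mem_lideal.
by rewrite -E => /(ecmpP eM k _ sY)[/mulv_idl_reg].
Qed.

Definition up_closed X := forall k l, X k -> (k <= l)%O -> X l.

Lemma up_closed_nle i : up_closed (fun j => ~~ (j <= i)%O).
Proof. by move=> k l ki kl; apply: contra ki; apply: le_trans. Qed.

(** * Traces of the projectives indexed by an up-closed set *)

Section UpClosed.
Variable X : pred V.
Hypothesis Xup : up_closed X.
Variables (M : lmodule A) (U' : {vspace M}) (l : V) (m : M).
Hypothesis sU' : stable U'.
Hypothesis mE : act (e l) m = m.
Hypothesis Hm : forall a, act a m \in U' <-> a * e l \in idn e l.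

Let nle_m j a : ~~ (j <= l)%O -> act (e j) (act a m) \in U'.
Proof.
move=> jl; rewrite -actM; apply/Hm.
by apply: idl_mulr; rewrite -[e j]mul1r; apply: mem_idl_mul.
Qed.

(** As X is up-closed and misses l, no k in X is <= l; the e_k with k in X then annihilate
    Delta(l). *)
Lemma trace_notin : ~~ X l ->
  mulv (idl e X) (cyc m + U')%VS = mulv (idl e X) U'.
Proof.
move=> Xl; apply/eqP; rewrite eqEsubv; apply/andP; split; last first.
  by apply: mulvS; apply: addvSr.
apply: mulv_sub => a _ Ja /memv_addP[_ /cycP[b ->] [u Uu ->]].
rewrite linearD memvD //=; last by rewrite mem_mulv.
rewrite -actM; apply: act_idl_sub (idl_mulr _ Ja); first exact: stable_idl.
move=> k c Xk; rewrite -[act (e k) _](act_ee eM) mem_mulv ?mem_idl //.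
by apply: nle_m; apply: contra Xl; apply: Xup.
Qed.

(** By [idn_gt] the relations of Delta(l) are generated by the e_k with k > l. These k lie in X, and
    e_k A m lies in U'. *)
Lemma trace_in a : a * e l \in idn e l -> X l ->
  act a m \in mulv (idl e X) U'.
Proof.
move=> /idn_gt Ja Xl; rewrite -mE -actM.
apply: act_idl_sub Ja; first exact: stable_idl.
move=> k c lk; rewrite -[act (e k) _](act_ee eM) mem_mulv ?mem_idl //.
  exact: Xup Xl (ltW lk).
by apply: nle_m; rewrite lt_geF.
Qed.

Lemma trace_sub : (mulv (idl e X) (cyc m + U') <= cyc m + mulv (idl e X) U')%VS.
Proof.
apply: mulv_sub => a _ Ja /memv_addP[_ /cycP[b ->] [u Uu ->]].
by rewrite linearD /= -actM memv_add ?mem_cyc ?mem_mulv.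
Qed.

End UpClosed.

(** Upper bounds are proved both for the trace and for the quotient of U by it. They add up to dim
    e_k U, so both are equalities. *)
Lemma dim_trace (M : lmodule A) (U : {vspace M}) X s k : up_closed X ->
  dfil e 0 U s ->
  \dim (ecmp e k (mulv (idl e X) U)) = count (fun t => X t && (k <= t)%O) s.
Proof.
move=> Xup FU; have sU : stable U by apply: dfil_stable FU; apply: stable0.
have H1 : (\dim (ecmp e k (mulv (idl e X) U)) <=
           count (fun t => X t && (k <= t)%O) s)%N.
  elim: s U FU {sU} => [|l s IH] U /=.
    move=> ->; suff -> : mulv (idl e X) 0%VS = 0%VS :> {vspace M}.
      by rewrite /ecmp limg0 dimv0.
    apply/eqP; rewrite -subv0; apply: mulv_sub => a u _; rewrite !memv0 => /eqP->.
    by rewrite linear0.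
  case=> U' [m [sU' mE -> Hm FU']].
  have [Xl|Xl] /= := boolP (X l); last by rewrite (trace_notin Xup Hm) //; apply: IH.
  apply: leq_trans (dimvS (ecmpS e k (trace_sub X U' m))) _.
  apply: leq_trans (ecmp_cyc_le k (@stable_idl _ X U') mE _) _.
    by move=> a Ja; apply: (trace_in Xup mE Hm).
  by rewrite addnC leq_add2l IH.
have H2 := @dfil_add_le M U (mulv (idl e X) U) X s k FU (@stable_idl _ X U).
have {H2} : (\dim (ecmp e k U) <= \dim (ecmp e k (mulv (idl e X) U)) +
    count (fun t => ~~ X t && (k <= t)%O) s)%N.
  apply: leq_trans (dimvS (ecmpS _ _ (addvSl _ _))) (H2 _).
  by move=> j x Xj Ux; rewrite mem_mulv ?mem_idl.
rewrite (dfil_dim k FU) -size_filter -(count_predC X) !count_filter => H2.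
by apply/eqP; rewrite eqn_leq H1; move: H2; rewrite leq_add2r.
Qed.

(** Modulo Z the factors indexed by X are lost; the bound on the intersection of Z and U ensures
    that the other factors survive intact. *)
Lemma dfil_quot (M : lmodule A) (U Z : {vspace M}) X s : up_closed X ->
  stable Z -> (forall j x, X j -> x \in U -> act (e j) x \in Z) ->
  (Z :&: U <= mulv (idl e X) U)%VS ->
  dfil e 0 U s -> dfil e Z (U + Z)%VS [seq t <- s | ~~ X t].
Proof.
move=> Xup sZ; elim: s U => [|l s IH] U HX HZ /=.
  by move=> ->; rewrite add0v.
case=> U' [m [sU' mE UE Hm FU']].
have HX' j x : X j -> x \in U' -> act (e j) x \in Z.
  by move=> Xj U'x; apply: HX => //; rewrite UE (subvP (addvSr _ _)).
have ZU' : (Z :&: U' <= mulv (idl e X) U')%VS.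
  apply/subvP => x; rewrite memv_cap => /andP[Zx U'x].
  have /(subvP HZ) : x \in (Z :&: U)%VS.
    by rewrite memv_cap Zx UE (subvP (addvSr _ _)).
  rewrite UE; have [Xl|Xl] := boolP (X l); last by rewrite (trace_notin Xup Hm).
  move/(subvP (trace_sub X U' m))/memv_addP => [_ /cycP[a ->] [u Ju xE]].
  have Uu : u \in U' by apply: subvP Ju; apply: mulv_sub => b y _; apply: sU'.
  rewrite xE memvD // (trace_in Xup mE Hm) //; apply/Hm.
  by rewrite -[act a m](addrK u) -xE memvB.
have {}IH := IH U' HX' ZU' FU'.
have [Xl|Xl] /= := boolP (X l).
  suff -> : (U + Z = U' + Z)%VS by [].
  rewrite UE -addvA; apply/addv_idPr; apply: subv_trans (addvSr _ _).
  apply: cyc_sub => //; rewrite -mE HX //.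
  by rewrite UE (subvP (addvSl _ _)) ?mem_cyc1.
exists (U' + Z)%VS, m; split=> //; first exact: stableD.
  by rewrite UE addvA.
move=> a; rewrite -Hm; split=> [/memv_addP[u Uu [z Zz E]]|H]; last first.
  by rewrite (subvP (addvSl _ _)).
rewrite E memvD //; have Uz : z \in U.
  have -> : z = act a m - u by rewrite E addrC addKr.
  rewrite UE memvB // ?(subvP (addvSr _ _) u) // (subvP (addvSl _ _)) //.
  exact: mem_cyc.
have /(subvP HZ) : z \in (Z :&: U)%VS by rewrite memv_cap Zz.
rewrite UE (trace_notin Xup Hm) //.
by apply/subvP/mulv_sub => b y _; apply: sU'.
Qed.

End Dimensions.

(** * The axioms in terms of elements of A *)

Lemma dimv1_line (K : fieldType) (V : vectType K) (U : {vspace V}) :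
  \dim U = 1%N -> exists x, [/\ x \in U, x != 0 & U = <[x]>%VS].
Proof.
move=> d1; have U0 : vpick U != 0 by rewrite vpick0 -dimv_eq0 d1.
exists (vpick U); split; rewrite ?memv_pick //; apply/eqP.
by rewrite eq_sym eqEdim -memvE memv_pick d1 dim_vline U0.
Qed.

Section Characterization.
Context {K : fieldType} {A : falgType K} {d : Order.disp_t}.
Context {V : finPOrderType d} (e : V -> A).

(* soc P(j) = S(v) and top I(j) = S(v), in the form of an injection P(j) -> I(v)
   and of a surjection P(v) -> I(j). *)
Definition cog_proj v := forall j, exists f : 'Hom(A, K^o),
  forall x, x * e j = x -> (forall a, f (e v * a * x) = 0) -> x = 0.

Definition gen_inj v := forall j, exists f : 'Hom(A, K^o),
  forall x, e j * x = x -> (forall a, f (x * a * e v) = 0) -> x = 0.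

(* Maps Delta(j) -> Delta(n) and Nabla(n) -> Nabla(j) come from right and left
   multiplication by an element c of e_j A e_n and e_n A e_j. *)
Definition std_inj n := forall j, exists c, [/\ e j * c = c, c * e n = c
  & forall a, a * c \in idn e n <-> a * e j \in idn e j].

Definition costd_surj n := forall j, exists c, [/\ e n * c = c, c * e j = c
  & forall a, c * a \in idn e n <-> e j * a \in idn e j].

Hypothesis eM : forall i j, e i * e j = if i == j then e i else 0.
Hypothesis e_sum : \sum_i e i = 1.
Hypothesis e_neq0 : forall i, e i != 0.
Variable J : {vspace A}.
Hypothesis JP : is_radical e J.

Let smP := filt_mult_SmodP eM e_sum e_neq0 JP.

Lemma std_line_mult : std_line e <->
  forall k t, (k <= t)%O -> filt_mult (Smod e) (Delta e t) k 1.
Proof.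
split=> [SL k t kt|H k t kt].
  apply/smP; have [c [kc ct cJ Hc]] := SL k t kt.
  have [g [gE cg Hg]] := Delta_gen eM e_sum e_neq0 JP t.
  have cg0 : act c g != 0 by apply: contra cJ => /eqP/Hg; rewrite ct.
  suff -> : ecmp e k {:Delta e t} = <[act c g]>%VS by rewrite dim_vline cg0.
  apply/vspaceP => x; apply/idP/idP => [/(ecmpP eM k x)[|_ <-]|/vlineP[r ->]].
  - exact: stable_full.
  - have /cycP[a ->] : x \in cyc g by rewrite cg memvf.
    have [r Hr] := Hc a; apply/vlineP; exists r; apply/eqP.
    rewrite -subr_eq0 -actZl -actM -actBl; apply/eqP/Hg.
    by rewrite mulrBl -scalerAl ct.
  - by rewrite memvZ // -kc actM mem_ecmp ?memvf.
have /smP/dimv1_line[x [_ x0 xE]] := H k t kt.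
have [g [gE cg Hg]] := Delta_gen eM e_sum e_neq0 JP t.
have /(ecmpP eM k x)[|_ kx] : x \in ecmp e k {:Delta e t}.
- by rewrite xE memv_line.
- exact: stable_full.
have /cycP[b xb] : x \in cyc g by rewrite cg memvf.
exists (e k * b * e t); split.
- by rewrite !mulrA (eMM eM).
- by rewrite -mulrA (eMM eM).
- by apply: contra x0 => /Hg; rewrite actM -xb kx => ->.
move=> a; have : act (e k) (act a g) \in ecmp e k {:Delta e t}.
  by rewrite mem_ecmp ?memvf.
rewrite xE => /vlineP[r E]; exists r.
have -> : e k * a * e t - r *: (e k * b * e t) = (e k * a - r *: (e k * b)) * e t.
  by rewrite mulrBl -scalerAl.
by apply/Hg; rewrite actBl actZl !actM -xb kx E subrr.
Qed.

Let fdP M N s f hf fI := @filtered_dfil _ _ _ _ e eM e_sum e_neq0 J JP M N f s hf fI.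

Lemma Pmod_lideal j : exists f : 'Hom(Pmod e j, regmod),
  [/\ modhom f, injective f & limg f = lideal (e j)].
Proof.
exists (linfun (@vsval _ _ (lideal (e j)))); split.
- exact: vsval_hom.
- by move=> x y; rewrite !lfunE => /val_inj.
apply/vspaceP => x; apply/memv_imgP/idP => [[y _ ->]|Px].
  by rewrite lfunE subvsP.
by exists (vsproj (lideal (e j)) x); rewrite ?memvf // lfunE /= vsprojK.
Qed.

Lemma filtered_full (M : lmodule A) s : filtered (Delta e) M s ->
  dfil e 0 {:M} s.
Proof.
have hid : modhom (\1%VF : 'Hom(M, M)) by move=> a x; rewrite !id_lfunE.
have iid : injective (\1%VF : 'Hom(M, M)) by move=> x y; rewrite !id_lfunE.
by move/(fdP hid iid); rewrite lim1g.
Qed.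

Lemma filtered_full_nabla (M : lmodule A) s : filtered (Nabla e) M s ->
  nfil e {:M} s.
Proof.
have hid : modhom (\1%VF : 'Hom(M, M)) by move=> a x; rewrite !id_lfunE.
have iid : injective (\1%VF : 'Hom(M, M)) by move=> x y; rewrite !id_lfunE.
by move/(filtered_nfil eM e_sum e_neq0 JP hid iid); rewrite lim1g.
Qed.

Lemma filtered_count_uniq (M : lmodule A) s s' k : std_line e ->
  filtered (Delta e) M s -> filtered (Delta e) M s' ->
  count_mem k s = count_mem k s'.
Proof.
move=> SL /filtered_full Fs /filtered_full Fs'; apply: count_up_inj => l.
by rewrite -(dfil_dim eM SL l Fs) (dfil_dim eM SL l Fs').
Qed.

Lemma one_quasi_hereditaryP : one_quasi_hereditary e <->
  exists v1 vn, [/\ forall j, (v1 <= j <= vn)%O, std_line e, proj_filt e,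
    cog_proj v1 /\ gen_inj v1 & std_inj vn /\ costd_surj vn].
Proof.
have dP j : \dim {:Pmod e j} <> 0%N.
  move/eqP; rewrite dimv_eq0 => /eqP E.
  by have := pgen_neq0 eM e_neq0 j; rewrite -memv0 -E memvf.
have dI j : \dim {:Imod e j} <> 0%N.
  move/eqP; rewrite dimv_eq0 => /eqP E.
  have [f fe] := functional_neq0 (e_neq0 j); case/negP: fe.
  rewrite -{1}(eMM eM j) -(nev_nmk eM).
  have -> : nmk e j f = 0 by apply/eqP; rewrite -memv0 -E memvf.
  by rewrite /nev zero_lfunE.
split=> [[QH [v1 [vn [Hm H2 H3 H4]]]]|[v1 [vn [Hm SL PF [CP GI] [SI CS]]]]].
  have SL : std_line e by apply/std_line_mult => k t /H2[].
  exists v1, vn; split=> //.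
  - by move=> j; apply/andP.
  (* The axioms give a possibly different filtration for each multiplicity; [filtered_count_uniq]
     transfers all the values to the single s. *)
  - move=> j; have [_ [s Fs] Hs _] := QH j; exists s; split.
      by have [f [hf fI <-]] := Pmod_lideal j; apply: fdP.
    move=> t; have [jt|jt] := boolP (j <= t)%O.
      have [_ [s' [Fs' E]]] := H2 t j jt.
      by rewrite (filtered_count_uniq t SL Fs Fs') E.
    have [s' [Fs' E]] := Hs t jt.
    by rewrite (filtered_count_uniq t SL Fs Fs') E.
  - split=> j; have [iS iT] := H3 j.
      by apply/(cogenerated_P eM); apply: (soc_isom_cogenerated eM e_sum e_neq0 JP).
    by apply/(generated_I eM); apply: (top_isom_generated eM e_sum e_neq0 JP).
  - split=> j; have [iD sN] := H4 j.
      exact/(injects_Delta eM e_sum e_neq0 JP).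
    exact/(surjects_Nabla eM e_sum e_neq0 JP).
have fP j : exists s, filtered (Delta e) (Pmod e j) s /\
    forall t, count_mem t s = (j <= t)%O.
  have [s [Fs Hs]] := PF j; exists s; split=> //.
  have [f [hf fI fE]] := Pmod_lideal j.
  by apply: (dfil_filtered eM e_sum e_neq0 JP hf fI); rewrite fE.
have/std_line_mult SM := SL.
split.
  move=> i; have [s [Fs Hs]] := fP i; split.
  - exact: SM.
  - by exists s.
  - by move=> j ij; exists s; rewrite Hs (negPf ij).
  - by exists s; rewrite Hs lexx.
exists v1, vn; split.
- by move=> j; apply/andP.
- move=> i j ji; split; first exact: SM.
  by have [s [Fs Hs]] := fP j; exists s; rewrite Hs ji.
- move=> j; split.
    apply: (cogenerated_soc_isom eM e_sum e_neq0 JP (dP j) _).1.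
    exact/(cogenerated_P eM).
  apply: (generated_top eM e_sum e_neq0 JP (dI j) _).1.
  exact/(generated_I eM).
move=> i; split; first exact/(injects_Delta eM e_sum e_neq0 JP).
exact/(surjects_Nabla eM e_sum e_neq0 JP).
Qed.

End Characterization.

(** * The spaces e_k A e_j *)

Lemma dim_succ_line (K : fieldType) (V : vectType K) (U W : {vspace V}) :
  (U <= W)%VS -> \dim W = (\dim U).+1 ->
  exists c, [/\ c \in W, c \notin U
    & forall x, x \in W -> exists r : K, x - r *: c \in U].
Proof.
move=> UW dW; have /subvPn[c Wc Uc] : ~~ (W <= U)%VS.
  by apply/negP => /dimvS; rewrite dW ltnn.
exists c; split=> // x; suff <- : (U + <[c]>)%VS = W.
  case/memv_addP => u Uu [_ /vlineP[r ->] ->]; exists r.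
  by rewrite addrK.
apply/eqP; rewrite eqEdim subv_add UW -memvE Wc dW ltn_neqAle.
rewrite dimvS ?addvSl //= andbT; apply: contra Uc => /eqP E.
have /eqP -> : U == (U + <[c]>)%VS by rewrite eqEdim addvSl /= E.
by rewrite (subvP (addvSr _ _)) ?memv_line.
Qed.

(** The numerical hypothesis bounds the dimension of the intersection of P and Q by dim G = dim
    f(G). Hence f(G) is the whole intersection, and f is injective on F. *)
Lemma injective_cap (K : fieldType) (V : vectType K) (f : 'End(V))
    (F G P Q R : {vspace V}) :
  (forall x, x \in F -> f x = 0 -> x = 0) -> (f @: F <= P)%VS -> (G <= F)%VS ->
  (f @: G <= Q)%VS -> (R <= P + Q)%VS -> (\dim P + \dim Q <= \dim R + \dim G)%N ->
  forall x, x \in F -> f x \in Q -> x \in G.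
Proof.
move=> fI FP GF GQ RPQ dle x Fx Qx.
have kF : (F :&: lker f = 0)%VS.
  apply/eqP; rewrite -subv0; apply/subvP => y.
  by rewrite memv_cap memv_ker memv0 => /andP[Fy /eqP/(fI y Fy)->].
have kG : (G :&: lker f = 0)%VS.
  by apply/eqP; rewrite -subv0 -kF; apply: capvS.
have dG := limg_dim_eq kG.
have GPQ : (f @: G <= P :&: Q)%VS.
  by rewrite subv_cap GQ andbT; apply: subv_trans FP; apply: limgS.
have /eqP E : (f @: G)%VS == (P :&: Q)%VS.
  rewrite eqEdim GPQ dG /=; have := dimv_sum_cap P Q; have := dimvS RPQ; lia.
have : f x \in (f @: G)%VS.
  by rewrite E memv_cap Qx andbT (subvP FP) ?memv_img.
case/memv_imgP => y Gy fxy; have Fy := subvP GF _ Gy.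
suff -> : x = y by [].
apply/eqP; rewrite -subr_eq0; apply/eqP/fI; first by rewrite memvB.
by rewrite linearB /= fxy subrr.
Qed.

Section Corners.
Context {K : fieldType} {A : falgType K} {d : Order.disp_t}.
Context {V : finPOrderType d} (e : V -> A).
Implicit Types X Y : pred V.
Hypothesis eM : forall i j, e i * e j = if i == j then e i else 0.
Hypothesis e_sum : \sum_i e i = 1.
Hypothesis SL : std_line e.
Hypothesis PF : proj_filt e.

(** The space e_k (A e_X A) e_j, written as the e_k-part of a trace in P(j) so that [dim_trace]
    applies. *)
Definition corner k X j : {vspace A} :=
  ecmp e (M := regmod) k (mulv (M := regmod) (idl e X) (lideal (e j))).

Lemma cornerP k X j x :
  x \in corner k X j <-> [/\ e k * x = x, x * e j = x & x \in idl e X].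
Proof.
have sI := @stable_idl _ _ _ _ e regmod X (lideal (e j)).
have EP := ecmpP (M := regmod) eM k x sI.
split=> [/EP[Jx kx]|[kx xj Jx]]; last first.
  apply/EP; split=> //; rewrite -[X in X \in _]xj.
  have Pj : e j \in (lideal (e j) : {vspace A}) by rewrite (lidealP eM) (eMM eM).
  exact: (@mem_mulv _ _ regmod _ _ _ _ Jx Pj).
split=> //; last exact: mulv_idl_reg Jx.
have : x \in (lideal (e j) : {vspace A}).
  apply: subvP Jx; apply: mulv_sub => a u _.
  exact: (@subm_stable _ _ regmod).
by rewrite (lidealP eM) => /eqP.
Qed.

Lemma mem_corner k X j a : a \in idl e X -> e k * a * e j \in corner k X j.
Proof.
move=> Ja; apply/cornerP; split; rewrite ?mulrA ?(eMM eM) //.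
  by rewrite -mulrA (eMM eM).
by rewrite idl_mulr ?idl_mull.
Qed.

Lemma corner_sub k X Y j : (forall t, X t -> Y t) -> (corner k X j <= corner k Y j)%VS.
Proof.
move=> XY; apply/subvP => x /cornerP[kx xj Jx]; apply/cornerP; split=> //.
exact: subvP (idlS eM XY) _ Jx.
Qed.

Lemma idl_full a : a \in idl e predT.
Proof.
rewrite -[a]mulr1 -e_sum mulr_sumr memv_suml // => i _.
by rewrite -[_ * _]mulr1 mem_idl_mul.
Qed.

Lemma mem_cornerT k j a : e k * a * e j \in corner k predT j.
Proof. by rewrite mem_corner ?idl_full. Qed.

Lemma dim_corner k X j : up_closed X ->
  \dim (corner k X j) = #|[pred t | [&& X t, (k <= t)%O & (j <= t)%O]]|.
Proof.
move=> Xup; have [s [Fs sE]] := PF j.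
rewrite (dim_trace eM e_sum SL PF k Xup Fs) count_sum -sum1_card.
rewrite [RHS]big_mkcond [LHS]big_mkcond; apply: eq_bigr => t _.
by rewrite sE !inE /=; case: (X t); case: (k <= t)%O; case: (j <= t)%O.
Qed.

Lemma dim_cornerC k X j : up_closed X ->
  \dim (corner k X j) = \dim (corner j X k).
Proof.
move=> Xup; rewrite !dim_corner //; apply: eq_card => t.
by rewrite !inE; congr (_ && _); rewrite andbC.
Qed.

Lemma up_closedT : up_closed (predT : pred V). Proof. by []. Qed.

Lemma e_notin_idn k : e k \notin idn e k.
Proof.
have [c [kc _ cJ _]] := SL (lexx k).
by apply: contra cJ => Jk; rewrite -kc idl_mulr.
Qed.

(** The right-hand counterpart of [std_line]. The sets counted by e_i A e_j and e_i J(i) e_j differ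
    only in t = i, the one t >= i that is also <= i. *)
Lemma costd_line i j : (j <= i)%O -> exists c,
  [/\ e i * c = c, c * e j = c, c \notin idn e i
    & forall a, exists r : K, e i * a * e j - r *: c \in idn e i].
Proof.
move=> ji; have [||c [/cornerP[ic cj _] cJ Hc]] :=
    @dim_succ_line _ _ (corner i (fun t => ~~ (t <= i)%O) j) (corner i predT j).
- by apply: corner_sub.
- rewrite !dim_corner //; last exact: up_closed_nle.
  rewrite (cardD1 i) !inE lexx ji /= add1n; congr _.+1; apply: eq_card => t.
  rewrite !inE /=; have [it|] := boolP (i <= t)%O; last by rewrite !andbF.
  rewrite (le_trans ji it) andbT andbT; case: eqVneq => [->|ti]; first by rewrite lexx.
  by rewrite /= lt_geF // lt_def ti.
exists c; split=> //.
  by apply: contra cJ => Jc; apply/cornerP.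
move=> a; have [r /cornerP[_ _ Hr]] := Hc _ (mem_cornerT i j a).
by exists r.
Qed.

Variables v1 vn : V.
Hypothesis v1_min : forall j, (v1 <= j)%O.
Hypothesis vn_max : forall j, (j <= vn)%O.

Lemma idn_max x : x \in idn e vn -> x = 0.
Proof.
move: x; apply: idl_ind => [//|k x y -> ->|a j b].
  by rewrite scaler0 addr0.
by rewrite vn_max.
Qed.

Lemma mem_idn_comp i x : (forall k, e k * x \in idn e i) -> x \in idn e i.
Proof.
by move=> H; rewrite -[x]mul1r -e_sum mulr_suml memv_suml // => k _; apply: H.
Qed.

Lemma mem_idn_compr i x : (forall k, x * e k \in idn e i) -> x \in idn e i.
Proof.
by move=> H; rewrite -[x]mulr1 -e_sum mulr_sumr memv_suml // => k _; apply: H.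
Qed.

(** Inside e_1 A e_k the right kernel contains e_1 J(i) e_k. By [dim_pairing] and the symmetry of
    the corners it has no larger dimension. *)
Lemma nondeg_right i (f : 'Hom(A, K^o)) : (forall a, a \in idn e i -> f a = 0) ->
  (forall x, x * e v1 = x -> (forall a, f (e v1 * a * x) = 0) -> x \in idn e i) ->
  forall y, e v1 * y = y -> (forall a, f (y * a * e v1) = 0) -> y \in idn e i.
Proof.
move=> f0 Hl y y1 Hy; apply: mem_idn_compr => k.
pose Yi := (fun t => ~~ (t <= i)%O).
have iup : up_closed Yi := @up_closed_nle _ _ i.
pose X := corner k predT v1; pose X1 := corner k Yi v1.
pose Y := corner v1 predT k; pose Y0 := corner v1 Yi k.
have [||Y1 Y1P] := @vspace_of _ A (fun z => z \in Y /\ forall x, x \in X -> f (z * x) = 0).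
- by split=> [|x _]; rewrite ?mem0v // mul0r linear0.
- move=> r u v [Yu Hu] [Yv Hv]; split=> [|x Xx]; first by rewrite memvD ?memvZ.
  by rewrite mulrDl -scalerAl linearP /= Hu // Hv // scaler0 addr0.
have : (\dim X + \dim Y1 <= \dim Y + \dim X1)%N.
  apply: (@dim_pairing _ A A (fun x w => f (w * x))).
  - by move=> x r u v; rewrite mulrDl -scalerAl linearP.
  - by move=> w r u v; rewrite mulrDr -scalerAr linearP.
  - move=> x /cornerP[kx x1 _] Hx; apply/cornerP; split=> //; apply: Hl => // a.
    rewrite -kx mulrA; apply: Hx; exact: mem_cornerT.
  - by apply/subvP => z /Y1P[].
  - by move=> x z Xx /Y1P[_]; apply.
have YY : (Y0 <= Y1)%VS.
  apply/subvP => z /cornerP[z1 zk Jz]; apply/Y1P; split.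
    by apply/cornerP; split=> //; apply: idl_full.
  by move=> x _; rewrite f0 // idl_mulr.
rewrite /X /Y (dim_cornerC k _ (up_closedT)) leq_add2l => dle.
have /eqP E : Y0 == Y1 by rewrite eqEdim YY /Y0 (dim_cornerC _ _ iup).
suff : y * e k \in Y0 by case/cornerP.
rewrite E; apply/Y1P; split.
  by rewrite -y1; apply: mem_cornerT.
by move=> x /cornerP[kx x1 _]; rewrite -mulrA kx -x1 mulrA.
Qed.

Hypothesis CP : cog_proj e v1.
Hypothesis GI : gen_inj e v1.

Lemma perfect_form : exists f : 'Hom(A, K^o),
  (forall x, x * e v1 = x -> (forall a, f (e v1 * a * x) = 0) -> x = 0) /\
  (forall y, e v1 * y = y -> (forall a, f (y * a * e v1) = 0) -> y = 0).
Proof.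
have [f Hf] := CP v1; exists f; split=> // y y1 Hy.
apply: idn_max; apply: (@nondeg_right vn f _ _ y y1 Hy).
  by move=> a /idn_max->; rewrite linear0.
by move=> x x1 Hx; rewrite (Hf x x1 Hx) mem0v.
Qed.

(** The condition soc P(j) = S(1) embeds P(j) in I(1) through h. Representing h by the perfect form
    replaces I(1) by P(1), and the embedding becomes right multiplication by u. *)
Lemma embed_left j : exists u,
  [/\ e j * u = u, u * e v1 = u & forall a, a * e j = a -> a * u = 0 -> a = 0].
Proof.
have [f [fl fr]] := perfect_form; have [h Hh] := CP j.
pose h' (w : A) : K^o := h (e v1 * w * e j).
have lh' : linear h'.
  by move=> k x y; rewrite /h' mulrDr mulrDl -scalerAr -scalerAl linearP.
have [|||x Hx] := @functional_repr _ A A (fun x w => f (e v1 * w * x * e v1)) _ _ (linfun h').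
- by move=> a k x y; rewrite mulrDr !mulrDl -scalerAr -!scalerAl linearP.
- by move=> a k x y; rewrite mulrDr !mulrDl -scalerAr -!scalerAl linearP.
- move=> w Hw; rewrite linfunE // /h'.
  by rewrite (fr (e v1 * w)) ?mulrA ?(eMM eM) // mul0r linear0.
exists (e j * x * e v1); split; rewrite ?mulrA ?(eMM eM) //.
  by rewrite -mulrA (eMM eM).
move=> a aj au; apply: Hh => // b.
have E1 : e v1 * (b * a) * e j = e v1 * b * a by rewrite -!mulrA aj.
have E2 : e v1 * (b * a) * x * e v1 = e v1 * b * (a * (e j * x * e v1)).
  by rewrite -[in LHS]aj !mulrA.
by have := Hx (b * a); rewrite linfunE // /h' E1 E2 au mulr0 linear0.
Qed.

Lemma embed_right j : exists w,
  [/\ e v1 * w = w, w * e j = w & forall a, e j * a = a -> w * a = 0 -> a = 0].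
Proof.
have [f [fl fr]] := perfect_form; have [h Hh] := GI j.
pose h' (w : A) : K^o := h (e j * w * e v1).
have lh' : linear h'.
  by move=> k x y; rewrite /h' mulrDr mulrDl -scalerAr -scalerAl linearP.
have [|||w Hw] := @functional_repr _ A A (fun w x => f (e v1 * w * x * e v1)) _ _ (linfun h').
- by move=> a k x y; rewrite mulrDr mulrDl -scalerAr -!scalerAl linearP.
- by move=> a k x y; rewrite mulrDr !mulrDl -scalerAr -!scalerAl linearP.
- move=> x Hx; rewrite linfunE // /h' -mulrA.
  rewrite (fl (x * e v1)) ?mulr0 ?linear0 //; first by rewrite -mulrA (eMM eM).
  by move=> a; rewrite mulrA Hx.
exists (e v1 * w * e j); split; rewrite ?mulrA ?(eMM eM) //.
  by rewrite -mulrA (eMM eM).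
move=> a ja wa; apply: Hh => // b.
have E1 : e j * (a * b) * e v1 = a * b * e v1 by rewrite mulrA ja.
have E2 : e v1 * w * (a * b) * e v1 = e v1 * w * e j * a * b * e v1.
  by rewrite -[in LHS]ja !mulrA.
by have := Hw (a * b); rewrite linfunE // /h' E1 E2 wa !mul0r linear0.
Qed.

(** * Images of P(j) in P(1) and of e_j A in e_1 A *)

Section Embeddings.
Variables (j : V) (u w : A).
Hypothesis u1 : u * e v1 = u.
Hypothesis uI : forall a, a * e j = a -> a * u = 0 -> a = 0.
Hypothesis w1 : e v1 * w = w.
Hypothesis wI : forall a, e j * a = a -> w * a = 0 -> a = 0.

(** For k >= j both e_k A e_j and e_k A e_1 have dimension #{t | t >= k}, so the injection between
    them is onto. *)
Lemma embed_left_img k a : (j <= k)%O -> exists b, e k * a * e v1 = e k * b * e j * u.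
Proof.
move=> jk; pose F := corner k predT j.
have kF : (F :&: lker (amulr u) = 0)%VS.
  apply/eqP; rewrite -subv0; apply/subvP => y; rewrite memv_cap memv_ker memv0.
  by rewrite lfunE /= => /andP[/cornerP[_ yj _] /eqP/(uI yj)->].
have /eqP E : (amulr u @: F)%VS == corner k predT v1.
  rewrite eqEdim; apply/andP; split.
    apply/subvP => _ /memv_imgP[y /cornerP[ky yj _] ->]; rewrite lfunE /=.
    by apply/cornerP; rewrite mulrA ky -mulrA u1; split=> //; apply: idl_full.
  rewrite (limg_dim_eq kF) !dim_corner //; apply/subset_leq_card/subsetP => t.
  by rewrite !inE /= => /andP[kt _]; rewrite kt (le_trans jk kt).
have := mem_cornerT k v1 a; rewrite -E => /memv_imgP[y /cornerP[ky yj _] ->].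
by exists y; rewrite lfunE /= -{1}yj -{1}ky.
Qed.

Lemma embed_right_img k a : (j <= k)%O -> exists b, e v1 * a * e k = w * (e j * b * e k).
Proof.
move=> jk; pose F := corner j predT k.
have kF : (F :&: lker (amull w) = 0)%VS.
  apply/eqP; rewrite -subv0; apply/subvP => y; rewrite memv_cap memv_ker memv0.
  by rewrite lfunE /= => /andP[/cornerP[jy _ _] /eqP/(wI jy)->].
have /eqP E : (amull w @: F)%VS == corner v1 predT k.
  rewrite eqEdim; apply/andP; split.
    apply/subvP => _ /memv_imgP[y /cornerP[jy yk _] ->]; rewrite lfunE /=.
    by apply/cornerP; rewrite mulrA w1 -mulrA yk; split=> //; apply: idl_full.
  rewrite (limg_dim_eq kF) !dim_corner //; apply/subset_leq_card/subsetP => t.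
  by rewrite !inE /= => /andP[_ kt]; rewrite kt (le_trans jk kt).
have := mem_cornerT v1 k a; rewrite -E => /memv_imgP[y /cornerP[jy yk _] ->].
by exists y; rewrite lfunE /= -{1}jy -{1}yk mulrA.
Qed.

(** Inclusion-exclusion for {t >= j} and {t not <= i} above k: the numerical hypothesis of
    [injective_cap]. *)
Let cardE i k : (#|[pred t | [&& (j <= t)%O, (k <= t)%O & (v1 <= t)%O]]| +
  #|[pred t | [&& ~~ (t <= i)%O, (k <= t)%O & (v1 <= t)%O]]| <=
  #|[pred t | [&& (j <= t)%O || ~~ (t <= i)%O, (k <= t)%O & (v1 <= t)%O]]| +
  #|[pred t | [&& ~~ (t <= i)%O, (k <= t)%O & (j <= t)%O]]|)%N.
Proof.
rewrite -cardUI leq_add //; apply/subset_leq_card/subsetP => t; rewrite !inE /=.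
  by rewrite v1_min; case: (k <= t)%O; case: (j <= t)%O; case: (t <= i)%O.
by rewrite v1_min; case: (k <= t)%O; case: (j <= t)%O; case: (t <= i)%O.
Qed.

Let jup : up_closed (fun t => (j <= t)%O).
Proof. by move=> k l; apply: le_trans. Qed.

Let Jup i : up_closed (fun t => (j <= t)%O || ~~ (t <= i)%O).
Proof.
move=> k l /orP[jk|ki] kl; apply/orP; [left|right]; first exact: jup kl.
exact: up_closed_nle kl.
Qed.

(* With P = A e_1, the image of P(j) is P^X and J(i) P is P^Y, where P^X is the
   trace of the P(k), k in X, for X = {k >= j} and Y = {k not <= i}.  As P^X + P^Y
   is the trace for the union of X and Y, a dimension count identifies the
   intersection of P^X and P^Y with J(i) P(j). *)
Lemma embed_left_idn i a : a * e j = a -> a * u \in idn e i -> a \in idn e i.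
Proof.
move=> aj Jau; apply: mem_idn_comp => k.
pose Y := fun t => ~~ (t <= i)%O; have Yup : up_closed Y := @up_closed_nle _ _ i.
suff : e k * a \in corner k Y j by case/cornerP.
apply: (@injective_cap _ A (amulr u) (corner k predT j) (corner k Y j)
  (corner k (fun t => (j <= t)%O) v1) (corner k Y v1)
  (corner k (fun t => (j <= t)%O || Y t) v1)).
- by move=> x /cornerP[_ xj _]; rewrite lfunE; apply: uI.
- apply/subvP => _ /memv_imgP[x /cornerP[kx xj _] ->]; rewrite lfunE /=.
  apply/cornerP; rewrite mulrA kx -mulrA u1; split=> //.
  by rewrite -xj mem_idl_mul.
- exact: corner_sub.
- apply/subvP => _ /memv_imgP[x /cornerP[kx xj Jx] ->]; rewrite lfunE /=.
  by apply/cornerP; rewrite mulrA kx -mulrA u1; split=> //; apply: idl_mulr.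
- apply/subvP => x /cornerP[kx x1 Jx]; rewrite -x1 -kx; move: x Jx {kx x1}.
  apply: idl_ind => [|r x y Hx Hy|b t c /orP[jt|ti]].
  + by rewrite mulr0 mul0r mem0v.
  + by rewrite mulrDr mulrDl -scalerAr -scalerAl memvD ?memvZ.
  + by rewrite (subvP (addvSl _ _)) ?mem_corner ?mem_idl_mul.
  + by rewrite (subvP (addvSr _ _)) ?mem_corner ?mem_idl_mul.
- by rewrite (dim_corner _ _ jup) !(dim_corner _ _ Yup) (dim_corner _ _ (@Jup i)); apply: cardE.
- by rewrite -aj mulrA; apply: mem_cornerT.
by rewrite lfunE /=; apply/cornerP; rewrite !mulrA (eMM eM) -!mulrA u1; split=> //; rewrite idl_mull.
Qed.

Lemma embed_right_idn i a : e j * a = a -> w * a \in idn e i -> a \in idn e i.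
Proof.
move=> ja Jwa; apply: mem_idn_compr => k.
pose Y := fun t => ~~ (t <= i)%O; have Yup : up_closed Y := @up_closed_nle _ _ i.
suff : a * e k \in corner j Y k by case/cornerP.
apply: (@injective_cap _ A (amull w) (corner j predT k) (corner j Y k)
  (corner v1 (fun t => (j <= t)%O) k) (corner v1 Y k)
  (corner v1 (fun t => (j <= t)%O || Y t) k)).
- by move=> x /cornerP[jx _ _]; rewrite lfunE; apply: wI.
- apply/subvP => _ /memv_imgP[x /cornerP[jx xk _] ->]; rewrite lfunE /=.
  apply/cornerP; rewrite mulrA w1 -mulrA xk; split=> //.
  by rewrite -jx mulrA mem_idl_mul.
- exact: corner_sub.
- apply/subvP => _ /memv_imgP[x /cornerP[jx xk Jx] ->]; rewrite lfunE /=.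
  by apply/cornerP; rewrite mulrA w1 -mulrA xk; split=> //; apply: idl_mull.
- apply/subvP => x /cornerP[kx x1 Jx]; rewrite -x1 -kx; move: x Jx {kx x1}.
  apply: idl_ind => [|r x y Hx Hy|b t c /orP[jt|ti]].
  + by rewrite mulr0 mul0r mem0v.
  + by rewrite mulrDr mulrDl -scalerAr -scalerAl memvD ?memvZ.
  + by rewrite (subvP (addvSl _ _)) ?mem_corner ?mem_idl_mul.
  + by rewrite (subvP (addvSr _ _)) ?mem_corner ?mem_idl_mul.
- rewrite (dim_cornerC _ _ jup) !(dim_cornerC _ k Yup) (dim_cornerC _ _ (@Jup i)).
  by rewrite (dim_corner _ _ jup) !(dim_corner _ _ Yup) (dim_corner _ _ (@Jup i)); apply: cardE.
- by rewrite -ja; apply: mem_cornerT.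
by rewrite lfunE /=; apply/cornerP; rewrite !mulrA w1 -!mulrA (eMM eM); split=> //; rewrite mulrA idl_mulr.
Qed.

End Embeddings.

Hypothesis SI : std_inj e vn.
Hypothesis CS : costd_surj e vn.

(** Inside Delta(n) the line e_k Delta(n) contains both the image of c and the generator of the copy
    of Delta(k). Both are nonzero, hence proportional, so c generates a copy of Delta(k). *)
Lemma std_inj_le i k : (k <= i)%O -> exists c, [/\ e k * c = c, c * e i = c
  & forall a, a * c \in idn e i <-> a * e k \in idn e k].
Proof.
move=> ki; have [c [kc ci cJ _]] := SL ki.
have [ci' [ici cin Hi]] := SI i; have [ck [kck ckn Hk]] := SI k.
have [c0 [_ _ _ Hc0]] := SL (vn_max k).
have line x : e k * x = x -> x * e vn = x -> exists r : K, x = r *: c0.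
  move=> kx xn; have [r /idn_max/eqP] := Hc0 x; rewrite kx xn subr_eq0 => /eqP->.
  by exists r.
have [||r rE] := line (c * ci'); rewrite ?mulrA ?kc // -?mulrA ?cin //.
have [s sE] := line ck kck ckn.
have r0 : r != 0.
  apply: contra cJ => /eqP r0; rewrite -ci; apply/Hi.
  by rewrite rE r0 scale0r mem0v.
have s0 : s != 0.
  apply: contra (e_notin_idn k) => /eqP s0; rewrite -(eMM eM); apply/Hk.
  by rewrite sE s0 scale0r mulr0 mem0v.
have ckE : ck = (s / r) *: (c * ci') by rewrite rE scalerA mulfVK.
have sr0 : s / r != 0 by rewrite mulf_neq0 ?invr_neq0.
exists c; split=> // a.
have H1 : a * c * ci' \in idn e vn <-> a * c \in idn e i by rewrite Hi -mulrA ci.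
rewrite -H1 -Hk ckE -scalerAr mulrA; split=> [|/(memvZ (s / r)^-1)].
  exact: memvZ.
by rewrite scalerK.
Qed.

Lemma costd_surj_le i k : (k <= i)%O -> exists c, [/\ e i * c = c, c * e k = c
  & forall a, c * a \in idn e i <-> e k * a \in idn e k].
Proof.
move=> ki; have [c [ic ck cJ _]] := costd_line ki.
have [ci' [nci cii Hi]] := CS i; have [ck' [nck ckk Hk]] := CS k.
have [c0 [_ _ _ Hc0]] := costd_line (vn_max k).
have line x : e vn * x = x -> x * e k = x -> exists r : K, x = r *: c0.
  move=> kx xn; have [r /idn_max/eqP] := Hc0 x; rewrite kx xn subr_eq0 => /eqP->.
  by exists r.
have [||r rE] := line (ci' * c); rewrite ?mulrA ?nci // -?mulrA ?ck //.
have [s sE] := line ck' nck ckk.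
have r0 : r != 0.
  apply: contra cJ => /eqP r0; rewrite -ic; apply/Hi.
  by rewrite rE r0 scale0r mem0v.
have s0 : s != 0.
  apply: contra (e_notin_idn k) => /eqP s0; rewrite -(eMM eM); apply/Hk.
  by rewrite sE s0 scale0r mul0r mem0v.
have ckE : ck' = (s / r) *: (ci' * c) by rewrite rE scalerA mulfVK.
have sr0 : s / r != 0 by rewrite mulf_neq0 ?invr_neq0.
exists c; split=> // a.
have H1 : ci' * (c * a) \in idn e vn <-> c * a \in idn e i by rewrite Hi mulrA ic.
rewrite -H1 -Hk ckE -scalerAl -mulrA; split=> [|/(memvZ (s / r)^-1)].
  exact: memvZ.
by rewrite scalerK.
Qed.

(** Delta(t) embeds in Delta(n) = P(n), as J(n) = 0, and every nonzero element of P(n) has a nonzero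
    multiple at v1. *)
Lemma Delta_ess t a : (forall b, e v1 * b * a * e t \in idn e t) -> a * e t \in idn e t.
Proof.
move=> H; have [c [tc cn Hc]] := SI t; apply/Hc.
have [f Hf] := CP vn.
suff -> : a * c = 0 by rewrite mem0v.
apply: Hf => [|b]; first by rewrite -mulrA cn.
have -> : e v1 * b * (a * c) = 0 by apply: idn_max; rewrite mulrA; apply/Hc/H.
by rewrite linear0.
Qed.

(** Nabla(l) is a quotient of Nabla(n) = I(n), which is generated at v1. Here g is the image of that
    generator and f is b g. *)
Lemma nabla_gen l (f : 'Hom(A, K^o)) : (forall a, a \in idn e l -> f a = 0) ->
  exists b (g : 'Hom(A, K^o)), [/\ forall a, a \in idn e l -> g a = 0,
    forall a, g (e l * a * e v1) = g (e l * a)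
    & forall a, f (e l * a) = g (e l * a * b)].
Proof.
move=> f0; have [c [nc cl Hc]] := CS l; have [h Hh] := GI vn.
pose f' (w : A) : K^o := f (e l * w).
have lf' : linear f' by move=> k x y; rewrite /f' mulrDr -scalerAr linearP.
pose g' (w : A) : K^o := h (c * w * e v1).
have lg' : linear g'.
  by move=> k x y; rewrite /g' mulrDr mulrDl -scalerAr -scalerAl linearP.
have [|||b Hb] := @functional_repr _ A A (fun b w => h (c * w * b * e v1)) _ _ (linfun f').
- by move=> a k x y; rewrite mulrDr !mulrDl -scalerAr -!scalerAl linearP.
- by move=> a k x y; rewrite mulrDr mulrDl -scalerAr -!scalerAl linearP.
- move=> w Hw; rewrite linfunE // /f' f0 //; apply/Hc.
  by rewrite (Hh (c * w)) ?mem0v // mulrA nc.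
exists b, (linfun g'); split=> a.
- move=> Ja; rewrite linfunE // /g'.
  have -> : c * a = 0 by apply/idn_max/Hc; apply: idl_mull.
  by rewrite mul0r linear0.
- by rewrite !linfunE // /g' mulrA -!mulrA (eMM eM).
- by rewrite -[LHS]/(f' a) -(linfunE lf') Hb linfunE // /g' !mulrA cl.
Qed.

End Corners.

(** * Modules with both filtrations *)

Section ModuleFiltrations.
Context {K : fieldType} {A : falgType K} {d : Order.disp_t}.
Context {V : finPOrderType d} (e : V -> A).
Implicit Types X Y : pred V.
Hypothesis eM : forall i j, e i * e j = if i == j then e i else 0.
Hypothesis e_sum : \sum_i e i = 1.
Variable J : {vspace A}.
Hypothesis JP : is_radical e J.
Hypothesis SL : std_line e.
Hypothesis PF : proj_filt e.
Variables v1 vn : V.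
Hypothesis v1_min : forall j, (v1 <= j)%O.
Hypothesis vn_max : forall j, (j <= vn)%O.
Hypothesis CP : cog_proj e v1.
Hypothesis GI : gen_inj e v1.
Hypothesis SI : std_inj e vn.
Hypothesis CS : costd_surj e vn.

Variable M : lmodule A.
Implicit Types U W : {vspace M}.

Lemma dfil_ess U s x : dfil e 0 U s -> x \in U ->
  (forall a, act (e v1) (act a x) = 0) -> x = 0.
Proof.
elim: s U x => [|l s IH] U x /=; first by move=> ->; rewrite memv0 => /eqP.
case=> U' [m [sU' mE -> Hm FU']] /memv_addP[_ /cycP[a ->] [u Uu ->]] H.
apply: (IH _ _ FU') => //; rewrite memvD //; apply/Hm.
apply: (Delta_ess vn_max CP SI) => b; apply/Hm.
have -> : act (e v1 * b * a) m = - act (e v1) (act b u).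
  by apply/eqP; rewrite -addr_eq0 !actM -!linearD /= H.
by rewrite memvN (sU' _ _ (sU' _ _ Uu)).
Qed.

Lemma functional_act (h : 'Hom(M, K^o)) l (x : M) :
  exists f : 'Hom(A, K^o), forall a, f a = h (act (e l) (act a x)).
Proof.
exists (linfun (fun a => h (act (e l) (act a x)))) => a; rewrite linfunE //.
by move=> k b c; rewrite actDl actZl !linearP.
Qed.

Lemma nfil_gen U s W : nfil e U s -> stable W ->
  (forall x, x \in U -> act (e v1) x = x -> x \in W) -> stable U -> (U <= W)%VS.
Proof.
move=> FU sW; elim: s U FU => [|l s IH] U /=; first by move=> ->; rewrite sub0v.
case=> U' [h [[sU' UU'] HU' Hk Hs FU']] HW sU.
have {}IH := IH _ FU' (fun x Ux => HW x (subvP UU' _ Ux)) sU'.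
apply/subvP => x Ux; have [f fE] := functional_act h l x.
have f0 a : a \in idn e l -> f a = 0 by rewrite fE; apply: Hk.
have [b [g [g0 g1 fg]]] := nabla_gen eM vn_max GI CS f0.
have [y [Uy yE]] := Hs g g0; pose y1 := act (e v1) y.
have y1E a : h (act (e l) (act a y1)) = g (e l * a).
  by rewrite /y1 -[act a _]actM yE mulrA g1.
have Uy1 : y1 \in U by apply: sU.
rewrite -[x](subrK (act b y1)) memvD //; last first.
  by apply: sW; apply: HW; rewrite // /y1 (act_ee eM).
apply: (subvP IH); apply/HU'; first by rewrite memvB // sU.
move=> a; rewrite !linearB /= -[act a (act b _)]actM y1E mulrA -fg fE.
by rewrite actM (act_ee eM) subrr.
Qed.

(** Nabla(l) contains a functional that is nonzero on c, which spans e_l A e_k modulo J(l); a lift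
    of it to U is not killed by c. *)
Lemma nfil_mem U s l k : nfil e U s -> l \in s -> (k <= l)%O ->
  exists x a, x \in U /\ act (e l * a * e k) x != 0.
Proof.
elim: s U => [|j s IH] U //= [U' [h [[sU' UU'] HU' Hk Hs FU']]].
rewrite inE => /orP[/eqP->|ls] kl; last first.
  have [x [a [Ux ax]]] := IH _ FU' ls kl.
  by exists x, a; split=> //; apply: (subvP UU').
have [c [lc ck cJ _]] := costd_line eM e_sum SL PF kl.
have [f [f0 fc]] := functional_sep cJ; have [y [Uy yE]] := Hs f f0.
exists y, c; split=> //; rewrite lc ck; apply: contra fc => /eqP c0.
by rewrite -lc -yE c0 linear0 linear0.
Qed.

Lemma nfil_dim U s k : nfil e U s -> stable U ->
  \dim (ecmp e k U) = count (fun t => (k <= t)%O) s.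
Proof.
elim: s U => [|l s IH] U /=; first by move=> -> _; rewrite /ecmp limg0 dimv0.
case=> U' [h [[sU' UU'] HU' Hk Hs FU']] sU.
rewrite -(IH _ FU' sU'); have sE := ecmpS e k UU'.
have [kl|kl] := boolP (k <= l)%O; last first.
  congr (\dim _); apply/eqP; rewrite eqEsubv sE andbT.
  apply/subvP => x /(ecmpP eM k x sU)[Ux kx]; apply/(ecmpP eM k x sU').
  split=> //; apply/HU' => // a; rewrite -kx -[act a _]actM Hk //.
  by apply: idl_mull; apply: mem_idl.
have [c [lc ck cJ Hc]] := costd_line eM e_sum SL PF kl.
have [f [f0 fc]] := functional_sep cJ; have [y [Uy yE]] := Hs f f0.
pose x0 := act (e k) y.
have hx0 : h (act c x0) != 0 by rewrite /x0 -actM ck -lc actM yE lc.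
have hE x a : x \in U -> act (e k) x = x ->
    exists r : K, h (act (e l) (act a x)) = r *: h (act c x).
  move=> Ux kx; have [r Hr] := Hc a; exists r.
  have E : act (e l) (act a x) = r *: act c x +
      act (e l) (act (e l * a * e k - r *: c) x).
    rewrite actBl linearB /= actZl linearZ /= -[act (e l) (act c x)]actM lc.
    by rewrite addrC subrK actM kx actM (act_ee eM).
  by rewrite E linearD /= Hk // addr0 linearZ.
have kx0 : act (e k) x0 = x0 by rewrite /x0 (act_ee eM).
have Ux0 : x0 \in U by apply: sU.
have x0U' : x0 \notin U'.
  apply: contra hx0 => /HU'-/(_ Ux0 c); rewrite -actM lc => ->.
  exact: eqxx.
suff -> : ecmp e k U = (<[x0]> + ecmp e k U')%VS.
  rewrite dimv_disjoint_sum ?dim_vline.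
    by case: eqP x0U' => // ->; rewrite mem0v.
  apply/eqP; rewrite -subv0; apply/subvP => z; rewrite memv_cap memv0.
  case/andP => /vlineP[r ->] /(ecmpP eM k _ sU')[U'r _].
  rewrite scaler_eq0; apply/orP; left; apply: contraR x0U' => r0.
  by rewrite -[x0](scalerK r0) memvZ.
apply/eqP; rewrite eqEsubv subv_add sE andbT -memvE; apply/andP; split; last first.
  by apply/(ecmpP eM k _ sU).
apply/subvP => x /(ecmpP eM k x sU)[Ux kx].
(* With this r, h(c y) = 0 for y = x - r x0; by [hE] all h(e_l a y) vanish, so y lies in U'. *)
pose r := (h (act c x) : K) / (h (act c x0) : K).
rewrite -[x](subrK (r *: x0)) addrC memv_add ?memvZ ?memv_line //.
have kxr : act (e k) (x - r *: x0) = x - r *: x0.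
  by rewrite linearB linearZ /= kx kx0.
have Uxr : x - r *: x0 \in U by rewrite memvB ?memvZ.
apply/(ecmpP eM k _ sU'); split=> //; apply/HU' => // a.
have [q ->] := hE _ a Uxr kxr; rewrite linearB linearZ /= linearB linearZ /=.
by rewrite -[r *: h _]/(r * (h (act c x0) : K)) /r mulfVK // subrr scaler0.
Qed.

Lemma count_dfil_nfil s s' : dfil e 0 {:M} s -> nfil e {:M} s' ->
  forall k, count_mem k s = count_mem k s'.
Proof.
move=> Fs Fs'; apply: count_up_inj => k.
by rewrite -(dfil_dim eM SL k Fs) -(nfil_dim k Fs' (@stable_full _ _ M)).
Qed.

Lemma rad_mem k a : k != v1 -> e k * a * e v1 \in J.
Proof.
move=> kv; have [Jl _ _ Jc] := JP; have [c Hc] := Jc a v1.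
have /= := Jl (e k) _ Hc; rewrite mulrBr mulrA -scalerAr eM (negPf kv).
by rewrite scaler0 subr0.
Qed.

(** M is generated by e_1 M, so M / J M is concentrated at v1. Only factors Delta(v1) contribute to
    it, each at most one dimension. *)
Lemma count_generated s s' : dfil e 0 {:M} s -> nfil e {:M} s' ->
  (count_mem v1 s <= 1)%N -> generated e v1 M.
Proof.
move=> Fs Fs' c1; pose Z := mulv J {:M}; have sZ : stable Z := @stable_radmul _ _ _ _ _ JP M fullv.
pose W := mulv fullv (ecmp e v1 {:M}).
have WT x : x \in W.
  have sW : stable W by apply: stable_mulv => a b _; apply: memvf.
  apply: (subvP (nfil_gen Fs' sW _ (@stable_full _ _ M))) (memvf x).
  by move=> z _ <-; rewrite -[X in X \in _]act1 mem_mulv ?memvf ?mem_ecmp ?memvf.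
have eZ k x : k != v1 -> act (e k) x \in Z.
  move=> kv; move: x (WT x); apply: mulv_ind => [|r x y Hx Hy|a u _].
  - by rewrite linear0 mem0v.
  - by rewrite linearP memvD ?memvZ.
  case/(ecmpP eM v1 u (@stable_full _ _ M)) => _ <-.
  by rewrite -!actM mem_mulv ?memvf ?rad_mem ?mulrA ?rad_mem.
have dle U s0 : dfil e 0 U s0 -> (\dim (U + Z) <= \dim Z + count_mem v1 s0)%N.
  elim: s0 U => [|l s0 IH] U /=; first by move=> ->; rewrite add0v addn0.
  case=> U' [m [sU' mE -> Hm /IH{}IH]]; rewrite -addvA.
  have [lv|lv] := eqVneq l v1; last first.
    suff -> : (cyc m + (U' + Z) = U' + Z)%VS by [].
    apply/addv_idPr; apply: subv_trans (addvSr _ _).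
    by apply: cyc_sub => //; rewrite -mE eZ.
  apply: (@leq_trans (\dim (<[m]> + (U' + Z))%VS)).
    apply: dimvS; rewrite subv_add addvSr andbT; apply/subvP => _ /cycP[a ->].
    have [_ _ _ Jc] := JP; have [c Hc] := Jc a l.
    have -> : act a m = c *: m + act (a * e l - c *: e l) m.
      by rewrite actBl actZl actM mE addrC subrK.
    rewrite memv_add ?memvZ ?memv_line //.
    by rewrite (subvP (addvSr _ _)) ?mem_mulv ?memvf.
  apply: leq_trans (dimv_add_leqif _ _) _; rewrite dim_vline addnCA.
  by apply: leq_add IH; apply: leq_b1.
have dT := dle _ _ Fs; rewrite addvC (addv_idPr (subvf Z)) in dT.
have [ZT|ZT] := eqVneq Z fullv.
  exists 0; rewrite linear0; split=> //; apply: (nakayama_gen JP) => x.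
  by exists 0; rewrite scale0r subr0 -/Z ZT memvf.
have [t [tE tZ]] : exists t : M, act (e v1) t = t /\ t \notin Z.
  apply/not_existsP => H; case/eqP: ZT; apply: eq_fullv => x.
  rewrite (act_esum e_sum x) memv_suml // => k _.
  have [->|/eZ//] := eqVneq k v1.
  apply/negPn/negP => xZ; apply: (H (act (e v1) x)).
  by rewrite (act_ee eM).
exists t; split=> //; apply: (nakayama_gen JP) => x.
suff : x \in (Z + <[t]>)%VS.
  by case/memv_addP => z Zz [_ /vlineP[r ->] ->]; exists r; rewrite addrK.
suff -> : (Z + <[t]>)%VS = fullv by apply: memvf.
apply/eqP; rewrite eqEdim subvf; apply: leq_trans dT _.
apply: leq_trans (leq_add (leqnn _) c1) _; rewrite addn1 ltn_neqAle dimvS ?addvSl // andbT.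
apply: contra tZ => /eqP E; have /eqP -> : Z == (Z + <[t]>)%VS.
  by rewrite eqEdim addvSl /= E.
by rewrite (subvP (addvSr _ _)) ?memv_line.
Qed.

(** * The S(v1)-part of the socle *)

Section SocleSpace.

Variable Sv : {vspace M}.
Hypothesis SvP : forall x, x \in Sv <->
  act (e v1) x = x /\ forall r, r \in J -> act r x = 0.

(** For l other than v1, socle vectors at v1 vanish in the factor Nabla(l), since e_l A e_1 lies in
    J. For l = v1 the functional h embeds their image in K. *)
Lemma dim_soc_le U s : nfil e U s -> (\dim (Sv :&: U) <= count_mem v1 s)%N.
Proof.
elim: s U => [|l s IH] U /=; first by move=> ->; rewrite capv0 dimv0.
case=> U' [h [[sU' UU'] HU' Hk Hs FU']].
have {}IH := IH _ FU'; have [lv|lv] := eqVneq l v1; last first.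
  apply: leq_trans IH; apply/dimvS/subvP => x; rewrite !memv_cap.
  case/andP => Sx Ux; rewrite Sx /=; apply/HU' => // a.
  have /SvP[vx Jx] := Sx.
  by rewrite -vx -!actM Jx ?linear0 ?mulrA ?rad_mem.
have := limg_ker_dim h (Sv :&: U).
have d1 : (\dim (h @: (Sv :&: U)) <= 1)%N.
  by apply: leq_trans (dimvS (subvf _)) _; rewrite dimvf.
have d2 : (\dim (Sv :&: U :&: lker h) <= \dim (Sv :&: U'))%N.
  apply/dimvS/subvP => x; rewrite !memv_cap memv_ker.
  case/andP => /andP[Sx Ux] /eqP hx; rewrite Sx /=; apply/HU' => // a.
  have /SvP[vx Jx] := Sx; have [_ _ _ Jc] := JP; have [c Hc] := Jc a v1.
  have E : act a x = c *: x.
    rewrite -{1}vx -actM -[a * _](subrK (c *: e v1)) actDl Jx // add0r.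
    by rewrite actZl vx.
  by rewrite E linearZ /= lv vx linearZ /= hx scaler0.
move=> <-; rewrite addnC; apply: leq_add => //; exact: leq_trans d2 IH.
Qed.

(* Ext^1(Delta(v1), Nabla(l)) = 0, along a Nabla-filtration: y can be corrected
   inside U so that it spans a copy of S(v1). *)
Lemma nfil_fix U s y : nfil e U s -> stable U -> act (e v1) y = y ->
  (forall k a, k != v1 -> act (e k) (act a y) \in U) ->
  exists z, [/\ z \in U, act (e v1) z = z
    & forall k a, k != v1 -> act (e k) (act a (y - z)) = 0].
Proof.
elim: s U y => [|l s IH] U y /=.
  move=> -> _ vy H; exists 0; split; rewrite ?mem0v ?linear0 // => k a kv.
  by rewrite ?subr0 ?addr0; apply/eqP; rewrite -memv0 H.
case=> U' [h [[sU' UU'] HU' Hk Hs FU']] sU vy HU.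
(* Since e_k Nabla(v1) = 0 for k != v1, the hypothesis on y then already holds for U'. *)
have [lv|lv] := eqVneq l v1.
  have [k a kv|z [Uz vz Hz]] := IH _ y FU' sU' vy; last first.
    by exists z; split=> //; apply: (subvP UU').
  apply/HU'; first exact: HU.
  move=> b; rewrite -(act_ee eM k) -[act b _]actM Hk ?HU //.
  rewrite idl_mull // mem_idl // lv; apply: contra kv => kv.
  by rewrite eq_le kv v1_min.
have [f fE] := functional_act h l y.
have nv j : ~~ (j <= l)%O -> j != v1.
  by apply: contra => /eqP->; apply: v1_min.
have f0 a : a \in idn e l -> f a = 0.
  move: a; apply: idl_ind => [|k p q Hp Hq|a j b jl]; first by rewrite linear0.
    by rewrite linearP /= Hp Hq scaler0 addr0.
  have E : act (a * e j * b) y = act (a * e j) (act (e j) (act b y)).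
    by rewrite -!actM ?mulrA -[a * e j * e j]mulrA (eMM eM).
  by rewrite fE E Hk ?HU ?nv // idl_mull ?mem_idl.
(* z1 in U reproduces the functional a |-> h(e_l a y), so y - z1 satisfies the hypothesis relative
   to U'. *)
have [z0 [Uz0 z0E]] := Hs f f0; pose z1 := act (e v1) z0.
have z1E a : h (act (e l) (act a z1)) = h (act (e l) (act a y)).
  by rewrite /z1 -[act a _]actM z0E fE mulrA !actM vy (act_ee eM).
have Uz1 : z1 \in U by apply: sU.
have vz1 : act (e v1) z1 = z1 by rewrite /z1 (act_ee eM).
have [||z [Uz vz Hz]] := IH _ (y - z1) FU' sU'.
- by rewrite linearB /= vy vz1.
- move=> k a kv; apply/HU'.
    by rewrite !linearB /= memvB ?HU // !sU.
  move=> b; rewrite !linearB /= -[act b _]actM -[act (b * _) _]actM.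
  by rewrite -[X in _ - h (act _ X)]actM -[act (b * _) (act a z1)]actM z1E subrr.
exists (z1 + z); split.
- by rewrite memvD // (subvP UU').
- by rewrite linearD /= vz1 vz.
by move=> k a kv; rewrite opprD addrA Hz.
Qed.

(** Each factor Nabla(v1) contributes a new socle vector: a lift y from that factor is corrected by
    [nfil_fix] to some x with e_k A x = 0 for all k != v1. *)
Lemma dim_soc_ge U s : nfil e U s -> stable U -> (count_mem v1 s <= \dim (Sv :&: U))%N.
Proof.
elim: s U => [|l s IH] U //= [U' [h [[sU' UU'] HU' Hk Hs FU']]] sU.
have {}IH := IH _ FU' sU'; have dS : (\dim (Sv :&: U') <= \dim (Sv :&: U))%N.
  by apply/dimvS/capvS.
have [lv|lv] := eqVneq l v1; last exact: leq_trans IH dS.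
rewrite add1n; apply: leq_ltn_trans IH _.
have [f [f0 fe]] := functional_sep (e_notin_idn SL v1).
have [|y0 [Uy0 y0E]] := Hs f; first by rewrite lv.
pose y := act (e v1) y0; have vy : act (e v1) y = y by rewrite /y (act_ee eM).
have Uy : y \in U by apply: sU.
have yU' : y \notin U'.
  apply: contra fe => /HU'-/(_ Uy 1); rewrite act1 lv vy -(eMM eM) -{1}lv -y0E -lv.
  by rewrite -[act (e l) (act _ _)]actM lv (eMM eM) => ->.
have nv k : k != v1 -> ~~ (k <= v1)%O.
  by apply: contra => kv; rewrite eq_le kv v1_min.
have [|z [Uz vz Hz]] := nfil_fix FU' sU' vy.
  move=> k a kv; apply/HU'; first by rewrite !sU.
  move=> b; rewrite -(act_ee eM k) -[act b _]actM Hk ?sU //.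
  by rewrite lv idl_mull // mem_idl ?nv.
pose x := y - z; have vx : act (e v1) x = x by rewrite linearB /= vy vz.
have Ux : x \in U by rewrite memvB // (subvP UU').
have xU' : x \notin U'.
  by apply: contra yU' => U'x; rewrite -[y](subrK z) memvD.
have x0 : x != 0 by apply: contra xU' => /eqP->; apply: mem0v.
(* A x = e_1 A e_1 x, J(v1) kills x, and e_1 A e_1 is a line modulo J(v1). That line is given by c
   instead of e_1, whence the rescaling by r1. *)
have ax a : exists r : K, act a x = r *: x.
  have E b : act b x = act (e v1 * b * e v1) x.
    rewrite (act_esum e_sum (act b x)) (bigD1 v1) //= big1 ?addr0.
      by rewrite -!actM -{1}vx -actM ?mulrA.
    by move=> k kv; apply: Hz.
  have Jx b : b \in idn e v1 -> act b x = 0.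
    move: b; apply: idl_ind => [|k p q Hp Hq|b j c /= jv]; first by rewrite act0l.
      by rewrite actDl actZl Hp Hq scaler0 addr0.
    rewrite -mulrA !actM Hz ?linear0 //.
    by apply: contra jv => /eqP->.
  have [c [_ _ _ Hc]] := SL (lexx v1).
  have [r1 Hr1] := Hc 1; have [r Hr] := Hc a.
  have cx : x = r1 *: act c x.
    apply/eqP; rewrite -subr_eq0 -actZl -{1}vx -actBl; apply/eqP/Jx.
    by have := Hr1; rewrite mulr1 (eMM eM).
  have r10 : r1 != 0 by apply: contra x0 => /eqP r0; rewrite cx r0 scale0r.
  exists (r / r1); rewrite E; apply/eqP; rewrite -subr_eq0.
  rewrite [X in _ *: X]cx scalerA mulfVK // -actZl -actBl; apply/eqP/Jx.
  exact: Hr.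
have Sx : x \in Sv.
  apply/SvP; split=> // r Jr; have [c rx] := ax r; rewrite rx.
  have [->|c0] := eqVneq c 0; first by rewrite scale0r.
  (* A nonzero scalar c would put the line of x inside J times itself, against Nakayama. *)
  suff E : <[x]>%VS = 0%VS by case/eqP: x0; apply/eqP; rewrite -memv0 -E memv_line.
  apply: (nakayama JP); rewrite -memvE -[X in X \in _](scalerK c0) -rx memvZ //.
  by rewrite mem_mulv ?memv_line.
rewrite ltn_neqAle dS andbT; apply: contra xU' => /eqP E.
have /eqP E' : (Sv :&: U')%VS == (Sv :&: U)%VS by rewrite eqEdim capvS //= E.
have : x \in (Sv :&: U)%VS by rewrite memv_cap Sx Ux.
by rewrite -E' memv_cap => /andP[].
Qed.

End SocleSpace.

Lemma soc_space : exists Sv : {vspace M}, forall x, x \in Sv <->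
  act (e v1) x = x /\ forall r, r \in J -> act r x = 0.
Proof.
have [||Sv SvP] := @vspace_of _ M (fun x => act (e v1) x = x /\
    forall r, r \in J -> act r x = 0).
- by split=> [|r _]; rewrite linear0.
- move=> a u v [vu Ju] [vv Jv]; split=> [|r Jr]; rewrite linearP /=.
    by rewrite vu vv.
  by rewrite Ju ?Jv // scaler0 addr0.
by exists Sv.
Qed.

(** The Delta-filtration puts a vector at v1 in every nonzero submodule; the Nabla-filtration leaves
    at most a line of socle vectors at v1. *)
Lemma count_cogenerated s s' : dfil e 0 {:M} s -> nfil e {:M} s' ->
  (count_mem v1 s' <= 1)%N -> cogenerated e v1 M.
Proof.
move=> Fs Fs' c1; have [Sv SvP] := soc_space.
apply: (cogenerated_of_ess eM e_sum JP) => [x x0|x y [x0 vx Jx] [_ vy Jy]].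
  apply/not_existsP => H; case/eqP: x0; apply: (dfil_ess Fs (memvf x)) => a.
  by apply/eqP; have /negP := H a; rewrite negbK.
have Sx : x \in Sv by apply/SvP.
have Sy : y \in Sv by apply/SvP.
have := dim_soc_le SvP Fs'; rewrite capvf => dS.
have /eqP E : <[x]>%VS == Sv.
  by rewrite eqEdim -memvE Sx dim_vline x0 /=; apply: leq_trans dS c1.
by move: Sy; rewrite -E => /vlineP.
Qed.

Lemma simple_soc_count s' : nfil e {:M} s' -> simple_mod (submod (soc M)) ->
  (count_mem v1 s' <= 1)%N.
Proof.
move=> Fs' sS; have [Sv SvP] := soc_space.
have := dim_soc_ge SvP Fs' (@stable_full _ _ M); rewrite capvf => H.
apply: leq_trans H _; have [S0|S0] := eqVneq Sv 0%VS; first by rewrite S0 dimv0.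
have x0 : vpick Sv != 0 by rewrite vpick0.
have Sx : vpick Sv \in Sv by apply: memv_pick.
have sg y : y \in Sv -> y != 0 -> sgen e J v1 y by move=> /SvP[].
suff /dimvS : (Sv <= <[vpick Sv]>)%VS by rewrite dim_vline x0.
apply/subvP => y Sy; have [->|y0] := eqVneq y 0; first exact: mem0v.
have [c ->] := simple_soc_sgen eM e_sum JP sS (sg _ Sx x0) (sg _ Sy y0).
by rewrite memvZ ?memv_line.
Qed.

End ModuleFiltrations.

(** * The tilting module T(i) *)

Section Tilting.
Context {K : fieldType} {A : falgType K} {d : Order.disp_t}.
Context {V : finPOrderType d} (e : V -> A).
Implicit Types X Y : pred V.
Hypothesis eM : forall i j, e i * e j = if i == j then e i else 0.
Hypothesis e_sum : \sum_i e i = 1.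
Variable J : {vspace A}.
Hypothesis JP : is_radical e J.
Hypothesis SL : std_line e.
Hypothesis PF : proj_filt e.
Variables v1 vn : V.
Hypothesis v1_min : forall j, (v1 <= j)%O.
Hypothesis vn_max : forall j, (j <= vn)%O.
Hypothesis CP : cog_proj e v1.
Hypothesis GI : gen_inj e v1.
Hypothesis SI : std_inj e vn.
Hypothesis CS : costd_surj e vn.

(* f is a form on A(i) that embeds A(i) e_1 in D(e_1 A(i)). *)
Definition form_at i (f : 'Hom(A, K^o)) :=
  (forall a, a \in idn e i -> f a = 0) /\
  (forall x, x * e v1 = x -> (forall a, f (e v1 * a * x) = 0) -> x \in idn e i).

Lemma form_at_right i f y : form_at i f -> e v1 * y = y ->
  (forall a, f (y * a * e v1) = 0) -> y \in idn e i.
Proof. by case=> f0 fl; apply: (nondeg_right eM e_sum SL PF f0 fl). Qed.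

(** By [embed_left_idn] the embedding of P(j) in P(1) stays injective modulo J(i), so the form on
    A(i) e_1 restricts to A(i) e_j. *)
Lemma form_cog i f j : form_at i f -> exists g : 'Hom(A, K^o),
  (forall a, a \in idn e i -> g a = 0) /\
  (forall x, x * e j = x -> (forall a, g (e v1 * a * x) = 0) -> x \in idn e i).
Proof.
move=> [f0 fl]; have [u [ju u1 uI]] := embed_left eM e_sum SL PF vn_max CP j.
exists (f \o amulr u)%VF; split=> [a Ja|x xj Hx].
  by rewrite comp_lfunE lfunE /= f0 // idl_mulr.
apply: (embed_left_idn eM e_sum SL PF v1_min u1 uI xj).
apply: fl => [|a]; first by rewrite -mulrA u1.
by have := Hx a; rewrite comp_lfunE lfunE /= -!mulrA.
Qed.

Lemma form_gen i f j : form_at i f -> exists g : 'Hom(A, K^o),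
  (forall a, a \in idn e i -> g a = 0) /\
  (forall x, e j * x = x -> (forall a, g (x * a * e v1) = 0) -> x \in idn e i).
Proof.
move=> Hf; have [f0 fl] := Hf.
have [w [w1 wj wI]] := embed_right eM e_sum SL PF vn_max CP GI j.
exists (f \o amull w)%VF; split=> [a Ja|x jx Hx].
  by rewrite comp_lfunE lfunE /= f0 // idl_mull.
apply: (embed_right_idn eM e_sum SL PF v1_min w1 wI jx).
apply: (form_at_right Hf) => [|a]; first by rewrite mulrA w1.
by have := Hx a; rewrite comp_lfunE lfunE /= !mulrA.
Qed.

(** A copy of P(l) is generated by a vector at l, hence lies in J(i) e_1. Conversely e_k A e_1 is
    contained in the copy A u of P(k) by [embed_left_img]. *)
Lemma mem_sumP i (x : Pmod e v1) : x \in sumP e v1 i <-> vsval x \in idn e i.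
Proof.
split=> [/mem_subm_inf H|Jx].
  have [W WP] := @vspace_of _ (Pmod e v1) (fun v => vsval v \in idn e i)
    (mem0v _) (fun k u v Hu Hv => memvD (memvZ k Hu) Hv).
  have sW : stable W by move=> a u /WP Hu; apply/WP; apply: idl_mull.
  apply/WP; apply: (H (Submodule sW)) => U [l [li iU]].
  have [n [cn Hn]] := isom_cyc_gen iU (cyc_pgen eM l).
  have nE : act (e l) n = n.
    apply/eqP; rewrite -subr_eq0 -[X in _ - X]act1 -actBl; apply/eqP/Hn.
    by apply/(act_pgen0 eM); rewrite mulrBl (eMM eM) mul1r subrr.
  apply/subvP => y Uy; have : vsproj U y \in cyc n by rewrite cn memvf.
  case/cycP => a ya; have -> : y = act a (vsval n).
    by rewrite -[y](vsprojK Uy) ya.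
  apply: sW; apply/WP; have -> : vsval n = act (e l) (vsval n).
    by rewrite -[in LHS]nE.
  by rewrite /= -[e l]mul1r mem_idl_mul.
have xE : x = act (vsval x) (pgen e v1).
  apply: val_inj; rewrite [RHS](val_act_pgen eM).
  by have := subvsP x; rewrite (lidealP eM) => /eqP.
rewrite xE; apply: act_idl_sub Jx; first exact: subm_stable.
move=> k a ki; have [u [ku u1 uI]] := embed_left eM e_sum SL PF vn_max CP k.
have [y yv] : exists y : Pmod e v1, vsval y = u.
  by exists (act u (pgen e v1)); rewrite (val_act_pgen eM).
pose U := Submodule (stable_cyc y).
apply/mem_subm_inf => W HW; apply: (subvP (HW U _)).
  exists k; split=> //.
  have Uy : y \in U by apply: mem_cyc1.
  apply: (isom_cyc (m := vsproj U y : submod U) _ (cyc_pgen eM k)).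
    apply: eq_fullv => z; have /cycP[b zb] := subvsP z.
    apply/cycP; exists b; apply: val_inj; rewrite /= vsprojK //.
  move=> b; rewrite (act_pgen0 eM); split=> [/(congr1 val)|b0].
    rewrite /= vsprojK // => /(congr1 val); rewrite /= yv => bu.
    by apply: uI; rewrite -mulrA ?(eMM eM) // ku.
  apply: val_inj; rewrite /= vsprojK //; apply: val_inj; rewrite /= yv.
  by rewrite -ku mulrA b0 mul0r.
have [b Hb] := embed_left_img eM e_sum SL PF u1 uI a (lexx k).
apply/cycP; exists (e k * b * e k); apply: val_inj.
by rewrite -actM [LHS](val_act_pgen eM) Hb /= yv.
Qed.

Lemma hom_Imod_mul v l (F : 'Hom(Imod e v, Imod e l)) : modhom F ->
  exists w, [/\ e v * w = w, w * e l = w & forall f a, nev (F f) a = nev f (w * a)].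
Proof.
move=> hF; pose m (g : 'Hom(A, K^o)) : K^o := nev (F (nmk e v g)) 1.
have lm : linear m.
  move=> k f g; rewrite /m; have -> : nmk e v (k *: f + g) = k *: nmk e v f + nmk e v g.
    apply: (nev_inj eM) => a; rewrite nev_linearl !(nev_nmk eM).
    by rewrite add_lfunE scale_lfunE.
  by rewrite !linearP nev_linearl.
have [w0 Hw] := bidual (linfun m).
exists (e v * (w0 * e l)); split; rewrite ?mulrA ?(eMM eM) //.
  by rewrite -!mulrA (eMM eM).
move=> f a; rewrite -(nev_e eM) -[e l * a]mul1r -(nev_act eM) -hF.
have -> : act (e l * a) f = nmk e v (nevf (act (e l * a) f)).
  by apply: (nev_inj eM) => b; rewrite (nev_nmk eM) nevfE (nev_e eM).
rewrite -[LHS](linfunE lm) Hw nevfE (nev_act eM) -(nev_e eM).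
by rewrite !mulrA.
Qed.

Lemma mem_capKer i f : f \in capKer e v1 i <-> forall a, a \in idn e i -> nev f a = 0.
Proof.
split=> [/mem_subm_inf H|f0].
  apply: idl_ind => [|k x y Hx Hy|a l c li].
  - by rewrite -nevfE linear0.
  - by rewrite nev_linear Hx Hy scaler0 addr0.
  have [w [w1 wl wI]] := embed_right eM e_sum SL PF vn_max CP GI l.
  pose h (g : Imod e v1) : K^o := nev g w.
  have lh : linear h by move=> k g1 g2; rewrite /h nev_linearl.
  have [F [hF FE0]] := hom_Imod eM l (linfun h).
  have FE g b : nev (F g) b = nev g (w * b).
    by rewrite FE0 linfunE // /h -actM (nev_act eM) mulrA wl.
  have sF : limg F = fullv.
    apply: eq_fullv => g; apply/memv_imgP.
    (* Left multiplication by w is injective on e_l A, so g can be transported to w A; any linear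
       extension is a preimage under F. *)
    pose g1 : 'Hom(A, K^o) := (nevf g \o (amull w)^-1)%VF.
    exists (nmk e v1 g1); rewrite ?memvf //; apply: (nev_inj eM) => b.
    rewrite FE (nev_nmk eM) mulrA w1.
    have -> : w * b = amull w b by rewrite lfunE.
    rewrite comp_lfunE nevfE; apply/eqP; rewrite -nevfE -[nev g _]nevfE -subr_eq0 -linearB /=.
    rewrite nevfE -(nev_e eM) [e l * _]wI; first by rewrite -nevfE linear0.
      by rewrite mulrA (eMM eM).
    rewrite mulrA wl -[w * _]/((w \*o idfun) _) -lfunE -/(amull w) linearB /=.
    by rewrite limg_lfunVK ?memv_img ?memvf // subrr.
  have sk : stable (lker F).
    by move=> b g; rewrite !memv_ker hF => /eqP->; rewrite linear0.
  have : f \in lker F by apply: (H (Submodule sk)); exists l, F.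
  rewrite memv_ker => /eqP Ff.
  have [b Hb] := embed_right_img eM e_sum SL PF w1 wI a (lexx l).
  by rewrite -(nev_e eM) !mulrA Hb -!mulrA -FE Ff /nev zero_lfunE.
apply/mem_subm_inf => U [l [F [li hF _ ->]]].
have [w [_ wl wE]] := hom_Imod_mul hF.
rewrite memv_ker; apply/eqP; apply: (nev_inj eM) => a.
rewrite wE [RHS]/nev zero_lfunE f0 // -wl.
by apply: idl_mulr; apply: idl_mull; apply: mem_idl.
Qed.

Variables (i : V) (T : lmodule A).
Hypothesis T0 : forall l, ~~ (l <= i)%O -> forall x : T, act (e l) x = 0.

Lemma act_idn0 a (x : T) : a \in idn e i -> act a x = 0.
Proof.
move: a; apply: idl_ind => [|k a b Ha Hb|a j b ji]; first by rewrite act0l.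
  by rewrite actDl actZl Ha Hb scaler0 addr0.
by rewrite -mulrA !actM T0 // linear0.
Qed.

Definition cyc_gen (t : T) := [/\ act (e v1) t = t, cyc t = fullv
  & forall a, act a t = 0 <-> a * e v1 \in idn e i].

Lemma isom_sumP : isom T (quotmod (sumP e v1 i)) <-> exists t, cyc_gen t.
Proof.
pose Q := quotmod (sumP e v1 i); pose q : Q := qproj (sumP e v1 i) (pgen e v1).
have cq : cyc q = fullv.
  apply: eq_fullv => x.
  have /cycP[a E] : vsval x \in cyc (pgen e v1) by rewrite (cyc_pgen eM) memvf.
  by apply/cycP; exists a; rewrite /q -qproj_hom -E qproj_val.
have Hq a : act a q = 0 <-> a * e v1 \in idn e i.
  rewrite -(val_act_pgen eM) -mem_sumP -qproj_eq0 qproj_hom.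
  by split=> /eqP.
split=> [iT|[t [tE ct Ht]]]; last first.
  by apply: (isom_cyc ct cq) => a; rewrite Ht Hq.
have [t [ct Ht]] := isom_cyc_gen iT cq; exists t; split=> // [|a].
  apply/eqP; rewrite -subr_eq0 -[X in _ - X]act1 -actBl; apply/eqP/Ht/Hq.
  by rewrite mulrBl (eMM eM) mul1r subrr mem0v.
by rewrite Ht Hq.
Qed.

Lemma isom_capKer_cog : isom T (submod (capKer e v1 i)) -> cogenerated e v1 T.
Proof.
move=> [F [hF /bij_inj FI]].
pose h (x : T) : K^o := nev (vsval (F x)) 1.
have lh : linear h by move=> k x y; rewrite /h !linearP nev_linearl.
exists (linfun h) => x Hx; apply: FI; rewrite linear0; apply: val_inj.
apply: (nev_inj eM) => a; rewrite [RHS]/nev zero_lfunE.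
have := Hx a; rewrite linfunE // /h -actM hF [vsval _]/= (nev_act eM) mul1r.
by rewrite (nev_e eM).
Qed.

Lemma cyc_gen_form t : cyc_gen t -> cogenerated e v1 T ->
  exists f : 'Hom(A, K^o), form_at i f /\
  exists g : 'Hom(T, K^o), (forall a, f a = g (act a t)) /\
    (forall x, (forall a, g (act (e v1) (act a x)) = 0) -> x = 0).
Proof.
move=> [tE ct Ht] [g Hg].
exists (g \o orbit_map t)%VF; split; last first.
  by exists g; split=> // a; rewrite comp_lfunE orbit_mapE.
split=> [a Ja|x x1 Hx]; first by rewrite comp_lfunE orbit_mapE act_idn0 // linear0.
rewrite -x1; apply/Ht/Hg => a; have := Hx a.
by rewrite comp_lfunE orbit_mapE !actM.
Qed.

(** Cogeneration gives injectivity. For surjectivity, the form is also nondegenerate on the right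
    modulo J(i), so each functional on e_1 A killing J(i) is represented by a vector of T. *)
Lemma isom_capKer t : cyc_gen t -> cogenerated e v1 T ->
  isom T (submod (capKer e v1 i)).
Proof.
move=> gt ct; have [f [Hf [g [fE Hg]]]] := cyc_gen_form gt ct.
have [F [hF FE]] := hom_Imod eM v1 g.
have FC x : F x \in capKer e v1 i.
  by apply/mem_capKer => a Ja; rewrite FE (act_idn0 _ Ja) !linear0.
pose G : 'Hom(T, submod (capKer e v1 i)) :=
  (linfun (vsproj (capKer e v1 i)) \o F)%VF.
have GE x : vsval (G x) = F x by rewrite /G comp_lfunE lfunE /= vsprojK.
exists G; split=> [a x|].
  by apply: val_inj; rewrite [LHS]GE hF /= GE.
apply: modhom_bij.
  rewrite -subv0; apply/subvP => x; rewrite memv_ker memv0 => /eqP Gx.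
  apply/eqP/Hg => a; rewrite -FE -GE Gx.
  by rewrite /nev zero_lfunE.
apply: eq_fullv => y; apply/memv_imgP.
have [|||x Hx] := @functional_repr _ T A
    (fun x w => g (act (e v1) (act w x))) _ _ (nevf (vsval y)).
- by move=> x k a b; rewrite actDl actZl !linearP.
- by move=> w k a b; rewrite !linearP.
- move=> w Hw; rewrite nevfE -(nev_e eM); apply: ((mem_capKer _ _).1 (subvsP y)).
  apply: (form_at_right Hf) => [|a]; first by rewrite mulrA (eMM eM).
  by rewrite fE !actM; case: gt => -> _ _.
exists x; rewrite ?memvf //; apply: val_inj; rewrite [RHS]GE.
by apply: (nev_inj eM) => a; rewrite FE -Hx nevfE.
Qed.

(** * Standard multiplicities of T and its identification with A(i) e_1 *)

Section Filtered.
Variables s s' : seq V.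
Hypothesis Fs : dfil e 0 {:T} s.
Hypothesis Fs' : nfil e {:T} s'.
Hypothesis is' : i \in s'.

(** T/J(k)T keeps the factors Delta(l) with l <= k; among these only l = k has a nonzero
    e_k-part. *)
Lemma count_std k : (\dim (ecmp e k {:T}) =
  \dim (ecmp e k (mulv (idn e k) {:T})) + count_mem k s)%N.
Proof.
rewrite (dfil_dim eM SL k Fs) (dim_trace eM e_sum SL PF k (@up_closed_nle _ _ k) Fs).
elim: s => //= l s0 ->; rewrite eq_le addnACA; congr (_ + _)%N.
by case: (l <= k)%O; case: (k <= l)%O.
Qed.

Lemma count_nle k : ~~ (k <= i)%O -> count_mem k s = 0%N.
Proof.
move=> ki; apply/eqP; rewrite -leqn0.
have : \dim (ecmp e k {:T}) = 0%N by apply/ecmp_eq0 => x; apply: T0.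
by rewrite count_std => /eqP; rewrite addn_eq0 => /andP[_ /eqP->].
Qed.

(** e_k T is spanned by c t modulo e_k J(k) T, where c spans e_k A e_1 modulo J(k). *)
Lemma count_le1 (t : T) k : act (e v1) t = t -> cyc t = fullv -> (count_mem k s <= 1)%N.
Proof.
move=> tE ct; have [c [kc cv _ Hc]] := costd_line eM e_sum SL PF (v1_min k).
pose Z := mulv (idn e k) {:T}; have sZ : stable Z by apply: stable_idl.
suff : (\dim (ecmp e k {:T}) <= \dim (ecmp e k Z) + 1)%N by rewrite count_std leq_add2l.
apply: leq_trans (_ : \dim (ecmp e k Z + <[act c t]>)%VS <= _)%N.
  apply: dimvS; apply/subvP => x /(ecmpP eM k x (@stable_full _ _ T))[_ kx].
  have /cycP[a xa] : x \in cyc t by rewrite ct memvf.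
  have [r Hr] := Hc a.
  have E : x = act (e k * a * e v1 - r *: c) t + r *: act c t.
    by rewrite actBl actZl subrK !actM tE -xa kx.
  rewrite E memv_add ?memvZ ?memv_line //; apply/(ecmpP eM k _ sZ); split.
    by rewrite mem_mulv ?memvf.
  by rewrite -actM mulrBr -scalerAr kc !mulrA (eMM eM).
apply: leq_trans (dimv_add_leqif _ _) _.
by rewrite leq_add2l dim_vline leq_b1.
Qed.

(** The c defining the surjection from Nabla(i) to Nabla(k) kills J(k) T, because c J(k) lies in
    J(i). It is nonzero on e_k T, since e_i A e_k is a line modulo J(i) and acts nontrivially; so
    e_k T is not inside J(k) T. *)
Lemma count_ge1 k : (k <= i)%O -> (0 < count_mem k s)%N.
Proof.
move=> ki; have [c [ic ck Hc]] := costd_surj_le eM e_sum SL PF vn_max CS ki.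
have [x [a [_ ax]]] := nfil_mem eM e_sum SL PF Fs' is' ki.
have [c0 [_ _ _ Hc0]] := costd_line eM e_sum SL PF ki.
pose x1 := act (e k) x; have kx1 : act (e k) x1 = x1 by rewrite /x1 (act_ee eM).
have line b : exists r : K, act (e i * b * e k) x1 = r *: act c0 x1.
  have [r Hr] := Hc0 b; exists r; apply/eqP.
  by rewrite -subr_eq0 -actZl -actBl act_idn0.
have cx : act c x1 != 0.
  have [r rE] := line a; have [q qE] := line c; rewrite ic ck in qE.
  have c0x : act c0 x1 != 0.
    apply: contra ax => /eqP c0x.
    by have := rE; rewrite c0x scaler0 actM kx1 /x1 -actM => ->.
  have q0 : q != 0.
    apply: contra (e_notin_idn SL k) => /eqP q0.
    rewrite -(eMM eM); apply/Hc; rewrite ck.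
    have [p Hp] := Hc0 c; rewrite ic ck in Hp.
    have : p *: act c0 x1 = 0.
      have : act (c - p *: c0) x1 = 0 by apply: act_idn0.
      by rewrite actBl actZl qE q0 scale0r sub0r => /eqP; rewrite oppr_eq0 => /eqP.
    move/eqP; rewrite scaler_eq0 (negPf c0x) orbF => /eqP p0.
    by move: Hp; rewrite p0 scale0r subr0.
  by rewrite qE scaler_eq0 negb_or q0.
rewrite lt0n; apply: contra cx => /eqP s0; have := count_std k; rewrite s0 addn0 => dE.
pose Z := mulv (idn e k) {:T}; have sZ : stable Z by apply: stable_idl.
have /eqP E : ecmp e k Z == ecmp e k {:T} by rewrite eqEdim ecmpS ?subvf //= dE.
have : x1 \in ecmp e k {:T} by rewrite mem_ecmp ?memvf.
rewrite -E => /(ecmpP eM k _ sZ)[Zx _].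
suff cZ z : z \in Z -> act c z = 0 by rewrite cZ.
move: z {Zx}; apply: mulv_ind => [|r y z Hy Hz|b u Jb _]; first by rewrite linear0.
  by rewrite linearP /= Hy Hz scaler0 addr0.
by rewrite -actM act_idn0 //; apply/Hc; rewrite idl_mull.
Qed.

Lemma generated_count : generated e v1 T -> forall k, count_mem k s = (k <= i)%O.
Proof.
case=> t [tE ct] k; have [ki|ki] := boolP (k <= i)%O; last exact: count_nle.
by apply/eqP; rewrite eqn_leq (count_le1 k tE ct) count_ge1.
Qed.

Lemma generated_cyc_gen : generated e v1 T -> exists t, cyc_gen t.
Proof.
move=> gT; have cE := generated_count gT; case: gT => t [tE ct].
exists t; split=> // a; split=> [at0|Ja]; last by rewrite -tE -actM act_idn0.
apply: (mem_idn_comp e_sum) => k.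
pose Yi := (fun j => ~~ (j <= i)%O).
pose F := corner e k predT v1; pose F0 := corner e k Yi v1.
have dT : \dim (ecmp e k {:T}) = #|[pred l | (k <= l <= i)%O]|.
  rewrite (dfil_dim eM SL k Fs) count_sum -sum1_card big_mkcond [RHS]big_mkcond.
  by apply: eq_bigr => l _; rewrite cE inE; case: (k <= l)%O.
have imF : (orbit_map t @: F)%VS = ecmp e k {:T}.
  apply/vspaceP => x; apply/memv_imgP/idP => [[y /(cornerP eM)[ky _ _] ->]|].
    by rewrite orbit_mapE -ky actM mem_ecmp ?memvf.
  case/(ecmpP eM k x (@stable_full _ _ T)) => _ kx.
  have /cycP[b xb] : x \in cyc t by rewrite ct memvf.
  exists (e k * b * e v1); first exact: mem_cornerT.
  by rewrite orbit_mapE !actM tE -xb kx.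
have F0F : (F0 <= F :&: lker (orbit_map t))%VS.
  apply/subvP => x /(cornerP eM)[kx x1 Jx]; rewrite memv_cap memv_ker orbit_mapE.
  rewrite act_idn0 // eqxx andbT; apply/(cornerP eM); split=> //.
  exact: idl_full.
have dF : (\dim F0 + \dim (ecmp e k {:T}) = \dim F)%N.
  rewrite dT /F /F0 (dim_corner eM e_sum SL PF _ _ (@up_closed_nle _ _ i)).
  rewrite (dim_corner eM e_sum SL PF) // addnC.
  rewrite -[RHS](cardID [pred l | (l <= i)%O]); congr (_ + _)%N.
  by apply: eq_card => l; rewrite !inE v1_min andbT /= andbC.
have := limg_ker_dim (orbit_map t) F; rewrite imF -dF => /eqP.
rewrite eqn_add2r => /eqP dE.
have /eqP E : F0 == (F :&: lker (orbit_map t))%VS by rewrite eqEdim F0F dE /=.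
suff : e k * (a * e v1) \in F0 by case/(cornerP eM).
rewrite E memv_cap mulrA (mem_cornerT eM e_sum) memv_ker orbit_mapE.
by rewrite !actM tE at0 linear0 eqxx.
Qed.

Lemma generated_cogenerated : generated e v1 T -> cogenerated e v1 T.
Proof.
move=> gT; apply: (count_cogenerated eM e_sum JP vn_max CP SI Fs Fs').
rewrite -(count_dfil_nfil eM e_sum SL PF Fs Fs').
by rewrite (generated_count gT) leq_b1.
Qed.

(* If f realizes A(i)e_1 as an injective A(i)-module, then A(i)e_1 splits off
   T: the composite A(i)e_1 -> T -> A(i)e_1 is nonzero on the one-dimensional
   e_i-component, hence not nilpotent, hence bijective. *)
Lemma form_cyc_gen f : \dim (ecmp e i {:T}) = 1%N -> indecomposable T ->
  form_at i f -> exists t, cyc_gen t.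
Proof.
move=> d1 [_ ind] Hf; have [f0 fl] := Hf.
have [Jl Jr [n Jn] Jc] := JP.
(* T is generated by e_1 T because of its Nabla-filtration, and e_i T is nonzero. *)
have [t [b [tE y00]]] : exists (t : T) b, act (e v1) t = t /\ act (e i * b) t != 0.
  pose W := mulv fullv (ecmp e v1 {:T}).
  have sW : stable W by apply: stable_mulv => a c _; apply: memvf.
  have WT x : x \in W.
    apply: (subvP (nfil_gen eM vn_max GI CS Fs' sW _ (@stable_full _ _ T))) (memvf x).
    by move=> z _ <-; rewrite -[X in X \in _]act1 mem_mulv ?memvf ?mem_ecmp ?memvf.
  apply/not_existsP => H.
  suff /ecmp_eq0 : forall x : T, act (e i) x = 0 by rewrite d1.
  move=> x; move: x (WT x); apply: mulv_ind => [|r x y Hx Hy|a u _].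
  - exact: linear0.
  - by rewrite linearP /= Hx Hy scaler0 addr0.
  case/(ecmpP eM v1 u (@stable_full _ _ T)) => _ uE.
  apply/eqP; apply: contraT => au; case: (H u); exists a; split=> //.
  by rewrite actM.
have [a0 ya0] : exists a0, act (e v1) (act a0 (act (e i * b) t)) != 0.
  apply/not_existsP => H; case/eqP: y00; apply: (dfil_ess vn_max CP SI Fs (memvf _)) => a.
  by apply/eqP; have /negP := H a; rewrite negbK.
have [m ma] := functional_neq0 ya0.
(* q is the image, unique modulo J(i), of x under the homomorphism from T to A(i) e_1 that m induces
   through the form; p0 is the image of t. *)
have repr (x : T) : exists q, q * e v1 = q /\
    forall w, m (act (e v1) (act w x)) = f (e v1 * w * q).
  have [g gE] := @functional_act _ _ _ _ e T m v1 x.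
  have [|||q Hq] := @functional_repr _ A A (fun q w => f (e v1 * w * q * e v1)) _ _ g.
  - by move=> z k p q; rewrite mulrDr !mulrDl -scalerAr -!scalerAl linearP.
  - by move=> z k p q; rewrite mulrDr !mulrDl -scalerAr -!scalerAl linearP.
  - move=> w Hw; rewrite gE -actM act_idn0 ?linear0 //.
    by apply: (form_at_right Hf) => //; rewrite mulrA (eMM eM).
  exists (q * e v1); split=> [|w]; first by rewrite -mulrA (eMM eM).
  by rewrite -gE Hq mulrA.
have [p0 [p0v Hp0]] := repr t; pose p := e v1 * p0.
have pv : p * e v1 = p by rewrite -mulrA p0v.
have vp : e v1 * p = p by rewrite /p mulrA (eMM eM).
have Hp w : m (act (e v1) (act w t)) = f (e v1 * w * p).
  by rewrite -{1}tE -[act w _]actM Hp0 !mulrA.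
move: p pv vp Hp => p pv vp Hp.
have [c Hc] := Jc p v1; rewrite pv in Hc; pose r := p - c *: e v1.
have rn : r ^+ n = 0.
  apply/eqP; rewrite -memv0 -Jn; elim: (n) => [|k IH]; first exact: memv_line.
  by rewrite exprS expvSl memv_mul.
have ibp : e i * b * p \notin idn e i.
  apply: contra ma => Jibp; rewrite -[act a0 _]actM Hp.
  have -> : e v1 * (a0 * (e i * b)) * p = e v1 * a0 * (e i * b * p) by rewrite !mulrA.
  by rewrite f0 ?eqxx // idl_mull.
(* If c = 0 then p = r is nilpotent. Modulo J(i), e_i A e_1 is the line of q and r acts on it by s1,
   so s1 = 0; then e_i b p lies in J(i), against [ibp]. *)
have c0 : c != 0.
  have [q [iq qv qJ Hq]] := costd_line eM e_sum SL PF (v1_min i).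
  have rv : r * e v1 = r by rewrite mulrBl pv -scalerAl (eMM eM).
  have [s1 Hs] := Hq (q * r); rewrite !mulrA iq -mulrA rv in Hs.
  have Hk k : q * r ^+ k - s1 ^+ k *: q \in idn e i.
    elim: k => [|k IH]; first by rewrite !expr0 mulr1 scale1r subrr mem0v.
    have -> : q * r ^+ k.+1 - s1 ^+ k.+1 *: q =
        (q * r ^+ k - s1 ^+ k *: q) * r + s1 ^+ k *: (q * r - s1 *: q).
      rewrite mulrBl -scalerAl scalerBr scalerA -exprSr -mulrA -exprSr.
      by rewrite addrA subrK.
    by rewrite memvD ?memvZ // idl_mulr.
  have s10 : s1 = 0.
    have := Hk n; rewrite rn mulr0 sub0r memvN => Hn.
    apply/eqP; apply: contraT => s0; case/negP: qJ.
    by rewrite -[q](scalerK (expf_neq0 n s0)) memvZ.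
  move: Hs; rewrite s10 scale0r subr0 => qr.
  apply: contra ibp => /eqP c0; have -> : p = r by rewrite /r c0 scale0r subr0.
  have vr : e v1 * r = r.
    by rewrite /r mulrBr -scalerAr (eMM eM) vp.
  have [s2 Hs2] := Hq b.
  have -> : e i * b * r = (e i * b * e v1 - s2 *: q) * r + s2 *: (q * r).
    by rewrite mulrBl -scalerAl subrK -[_ * e v1 * r]mulrA vr.
  by rewrite memvD ?memvZ // idl_mulr.
have pr z : z * e v1 = z -> z * p = z * r + c *: z.
  by move=> zv; rewrite /r mulrBr -scalerAr zv subrK.
(* Right multiplication by p = c e_1 + r is invertible on A e_1, r being nilpotent. [cancel_p] is
   injectivity modulo J(i), [div_p] surjectivity, both by induction on powers of r. *)
have cancel_p z : z * e v1 = z -> z * p \in idn e i -> z \in idn e i.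
  move=> zv Jzp; have : z * r ^+ n \in idn e i by rewrite rn mulr0 mem0v.
  elim: (n) => [|k IH]; first by rewrite mulr1.
  rewrite exprS mulrA => H; apply: IH.
  have : z * p * r ^+ k \in idn e i by rewrite idl_mulr.
  rewrite (pr z zv) mulrDl -scalerAl => H2.
  rewrite -[z * _](scalerK c0) memvZ // -[c *: _](addKr (z * r * r ^+ k)).
  by rewrite memvD ?memvN.
have div_p z : z * e v1 = z -> exists2 a, a * e v1 = a & z = a * p.
  have : z * r ^+ n = 0 by rewrite rn mulr0.
  elim: (n) z => [|k IH] z; first by rewrite mulr1 => -> _; exists 0; rewrite !mul0r.
  rewrite exprS mulrA => zr zv.
  have [|a av E] := IH _ zr.
    by rewrite /r -mulrA mulrBl pv -scalerAl (eMM eM).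
  exists (c^-1 *: (z - a)); first by rewrite -scalerAl mulrBl zv av.
  by rewrite -scalerAl mulrBl (pr z zv) E addrAC subrr add0r scalerK.
have annt a : act a t = 0 <-> a * e v1 \in idn e i.
  split=> [at0|Ja]; last by rewrite -tE -actM act_idn0.
  have av : a * e v1 * e v1 = a * e v1 by rewrite -mulrA (eMM eM).
  apply: (cancel_p _ av); apply: fl => [|w]; first by rewrite -mulrA pv.
  have -> : e v1 * w * (a * e v1 * p) = e v1 * (w * a) * p.
    by rewrite !mulrA -[_ * e v1 * p]mulrA vp.
  by rewrite -Hp actM at0 !linear0.
(* N is the kernel of the map from T to A(i) e_1. That map is bijective on A t, so T is the direct
   sum of A t and N, and N = 0 since t is nonzero. *)
have [||N NP] := @vspace_of _ T (fun x => forall a, m (act (e v1) (act a x)) = 0).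
- by move=> a; rewrite !linear0.
- by move=> k x y Hx Hy a; rewrite !linearP /= Hx Hy scaler0 addr0.
have sN : stable N.
  by move=> a x /NP Hx; apply/NP => w; rewrite -[act w _]actM.
have Nt : (cyc t :&: N = 0)%VS.
  apply/eqP; rewrite -subv0; apply/subvP => x; rewrite memv_cap memv0.
  case/andP => /cycP[a ->] /NP Ha; apply/eqP/annt.
  have av : a * e v1 * e v1 = a * e v1 by rewrite -mulrA (eMM eM).
  apply: (cancel_p _ av); apply: fl => [|w]; first by rewrite -mulrA pv.
  have -> : e v1 * w * (a * e v1 * p) = e v1 * (w * a) * p.
    by rewrite !mulrA -[_ * e v1 * p]mulrA vp.
  by rewrite -Hp actM.
have Nf : (cyc t + N = fullv)%VS.
  apply: eq_fullv => x; have [q [qv Hq]] := repr x.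
  have [a av qE] := div_p q qv.
  have -> : x = act a t + (x - act a t) by rewrite addrC subrK.
  rewrite memv_add ?mem_cyc //; apply/NP => w.
  by rewrite !linearB /= Hq qE -[act w _]actM Hp !mulrA subrr.
exists t; split=> //; case: (ind (Submodule (stable_cyc t)) (Submodule sN) Nf Nt) => /= E.
  case/eqP: y00; have -> : t = 0 by apply/eqP; rewrite -memv0 -E mem_cyc1.
  exact: linear0.
by rewrite -Nf E addv0.
Qed.

End Filtered.
End Tilting.

(** * The truncated algebra A(i) *)

Lemma dfil_base (K : fieldType) (A : falgType K) (d : Order.disp_t)
    (V : finPOrderType d) (e : V -> A) (M : lmodule A) (W U : {vspace M}) s :
  dfil e W U s -> (W <= U)%VS.
Proof.
elim: s U => [|l s IH] U /=; first by move->.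
by case=> U' [m [_ _ -> _ /IH H]]; apply: subv_trans H (addvSr _ _).
Qed.

Section Transport.
Context {K : fieldType} {A A' : falgType K} {d d' : Order.disp_t}.
Context {V : finPOrderType d} {V' : finPOrderType d'}.
Variables (e : V -> A) (e' : V' -> A') (i : V) (v : V' -> V) (q : 'Hom(A, A')).
Hypothesis eM : forall i j, e i * e j = if i == j then e i else 0.
Hypothesis e_sum : \sum_i e i = 1.
Hypothesis e_neq0 : forall i, e i != 0.
Variable J : {vspace A}.
Hypothesis JP : is_radical e J.
Hypothesis qM : forall a b, q (a * b) = q a * q b.
Hypothesis q1 : q 1 = 1.
Hypothesis q_surj : limg q = fullv.
Hypothesis q_ker : forall a, (q a == 0) = (a \in idn e i).
Hypothesis qe : forall j, e' j = q (e (v j)).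
Hypothesis v_le : forall j k, (v j <= v k)%O = (j <= k)%O.
Hypothesis v_img : forall k, (k <= i)%O -> exists j, v j = k.
Hypothesis v_sub : forall j, (v j <= i)%O.

Lemma lift_q (a' : A') : exists a, a' = q a.
Proof.
have : a' \in limg q by rewrite q_surj memvf.
by case/memv_imgP => a _ ->; exists a.
Qed.

Lemma trunc_inj : injective v.
Proof. by move=> j k E; apply/eqP; rewrite eq_le -!v_le E lexx. Qed.

Lemma trunc_idemM j k : e' j * e' k = if j == k then e' j else 0.
Proof.
rewrite !qe -qM eM (inj_eq trunc_inj).
by case: eqP => // _; rewrite linear0.
Qed.

Lemma trunc_idem_sum : \sum_j e' j = 1.
Proof.
rewrite -q1 -e_sum linear_sum (bigID (fun k => (k <= i)%O)) /=.
rewrite [X in _ = _ + X]big1 ?addr0 => [|k ki]; last first.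
  by apply/eqP; rewrite q_ker mem_idl.
have P : perm_eq [seq v j | j <- enum V'] (enum [pred k | (k <= i)%O]).
  apply: uniq_perm; rewrite ?enum_uniq // ?(map_inj_uniq trunc_inj) ?enum_uniq //.
  move=> k; rewrite mem_enum inE; apply/mapP/idP => [[j _ ->]|/v_img[j <-]].
    exact: v_sub.
  by exists j; rewrite ?mem_enum.
rewrite -[RHS](@big_enum _ _ _ _ [pred k | (k <= i)%O]) -(perm_big _ P) big_map /=.
by rewrite big_enum; apply: eq_bigr => j _; rewrite qe.
Qed.

(** J(i) lies in J(v t) because v t <= i, so J(v t) is the full preimage of its image. Conditions
    modulo [idn e' t] can thus be checked in A. *)
Lemma trunc_idn x t : q x \in idn e' t <-> x \in idn e (v t).
Proof.
split=> [|Jx].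
  have sub : (idn e' t <= q @: idn e (v t))%VS.
    apply/subvP; apply: idl_ind => [|k y z Hy Hz|a' j b' jt].
    - exact: mem0v.
    - by rewrite memvD ?memvZ.
    have [a ->] := lift_q a'; have [b ->] := lift_q b'.
    by rewrite qe -!qM memv_img // mem_idl_mul // v_le.
  move/(subvP sub)/memv_imgP => [y Jy qxy].
  rewrite -[x](subrK y) memvD //; apply: (subvP (idn_le eM (v_sub t))).
  by rewrite -q_ker linearB /= qxy subrr.
move: x Jx; apply: idl_ind => [|k y z Hy Hz|a k b kt].
- by rewrite linear0 mem0v.
- by rewrite linearP memvD ?memvZ.
have [ki|ki] := boolP (k <= i)%O; last first.
  have /eqP-> : q (a * e k * b) == 0 by rewrite q_ker mem_idl_mul.
  exact: mem0v.
have [j jk] := v_img ki; rewrite -jk !qM -qe mem_idl_mul //; first exact: trunc_idemM.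
by rewrite -v_le jk.
Qed.

Lemma limg_expv (n : nat) : ((q @: J) ^+ n <= q @: (J ^+ n))%VS.
Proof.
elim: n => [|n IH].
  by rewrite !expv0 -memvE -q1 memv_img ?memv_line.
rewrite !expvSl; apply/prodvP => _ y' /memv_imgP[x Jx ->] /(subvP IH).
by case/memv_imgP => y Jy ->; rewrite -qM memv_img ?memv_mul.
Qed.

Lemma trunc_radical : is_radical e' (q @: J)%VS.
Proof.
have [Jl Jr [n Jn] Jc] := JP; split.
- move=> a' _ /memv_imgP[x Jx ->]; have [a ->] := lift_q a'.
  by rewrite -qM memv_img ?Jl.
- move=> a' _ /memv_imgP[x Jx ->]; have [a ->] := lift_q a'.
  by rewrite -qM memv_img ?Jr.
- exists n; apply/eqP; rewrite -subv0; apply: subv_trans (limg_expv n) _.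
  by rewrite Jn limg0.
move=> a' j; have [a ->] := lift_q a'; have [c Hc] := Jc a (v j).
by exists c; rewrite qe -qM -linearZ -linearB memv_img.
Qed.

Section DataTransport.
Hypothesis SL : std_line e.
Hypothesis PF : proj_filt e.

Lemma trunc_idem_neq0 j : e' j != 0.
Proof.
rewrite qe q_ker; apply: contra (e_notin_idn SL (v j)).
exact: subvP (idn_le eM (v_sub j)) _.
Qed.

Lemma trunc_std_line : std_line e'.
Proof.
move=> k t kt; rewrite -v_le in kt; have [c [kc ct cJ Hc]] := SL kt.
exists (q c); rewrite !qe -!qM kc ct; split=> //.
  by apply: contra cJ => /trunc_idn.
move=> a'; have [a ->] := lift_q a'; have [r Hr] := Hc a; exists r.
by rewrite -!qM -linearZ -linearB; apply/trunc_idn.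
Qed.

(** The inclusions make W the kernel of q on U, so the chain above W maps to a chain above 0 with
    factors relabelled by v. *)
Lemma dfil_push (W U : {vspace A}) s :
  dfil e (M := regmod) W U s -> (forall t, t \in s -> (t <= i)%O) ->
  (W <= idn e i)%VS -> (U :&: idn e i <= W)%VS -> (W <= U)%VS ->
  exists s', s = map v s' /\ dfil e' (M := regmod) 0 (q @: U)%VS s'.
Proof.
elim: s U => [|l s IH] U /=.
  move=> -> _ WJ _ _; exists [::]; split=> //=.
  apply/eqP; rewrite -subv0; apply/subvP => y /memv_imgP[x Wx ->].
  by have := subvP WJ x Wx; rewrite -q_ker => /eqP->; rewrite mem0v.
case=> U' [m [sU' mE UE Hm FU']] si WJ UJ WU.
have WU' := dfil_base FU'.
have U'U : (U' <= U)%VS by rewrite UE addvSr.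
have [||//|//|s' [sE Fs']] := IH U' FU'.
- by move=> t ts; apply: si; rewrite inE ts orbT.
- exact: WJ.
- by apply: subv_trans UJ; apply: capvS.
have [l' lE] : exists l', v l' = l by apply/v_img/si; rewrite inE eqxx.
exists (l' :: s'); rewrite /= lE sE; split=> //.
exists (q @: U')%VS, (q m); split=> //.
- move=> a' _ /memv_imgP[x Ux ->]; have [a ->] := lift_q a'.
  by rewrite /= -qM memv_img // sU'.
- by rewrite /= qe -qM lE mE.
- rewrite UE limgD; congr (_ + _)%VS; apply/vspaceP => y; apply/idP/idP.
    case/memv_imgP => z mz ->; have [a za] := cycP (M := regmod) m z mz.
    by apply/(cycP (M := regmod)); exists (q a); rewrite za /= qM.
  case/(cycP (M := regmod)) => a' ->; have [a ->] := lift_q a'.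
  by rewrite /= -qM memv_img //; apply: (mem_cyc (M := regmod)).
move=> a'; have [a ->] := lift_q a'; rewrite /= -qM qe lE -qM trunc_idn lE -Hm.
split=> [/memv_imgP[x Ux E]|H]; last by rewrite memv_img.
have Uam : a * m \in U.
  by rewrite UE (subvP (addvSl _ _)) //; apply: (mem_cyc (M := regmod)).
suff : a * m - x \in U'.
  by move=> H; rewrite -[a * m](subrK x) memvD.
apply: (subvP WU'); apply: (subvP UJ); rewrite memv_cap memvB ?(subvP U'U x) //=.
by rewrite -q_ker linearB /= E subrr.
Qed.

(** With Z = J(i) e_j, [dfil_quot] removes the factors of P(j) not below i, and [dfil_push] carries
    the rest to A(i). *)
Lemma trunc_proj_filt : proj_filt e'.
Proof.
move=> j; have [s [Fs sE]] := PF (v j).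
pose U : {vspace regmod} := lideal (e (v j)); pose Z := mulv (idn e i) U.
have sU : stable U by apply: (@subm_stable _ _ regmod).
have sZ : stable Z by apply: stable_idl.
have ZU : (Z <= U)%VS by apply: mulv_sub => a u _; apply: sU.
have HZ j0 (x : regmod) : ~~ (j0 <= i)%O -> x \in U -> act (e j0) x \in Z.
  by move=> ji Ux; apply: mem_mulv => //; apply: mem_idl.
have := @dfil_quot _ _ _ _ e eM e_sum SL PF regmod U Z _ s
  (@up_closed_nle _ _ i) sZ HZ (capvSl _ _) Fs.
rewrite (addv_idPl ZU) => /dfil_push[||||s' [s'E Fs']] //.
- by move=> t; rewrite mem_filter negbK => /andP[].
- by apply/subvP => x /mulv_idl_reg.
- apply/subvP => x; rewrite memv_cap => /andP[Ux Jx].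
  have xj : x * e (v j) = x by have := Ux; rewrite (lidealP eM) => /eqP.
  have Uj : e (v j) \in U by rewrite (lidealP eM) (eMM eM).
  by rewrite -xj; exact: (@mem_mulv _ _ regmod _ _ _ _ Jx Uj).
exists s'; split.
  suff <- : (q @: U)%VS = lideal (e' j) by [].
  apply/vspaceP => y; rewrite (lidealP trunc_idemM); apply/memv_imgP/eqP.
    case=> x; rewrite (lidealP eM) => /eqP xj ->.
    by rewrite qe -qM xj.
  move=> yj; have [a ya] := lift_q y; exists (a * e (v j)).
    exact: mem_lideal.
  by rewrite qM -qe -ya yj.
move=> t; rewrite -v_le -sE.
have -> : count_mem (v t) s = count_mem (v t) [seq t <- s | ~~ ~~ (t <= i)%O].
  rewrite count_filter; apply: eq_count => l /=; rewrite negbK.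
  by case: eqP => // ->; rewrite v_sub.
rewrite s'E count_map; apply: eq_count => l /=.
by rewrite (inj_eq trunc_inj).
Qed.

Variables (v1 vn : V).
Hypothesis v1_min : forall j, (v1 <= j)%O.
Hypothesis vn_max : forall j, (j <= vn)%O.
Hypothesis CP : cog_proj e v1.
Hypothesis GI : gen_inj e v1.
Hypothesis SI : std_inj e vn.
Hypothesis CS : costd_surj e vn.

Lemma descend (f : 'Hom(A, K^o)) : (forall a, a \in idn e i -> f a = 0) ->
  forall a, (f \o q^-1)%VF (q a) = f a.
Proof.
move=> f0 a; rewrite comp_lfunE; apply/eqP; rewrite -subr_eq0 -linearB /= f0 //.
by rewrite -q_ker linearB /= limg_lfunVK ?memv_img ?memvf // subrr.
Qed.

(** The form supplies the socle and top conditions; the maps between standard and costandard modules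
    come from [std_inj_le] and [costd_surj_le], with i as the new largest vertex. *)
Lemma trunc_oqh f : form_at e v1 i f -> one_quasi_hereditary e'.
Proof.
move=> Hf.
apply/(one_quasi_hereditaryP trunc_idemM trunc_idem_sum trunc_idem_neq0 trunc_radical).
have [v1' v1E] := v_img (v1_min i); have [i' iE] := v_img (lexx i).
exists v1', i'; split; last 2 first.
- split=> j.
    have [g [g0 Hg]] := form_cog eM e_sum SL PF v1_min vn_max CP (v j) Hf.
    exists (g \o q^-1)%VF => x'; have [x ->] := lift_q x'.
    rewrite qe -qM => xj Hx; apply/eqP; rewrite -xj q_ker; apply: Hg.
      by rewrite -mulrA (eMM eM).
    by move=> a; rewrite -(descend g0) qM xj [q (_ * a)]qM -v1E -qe; apply: Hx.
  have [g [g0 Hg]] := form_gen eM e_sum SL PF v1_min vn_max CP GI (v j) Hf.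
  exists (g \o q^-1)%VF => x'; have [x ->] := lift_q x'.
  rewrite qe -qM => jx Hx; apply/eqP; rewrite -jx q_ker; apply: Hg.
    by rewrite mulrA (eMM eM).
  by move=> a; rewrite -(descend g0) qM [q (_ * a)]qM jx -v1E -qe; apply: Hx.
- split=> j.
    have [c [jc ci Hc]] := std_inj_le eM SL vn_max SI (v_sub j).
    exists (q c); rewrite !qe -!qM jc iE ci; split=> // a'.
    have [a ->] := lift_q a'; rewrite -!qM !trunc_idn iE; exact: Hc.
  have [c [ic cj Hc]] := costd_surj_le eM e_sum SL PF vn_max CS (v_sub j).
  exists (q c); rewrite !qe -!qM cj iE ic; split=> // a'.
  have [a ->] := lift_q a'; rewrite -!qM !trunc_idn iE; exact: Hc.
- by move=> j; rewrite -!v_le v1E iE v1_min v_sub.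
- exact: trunc_std_line.
- exact: trunc_proj_filt.
Qed.

(** The functional expressing soc A(i) e_1 = S(1), composed with q, is the required form. *)
Lemma oqh_trunc : one_quasi_hereditary e' -> exists f, form_at e v1 i f.
Proof.
move/(one_quasi_hereditaryP trunc_idemM trunc_idem_sum trunc_idem_neq0 trunc_radical).
case=> v1' [vn' [Hm _ _ [CP' _] _]].
have v1E : v v1' = v1.
  have [w wE] := v_img (v1_min i); have /andP[le1 _] := Hm w.
  by apply/eqP; rewrite eq_le v1_min andbT -wE v_le.
have [f Hf] := CP' v1'; exists (f \o q)%VF; split.
  by move=> a; rewrite -q_ker comp_lfunE => /eqP->; rewrite linear0.
move=> x x1 Hx; rewrite -q_ker; apply/eqP; apply: Hf.
  by rewrite qe v1E -qM x1.
move=> a'; have [a ->] := lift_q a'; rewrite qe v1E -!qM.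
by have := Hx a; rewrite comp_lfunE.
Qed.

End DataTransport.
End Transport.

(** * Bound quiver algebras *)

Section BoundQuiver.
Context {K : fieldType} {V : finType} {Q : quiver V} {A : falgType K}.
Variable B : bound_quiver_algebra Q A.
Local Notation e := (idem B).
Local Notation x := (arr B).
Local Notation evp := (ev_path e x).

Lemma bqa_idem_neq0 i : e i != 0.
Proof.
apply/negP => /eqP ei0; have [ker2 _] := ev_ker B.
have ev0 : ev e x << trivpath Q i >> = 0.
  by rewrite /ev mmapU /= /ev_path /= ei0 mulr0.
have := ker2 _ ev0 (trivpath Q i).
by rewrite mcoeffU eqxx oner_eq0 => /(_ isT).
Qed.

(** The last arrow of a path of positive length is its leftmost factor. *)
Lemma bqa_ind (P : A -> Prop) : P 0 ->
  (forall k a b, P a -> P b -> P (k *: a + b)) ->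
  (forall i, P (e i)) -> (forall al b, P (x al * b)) -> forall a, P a.
Proof.
move=> P0 PL Pe Px a; have [u <-] := ev_surj B a.
have Pp p : P (evp p).
  case: p => -[i s] /=; rewrite /ev_path /=; case/lastP: s => [|s al] _; first exact: Pe.
  by rewrite foldl_rcons; apply: Px.
rewrite /ev mmapE; elim/big_ind: _ => // [b c Pb Pc|p _].
  by rewrite -[b]scale1r; apply: PL.
by rewrite mulr_algl -[_ *: _]addr0; apply: PL.
Qed.

Lemma idem_arr i al : e i * x al = if i == tgt al then x al else 0.
Proof.
rewrite -(arrE B al) !mulrA (idemM B); case: eqP => [->//|_].
by rewrite !mul0r.
Qed.

Lemma arr_idem i al : x al * e i = if src al == i then x al else 0.
Proof.
rewrite -(arrE B al) -mulrA (idemM B); case: eqP => // _.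
by rewrite mulr0.
Qed.

Definition arrows_span : {vspace A} := (\sum_(al : arrow Q) <[x al]>)%VS.
Local Notation W := arrows_span.

Lemma mem_arrows al : x al \in W.
Proof. by apply: (subvP (sumv_sup al _ (subvv _))) => //; apply: memv_line. Qed.

Lemma arrows_sub (U : {vspace A}) : (forall al, x al \in U) -> (W <= U)%VS.
Proof. by move=> H; apply/subv_sumP => al _; rewrite -memvE. Qed.

(** By [bqa_ind] a left factor is an idempotent, which fixes or kills an arrow, or itself starts
    with an arrow. This makes W A a two-sided ideal. *)
Lemma fullv_arrows : ({:A} * W <= W * {:A})%VS.
Proof.
have sW : (W <= W * {:A})%VS.
  by apply: arrows_sub => al; rewrite -[x al]mulr1 memv_mul ?mem_arrows ?memvf.
apply/prodvP => a w _ Ww.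
suff : (W <= (amull a) @^-1: (W * {:A}))%VS.
  by move/subvP/(_ _ Ww); rewrite -memv_preim lfunE.
apply: arrows_sub => al; rewrite -memv_preim lfunE /=.
move: a; apply: bqa_ind => [|k a b Ha Hb|i|be b].
- by rewrite mul0r mem0v.
- by rewrite mulrDl -scalerAl memvD ?memvZ.
- by rewrite idem_arr; case: eqP; rewrite ?mem0v // (subvP sW) ?mem_arrows.
- by rewrite -mulrA memv_mul ?mem_arrows ?memvf.
Qed.

Lemma path_arrow al (p : qpath Q) : x al * evp p = 0 \/
  exists p', evp p' = x al * evp p /\ plen p' = (plen p).+1.
Proof.
case: p => -[i s] /= cs.
pose l := last i [seq tgt b | b <- s].
have [sl|sl] := eqVneq (src al) l; last first.
  left; suff -> : evp (exist _ (i, s) cs) = e l * evp (exist _ (i, s) cs).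
    by rewrite mulrA arr_idem (negPf sl) mul0r.
  rewrite /ev_path /= /l; clear l sl; case/lastP: s cs => [|s be] /= cs.
    by rewrite (idemM B) eqxx.
  by rewrite map_rcons last_rcons foldl_rcons mulrA idem_arr eqxx.
have cs' : composable i (rcons s al).
  rewrite /l in sl; clear l; elim: s i cs sl => [|b s IH] i /=.
    by move=> _ ->; rewrite eqxx.
  by case/andP => -> cs sl; apply: IH.
right; exists (exist (fun ip => composable ip.1 ip.2) (i, rcons s al) cs').
by rewrite /ev_path /plen /= foldl_rcons size_rcons.
Qed.

(** The arrow ideal W A works: admissibility gives W^m = 0, and A W inside W A gives (W A)^m inside
    W^m A. *)
Lemma basic_bqa : exists J, is_radical e J.
Proof.
have [_ [m _ kerm]] := ev_ker B.
have evp0 p : (m <= plen p)%N -> evp p = 0.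
  move=> mp; have := kerm << p >>; rewrite /ev mmapU /= scale1r mul1r; apply.
  by move=> p'; rewrite mcoeffU; case: (p =P p') => [<-|]; rewrite ?eqxx.
(* Each arrow multiplied on the left lengthens a path by one or kills it; trivial paths and k = m
   then give W^m = 0. *)
have Wp k : forall p y, (m <= plen p + k)%N -> y \in (W ^+ k)%VS -> y * evp p = 0.
  elim: k => [|k IH] p y mp.
    rewrite expv0 => /vlineP[c ->]; rewrite evp0 ?mulr0 //.
    by rewrite -[plen p]addn0.
  have : (W ^+ k.+1 <= lker (amulr (evp p)))%VS.
    rewrite expvSr; apply/prodvP => u w Wu Ww.
    rewrite memv_ker lfunE /= -mulrA; apply/eqP.
    suff : (W <= lker (amull u \o amulr (evp p)))%VS.
      by move/subvP/(_ _ Ww); rewrite memv_ker comp_lfunE !lfunE => /eqP.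
    apply: arrows_sub => al; rewrite memv_ker comp_lfunE !lfunE /=.
    have [->|[p' [<- p'E]]] := path_arrow al p; first by rewrite mulr0.
    by rewrite IH // p'E addSn -addnS.
  by move/subvP => H /H; rewrite memv_ker lfunE => /eqP.
have Wm : (W ^+ m = 0)%VS.
  apply/eqP; rewrite -subv0; apply/subvP => y Wy.
  rewrite -[y]mulr1 -(idem_sum B) mulr_sumr memv_suml // => i _.
  by rewrite -[e i]/(evp (trivpath Q i)) (Wp m) ?mem0v.
have fW n : ({:A} * (W ^+ n * {:A}) <= W ^+ n * {:A})%VS.
  elim: n => [|n IH]; first by rewrite expv0 prod1v subvf.
  rewrite expvSl !prodvA -[X in (X <= _)%VS]prodvA.
  apply: subv_trans (prodvSl _ fullv_arrows) _.
  by rewrite -!prodvA prodvSr // [(_ * (_ * _))%VS]prodvA.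
exists (W * {:A})%VS; split.
- move=> a y Jy; have : a * y \in ({:A} * (W * {:A}))%VS by rewrite memv_mul ?memvf.
  by have := fW 1%N; rewrite expv1 => /subvP; apply.
- move=> a y Jy; have : y * a \in (W * {:A} * {:A})%VS by rewrite memv_mul ?memvf.
  by apply: subvP; rewrite -prodvA prodvSr ?subvf.
- have H n : ((W * {:A}) ^+ n <= W ^+ n * {:A})%VS.
    elim: n => [|n IH]; first by rewrite !expv0 prod1v subvf.
    rewrite !expvSl -!prodvA; apply: prodvSr.
    by apply: subv_trans (fW n); apply: prodvSr.
  exists m; apply/eqP; rewrite -subv0; apply: subv_trans (H m) _.
  by rewrite Wm prod0v subvv.
move=> a j; move: a; apply: bqa_ind => [|k a b [c1 H1] [c2 H2]|i|al b].
- by exists 0; rewrite mul0r scale0r subrr mem0v.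
- exists (k * c1 + c2); rewrite mulrDl -scalerAl scalerDl -scalerA opprD addrACA.
  by rewrite -scalerBr memvD ?memvZ.
- rewrite (idemM B); case: eqP => [->|_]; first by exists 1; rewrite scale1r subrr mem0v.
  by exists 0; rewrite scale0r subrr mem0v.
- by exists 0; rewrite scale0r subr0 -mulrA memv_mul ?mem_arrows ?memvf.
Qed.

End BoundQuiver.

Local Open Scope order_scope.

Theorem theorem5p1 (K : closedFieldType) (d : Order.disp_t)
    (Q0 : finPOrderType d) (Q : quiver Q0) (A : falgType K)
    (B : bound_quiver_algebra Q A)
    (hA : one_quasi_hereditary (idem B))
    (v1 : Q0) (v1_min : forall j : Q0, v1 <= j)
    (i : Q0) (T : lmodule A) (hT : tilting_at (idem B) i T) :
  [<-> one_quasi_hereditary (trunc_idem B (i := i));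
       isom T (quotmod (sumP (idem B) v1 i));
       isom T (submod (capKer (idem B) v1 i));
       simple_mod (submod (soc T));
       simple_mod (top T)].
Proof.
have eM := idemM B; have e_sum := idem_sum B.
have e_neq0 := bqa_idem_neq0 B; have [J JP] := basic_bqa B.
have smP := filt_mult_SmodP eM e_sum e_neq0 JP.
have /(one_quasi_hereditaryP eM e_sum e_neq0 JP)[w [vn [wn SL PF [CP0 GI0] [SI CS]]]] := hA.
have vn_max j : j <= vn by case/andP: (wn j).
have wE : w = v1 by apply/eqP; rewrite eq_le v1_min andbT; case/andP: (wn v1).
have CP : cog_proj (idem B) v1 by rewrite -wE.
have GI : gen_inj (idem B) v1 by rewrite -wE.
have [indT _ HT0 [[s [Fs0 _]] [s' [Fs'0 s'i]] /smP dTi]] := hT.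
have T0 l : ~~ (l <= i) -> forall x : T, act (idem B l) x = 0.
  by move=> /HT0[_ _ /smP/ecmp_eq0].
have dT := indT.1.
have Fs := filtered_full eM e_sum e_neq0 JP Fs0.
have Fs' := filtered_full_nabla eM e_sum e_neq0 JP Fs'0.
have is' : i \in s' by rewrite -has_pred1 has_count s'i.
pose q : 'Hom(A, trunc_alg B i) := qproj (trunc_ideal B i).
have qM a b : q (a * b) = q a * q b by apply: qproj_mul.
have q1 : q 1 = 1 by [].
have qS : limg q = fullv by apply: eq_fullv => y; rewrite -[y]qproj_val memv_img ?memvf.
have qk a : (q a == 0) = (a \in idn (idem B) i) by apply: qproj_eq0.
have qe j : trunc_idem B (i := i) j = q (idem B (val j)) by [].
have vle (j k : lower i) : (val j <= val k)%O = (j <= k)%O by [].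
have vim k : k <= i -> exists j : lower i, val j = k.
  by move=> ki; exists (exist _ k ki).
have vsub (j : lower i) : val j <= i by case: j.
have gen_cog := generated_cogenerated eM e_sum JP SL PF v1_min vn_max CP SI CS T0 Fs Fs' is'.
have gen_cyc := generated_cyc_gen eM e_sum SL PF v1_min vn_max CS T0 Fs Fs' is'.
have cyc_gen0 (t : T) : cyc_gen (idem B) v1 i t -> generated (idem B) v1 T.
  by case=> tE ct _; exists t.
have iso_ii := isom_sumP eM e_sum SL PF vn_max CP i T.
(* The implications are proved in a cycle: (i), (ii), (ii'), (iii), (iii'), (i). *)
split.
  move/(oqh_trunc eM e_sum JP qM q1 qS qk qe vle vim vsub SL v1_min) => [f Hf].
  apply/iso_ii.
  exact: (form_cyc_gen eM e_sum JP SL PF v1_min vn_max CP GI SI CS T0 Fs Fs' dTi indT Hf).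
split.
  move/iso_ii => [t Ht].
  apply: (isom_capKer eM e_sum SL PF vn_max CP GI T0 Ht).
  exact/gen_cog/(cyc_gen0 t).
split.
  move=> /(isom_capKer_cog eM) cT.
  exact: (cogenerated_soc_isom eM e_sum e_neq0 JP dT cT).2.
split.
  move=> /(simple_soc_count eM e_sum JP SL v1_min Fs') c1.
  rewrite -(count_dfil_nfil eM e_sum SL PF Fs Fs') in c1.
  have gT := count_generated eM e_sum JP vn_max GI CS Fs Fs' c1.
  exact: (generated_top eM e_sum e_neq0 JP dT gT).2.
move=> sT.
have gT : generated (idem B) v1 T.
  (* The Nabla-filtration makes e_1 T generate T, so the simple top has a representative at v1. *)
  apply: (simple_top_generated sT) => W sW HW; apply: eq_fullv => y.
  apply: (subvP (nfil_gen eM vn_max GI CS Fs' sW _ (@stable_full _ _ T))) (memvf y).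
  by move=> z _; apply: HW.
have [t Ht] := gen_cyc gT.
have [f [Hf _]] := cyc_gen_form T0 Ht (gen_cog gT).
exact: (trunc_oqh eM e_sum JP qM q1 qS qk qe vle vim vsub SL PF v1_min vn_max CP GI SI CS Hf).
Qed.
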